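(* Let $\mathcal{G}$ be a negative definite weighted graph. If $\varphi$ is an automorphism of $\mathcal{G}$ not fixing an essential vertex $u$, then there is no adjacency from $u$ to $\varphi(u)$.
   Context: A weighted graph is a finite connected graph whose vertices carry a genus weight and a self-intersection weight; automorphisms preserve both weights. It is negative definite if its incidence matrix (self-intersection weights on the diagonal, numbers of edges between distinct vertices off the diagonal) is negative definite; these are exactly the dual graphs of good resolutions of normal surface singularities (vertices = irreducible components $E_i$ of the exceptional divisor, weighted by genus and self-intersection; edges = intersection points). Let $(X,O)$ be a normal surface singularity over an algebraically closed field $\mathbb{K}$ of characteristic $0$ with a good resolution $\pi:\tilde X\to X$ with dual graph $\mathcal{G}$. $\mathcal{X}_\infty$ is the affine $\mathbb{K}$-scheme representing the functor sending $\operatorname{Spec}A$ to the set of morphisms $\operatorname{Spec}A[[t]]\to X$ sending $V(t)$ to $O$; its points are arcs, and arcs not identically $O$ lift uniquely to $\tilde X$. $N_{E_u}$ is the set of arcs whose lifting sends the closed point into $E_u$. There is an adjacency from $u$ to $v$ if $N_{E_v}$ is contained in the Zariski closure of $N_{E_u}$ in $\mathcal{X}_\infty$; this depends only on $\mathcal{G}$ and not on the choice of $(X,O)$. A vertex $u$ is essential if $E_u$ is an essential component, i.e. for every other resolution its birational transform is an irreducible component of the exceptional divisor. *)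

(* Defs.v *)
(* Integral schemes are handled in the language of Zariski and Chevalley
   (EGA I, section 8): a separated integral scheme Z of finite type over K with
   function field F is identified with the set of its local rings O_(Z,z),
   which are subrings of F with fraction field F.  The field F itself is the
   local ring of the generic point, and z' is a specialization of z iff
   O_(Z,z') is contained in O_(Z,z).  Function fields are identified along
   birational morphisms, and a birational morphism Z -> X sends a local ring
   of Z to the unique local ring of X which it dominates.

   Subrings of F, and ideals of such subrings, are sets of elements of F. *)
From HB Require Import structures.
From mathcomp Require Import all_boot all_order all_fingroup all_algebra.
From mathcomp Require Import all_classical.
From mathcomp Require Export reals.

Set Implicit Arguments.
Unset Strict Implicit.
Unset Printing Implicit Defensive.

Import Order.TTheory GRing.Theory Num.Theory.
Local Open Scope card_scope.
Local Open Scope classical_set_scope.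
Local Open Scope ring_scope.

(* Multiple edges are recorded by their number.  There are no loops, since the
   components of the exceptional divisor of a good resolution are smooth. *)
Record weighted_graph := WeightedGraph {
  vertex :> finType;
  edges : vertex -> vertex -> nat;
  genus : vertex -> nat;
  selfint : vertex -> int;
  edges_sym : forall u v, edges u v = edges v u;
  edges_irr : forall u, edges u u = 0%N;
  edges_conn : forall u v, connect (fun x y => 0 < edges x y)%N u v }.

Definition incidence (G : weighted_graph) : 'M[int]_#|G| :=
  \matrix_(i, j) if i == j then selfint (enum_val i)
                 else (edges (enum_val i) (enum_val j))%:Z.

Definition negative_definite (R : realType) (G : weighted_graph) :=
  forall x : 'rV[R]_#|G|, x != 0 ->
    (x *m map_mx intr (incidence G) *m x^T) 0 0 < 0.

Definition graph_automorphism (G : weighted_graph) (phi : {perm G}) :=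
  [/\ forall u v, edges (phi u) (phi v) = edges u v,
      forall u, genus (phi u) = genus u &
      forall u, selfint (phi u) = selfint u].

Section Subrings.
Variable T : comNzRingType.
Implicit Types S I P : set T.

Definition subring S :=
  S 1 /\ forall x y, S x -> S y -> S (x - y) /\ S (x * y).

Definition ideal_of S I :=
  [/\ I `<=` S, I 0, forall x y, I x -> I y -> I (x + y) &
      forall a x, S a -> I x -> I (a * x)].

Definition prime_of S P :=
  [/\ ideal_of S P, ~ P 1 &
      forall x y, S x -> S y -> P (x * y) -> P x \/ P y].

Definition maximal_of S P :=
  [/\ ideal_of S P, ~ P 1 &
      forall I, ideal_of S I -> P `<=` I -> ~ I 1 -> I = P].

Definition prime_chain S (n : nat) (Q : nat -> set T) :=
  (forall i, (i <= n)%N -> prime_of S (Q i)) /\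
  (forall i, (i < n)%N -> Q i `<` Q i.+1).

Definition krull_dim S (n : nat) :=
  (exists Q, prime_chain S n Q) /\ ~ (exists Q, prime_chain S n.+1 Q).

Definition span_ideal S (d : nat) (s : 'I_d -> T) : set T :=
  [set x | exists2 c : 'I_d -> T, forall i, S (c i) & x = \sum_i c i * s i].

End Subrings.

Section Models.
Variables (K : closedFieldType) (F : fieldType) (iota : {rmorphism K -> F}).
Implicit Types S R V A P m : set F.

Definition subalgebra S := subring S /\ forall c, S (iota c).

Definition affine_ring S :=
  [/\ subalgebra S,
      exists s : seq F, forall x, S x <->
        (forall S', subalgebra S' -> (forall y, y \in s -> S' y) -> S' x) &
      forall z, exists a b, [/\ S a, S b, b != 0 & z = a / b]].

Definition localization S P : set F :=
  [set z | exists a b, [/\ S a, S b, ~ P b & z = a / b]].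

(* The maximal ideal of a local ring: its non-units. *)
Definition maxid S : set F := [set x | S x /\ (x = 0 \/ ~ S x^-1)].

Definition spec_rings S : set (set F) :=
  [set R | exists2 P, prime_of S P & R = localization S P].

Definition valuation_ring V := subalgebra V /\ forall x, V x \/ V x^-1.

Definition dominates V R := R `<=` V /\ maxid R `<=` maxid V.

(* Local rings of a separated integral scheme of finite type over K with
   function field F: a finite union of affine pieces, on which every valuation
   ring of F has at most one center. *)
Definition scheme_model (M : set (set F)) :=
  (exists2 s : seq (set F), forall S, S \in s -> affine_ring S &
     M = [set R | exists2 S, S \in s & spec_rings S R]) /\
  (forall V R1 R2, valuation_ring V -> M R1 -> M R2 ->
     dominates V R1 -> dominates V R2 -> R1 = R2).

Definition regular_local S :=
  exists2 d : nat, krull_dim S d &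
    exists s : 'I_d -> F, maxid S = span_ideal S s.

Definition integrally_closed S :=
  forall (x : F) (p : {poly F}),
    p \is monic -> (forall i, S p`_i) -> root p x -> S x.

(* X = Spec A, and O is the closed point given by the maximal ideal mO. *)
Definition normal_surface_singularity A mO :=
  [/\ affine_ring A, integrally_closed A, krull_dim A 2 & maximal_of A mO].

Section Resolutions.
Variables (A mO : set F).

Definition over_O R := maxid R `&` A = mO.

(* Proper birational morphisms M -> Spec A with M smooth, which are
   isomorphisms over the complement of O.  Properness is the valuative
   criterion, whose uniqueness part is contained in scheme_model. *)
Definition resolution (M : set (set F)) :=
  [/\ scheme_model M,
      forall R, M R -> A `<=` R,
      forall V, valuation_ring V -> A `<=` V ->
        exists2 R, M R & dominates V R,
      forall R, M R -> regular_local R &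
      forall R, (M R /\ ~ over_O R) <->
        (spec_rings A R /\ R <> localization A mO)].

(* The irreducible components of the exceptional divisor, each represented by
   the local ring of its generic point. *)
Definition exceptional (M : set (set F)) : set (set F) :=
  [set R | [/\ M R, over_O R & krull_dim R 1]].

(* The closed points of the component with generic local ring R. *)
Definition points_on (M : set (set F)) R : set (set F) :=
  [set S | [/\ M S, S `<=` R & krull_dim S 2]].

(* The ideal in S of the component with generic local ring R. *)
Definition component_ideal R S : set F := maxid R `&` S.

Definition principal S (x : F) : set F := [set z | exists2 a, S a & z = a * x].

(* The exceptional divisor has simple normal crossings. *)
Definition good_resolution (M : set (set F)) :=
  resolution M /\
  forall S, M S -> over_O S -> krull_dim S 2 ->
    exists x y : F,
      [/\ S x, S y,
          maxid S = [set z | exists a b, [/\ S a, S b & z = a * x + b * y]] &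
          forall R, exceptional M R -> S `<=` R ->
            component_ideal R S = principal S x \/
            component_ideal R S = principal S y].

(* The component E with generic local ring R is a smooth complete curve with
   function field R / maxid R, whose local ring at S is
   S / component_ideal R S. *)

(* t restricts to a uniformizer of E at S. *)
Definition curve_uniformizer R S (t : F) :=
  S t /\
  maxid S = [set z | exists a b,
               [/\ S a, component_ideal R S b & z = a * t + b]].

(* The restriction of f to E is nonzero, of order n at S. *)
Definition curve_ord R S (f : F) (n : int) :=
  exists t u : F,
    [/\ curve_uniformizer R S t, S u, u != 0, S u^-1 &
        maxid R (f - u * t ^ n)].

(* The Riemann-Roch space L(D), as a subset of R containing maxid R. *)
Definition rr_space M R (D : set F -> int) : set F :=
  [set f | R f /\ (maxid R f \/
     forall S, points_on M R S -> exists2 n, curve_ord R S f n & - D S <= n)].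

Definition quotient_dim (W N : set F) (n : nat) :=
  exists2 b : 'I_n -> F, forall i, W (b i) &
    forall w, W w ->
      exists! c : 'rV[K]_n, N (w - \sum_i iota (c 0 i) * b i).

Definition divisor_on M R (D : set F -> int) :=
  finite_set (points_on M R `&` [set S | D S != 0]).

Definition divisor_degree M R (D : set F -> int) : int :=
  \sum_(S \in points_on M R) D S.

(* g = max { deg D + 1 - dim L(D) : D a divisor on E } *)
Definition curve_genus M R (g : nat) :=
  (forall D l, divisor_on M R D -> quotient_dim (rr_space M R D) (maxid R) l ->
     divisor_degree M R D + 1 - l%:Z <= g%:Z) /\
  (exists D l, [/\ divisor_on M R D,
     quotient_dim (rr_space M R D) (maxid R) l &
     divisor_degree M R D + 1 - l%:Z = g%:Z]).

(* E.E is minus the degree on E of the conormal bundle O(-E)|_E.  The latter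
   is computed from the rational section defined by an f in F vanishing to
   order exactly 1 along E: at S it is f / x times the local generator given
   by an equation x of E. *)
Definition self_intersection M R (b : int) :=
  exists (f : F) (n : set F -> int),
    [/\ maxid R = principal R f,
        forall S, points_on M R S -> exists2 x,
          component_ideal R S = principal S x & curve_ord R S (f / x) (n S),
        divisor_on M R n &
        b = - divisor_degree M R n].

(* G is the dual graph of M, the vertex v corresponding to the component with
   generic local ring E v. *)
Definition is_dual_graph (G : weighted_graph) M (E : G -> set F) :=
  [/\ set_bij setT (exceptional M) E,
      forall v, curve_genus M (E v) (genus v),
      forall v, self_intersection M (E v) (selfint v) &
      forall u v, u != v ->
        (points_on M (E u) `&` points_on M (E v)) #= `I_(edges u v)].

(* The center of E_u on every resolution is an exceptional component. *)
Definition essential R :=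
  forall M, resolution M -> exists2 R', exceptional M R' & dominates R R'.

Section Arcs.

(* Ring morphisms S -> C[[t]]; g x n is the coefficient of t^n in g x, and the
   values of g outside S are irrelevant. *)
Definition fps_morphism_on S (C : comNzRingType) (g : F -> nat -> C) :=
  [/\ forall n, g 1 n = (n == 0%N)%:R,
      forall x y, S x -> S y -> forall n, g (x + y) n = g x n + g y n &
      forall x y, S x -> S y -> forall n,
        g (x * y) n = \sum_(i < n.+1) g x i * g y (n - i)%N].

(* K-morphisms Spec C[[t]] -> X sending V(t) to O, that is, whose restriction
   to Spec C factors through the reduced point O. *)
Definition arc (C : comAlgType K) (g : F -> nat -> C) :=
  [/\ fps_morphism_on A g,
      forall c n, g (iota c) n = if n == 0%N then c%:A else 0 &
      forall a, mO a -> g a 0%N = 0].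

(* Spec B, with universal arc U, is the arc space X_oo. *)
Definition represents_arcs (B : comAlgType K) (U : F -> nat -> B) :=
  arc U /\
  forall (C : comAlgType K) (g : F -> nat -> C), arc g ->
    exists2 h : {lrmorphism B -> C},
      forall a n, A a -> g a n = h (U a n) &
      forall h' : {lrmorphism B -> C},
        (forall a n, A a -> g a n = h' (U a n)) -> h' =1 h.

Variables (B : comAlgType K) (U : F -> nat -> B).

Definition spec_point (p : set B) := prime_of setT p.

(* L, with h : B -> L, is the residue field of Spec B at p. *)
Definition residue_field (p : set B) (L : fieldType) (h : {rmorphism B -> L}) :=
  (forall b, h b = 0 <-> p b) /\ forall z, exists a b, z = h a / h b.

(* N_E: the arcs, not identically O, whose lifting to M sends the closed point
   to a point S of E.  A morphism from Spec L[[t]] to M is a point S of M with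
   a local morphism S -> L[[t]]. *)
Definition arcs_through M R : set (set B) :=
  [set p | spec_point p /\
    exists (L : fieldType) (h : {rmorphism B -> L}),
      [/\ residue_field p h,
          exists a n, mO a /\ h (U a n) <> 0 &
          exists S (g : F -> nat -> L),
            [/\ M S /\ S `<=` R, fps_morphism_on S g,
                forall x, maxid S x -> g x 0%N = 0 &
                forall a n, A a -> g a n = h (U a n)]]].

Definition zariski_closure (Z : set (set B)) : set (set B) :=
  [set q | spec_point q /\
    forall I : set B, (forall p, Z p -> I `<=` p) -> I `<=` q].

Definition adjacency M (R R' : set F) :=
  arcs_through M R' `<=` zariski_closure (arcs_through M R).

End Arcs.
End Resolutions.
End Models.

(* Main.v *)
(* Write ord_w for the order of vanishing along E_w, let v = phi u and, for an
   effective exceptional cycle W, let I(W) be the ideal of all h in A with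
   ord_w h >= W_w for all w.  A function of order >= k along E_u has vanishing
   coefficients below t^k on all arcs through E_u, hence on all arcs in their
   closure; since arcs through E_v transversal at general points compute ord_v,
   an adjacency from u to v implies ord_u <= ord_v on A.

   The negative definite intersection form is invariant under phi, so that the
   cycle x with x.E_u = -N < 0 and x.E_i = 0 for i != u satisfies x_u > x_v:
   there is a cycle D, antinef together with D + E_v, such that D_u > D_v.  Then
   I(nD) = I(nD + nE_v).  Let Z be the exceptional part of div f for some f != 0
   in mO.  By the degree of O(-W) on the components, dim I(W)/I(W + E_i) is at
   most max(0, 1 - W.E_i); adding these steps up from 0 to nD and from n(D + E_v)
   to n lambda Z, and using that the step in between is free, dim A/I(n lambda Z)
   is at most -(n lambda Z)^2/2 - n^2/2 + O(n).  On the other hand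
   dim A/I(kZ) - dim A/I((k-1)Z) = dim A/(I(kZ) + fA) is computed on the curve
   f = 0 and is at least -k Z^2 - O(1), so that dim A/I(n lambda Z) is at least
   -(n lambda Z)^2/2 - O(n): a contradiction for large n. *)
Require Import Defs.
From mathcomp Require Import all_boot all_order all_fingroup all_algebra.
From mathcomp Require Import all_classical reals.
From mathcomp Require Import ring zify.

Set Implicit Arguments.
Unset Strict Implicit.
Unset Printing Implicit Defensive.

Import Order.TTheory GRing.Theory Num.Theory.
Local Open Scope classical_set_scope.
Local Open Scope ring_scope.

(** * Subrings and valuation rings *)

(** The comparison is quadratic in n. Both bounds on dim A/I(n lambda Z) have the same leading term
    and a linear error, so they cannot absorb a saving of order n^2. The saving is what the degree
    count would charge for the step from nD to n(D + E_v), half of n^2 (-2 D.E_v - E_v^2); the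
    bracket is at least 1, as D is antinef and E_v^2 < 0. The step costs nothing because elements of
    I(nD) have order at least n D_u >= n (D_v + 1) along E_u, hence along E_v.

    For x_u > x_v, let y be the image of x under phi, which is dual to v as x is to u. Symmetry of
    the form gives y_u = x_v, invariance gives y_v = x_u, and 0 > (x - y)^2 = -2N (x_u - x_v).

    Uniformity in n shapes both estimates. The upper bound climbs by n copies of one fixed cycle,
    each started at an antinef cycle, so every copy has the same error. In the lower bound the
    defect of A in the truncated local rings must be bounded independently of the truncation;
    multipliers from A, chosen outside each branch of the strict transform, achieve this. Dimension
    theory rests on valuation rings and transcendence degree. *)

Section SubringTheory.
Variable F : fieldType.
Implicit Types (S D I J V : set F) (x y z : F) (p q : {poly F}).

Definition coefs_in S p := forall i, S p`_i.

(** Finite sums of products whose two factors satisfy a relation. A relation rather than two sets,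
    because in [separated_unit] the condition couples the factors. *)
Inductive lspan (P : F -> F -> Prop) : F -> Prop :=
| lspan0 : lspan P 0
| lspanD a b y : P a b -> lspan P y -> lspan P (a * b + y).

Lemma lspan_mem (P : F -> F -> Prop) a b : P a b -> lspan P (a * b).
Proof. by move=> h; rewrite -[a * b]addr0; apply: lspanD h (lspan0 _). Qed.

Lemma lspan_add (P : F -> F -> Prop) x y :
  lspan P x -> lspan P y -> lspan P (x + y).
Proof.
move=> hx hy; elim: hx => [|a b z h _ IH]; first by rewrite add0r.
by rewrite -addrA; apply: lspanD.
Qed.

Lemma lspan_map (P Q : F -> F -> Prop) c :
  (forall a b, P a b -> lspan Q (c * (a * b))) ->
  forall x, lspan P x -> lspan Q (c * x).
Proof.
move=> h x; elim=> [|a b y hab _ IH]; first by rewrite mulr0; apply: lspan0.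
by rewrite mulrDr; apply: lspan_add IH; apply: h.
Qed.

Lemma lspan_sub (P : F -> F -> Prop) J :
  J 0 -> (forall x y, J x -> J y -> J (x + y)) ->
  (forall a b, P a b -> J (a * b)) -> lspan P `<=` J.
Proof. by move=> J0 JD JP x; elim=> // a b y h _; apply: JD; apply: JP. Qed.

Section Closed.
Variables (S : set F) (hS : subring S).

Lemma subring1 : S 1. Proof. by case: hS. Qed.
Lemma subringB x y : S x -> S y -> S (x - y).
Proof. by case: hS => _ h /h{}h /h[]. Qed.
Lemma subringM x y : S x -> S y -> S (x * y).
Proof. by case: hS => _ h /h{}h /h[]. Qed.
Lemma subring0 : S 0.
Proof. by rewrite -(subrr 1); apply: subringB; apply: subring1. Qed.
Lemma subringN x : S x -> S (- x).
Proof. by rewrite -sub0r; apply: subringB; apply: subring0. Qed.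
Lemma subringD x y : S x -> S y -> S (x + y).
Proof. by move=> hx hy; rewrite -[y]opprK; apply/subringB/subringN. Qed.
Lemma subringX x n : S x -> S (x ^+ n).
Proof.
by move=> hx; elim: n => [|n IH]; [apply: subring1 | rewrite exprS; apply: subringM].
Qed.
Lemma subring_sum (I : Type) (r : seq I) (Q : pred I) (f : I -> F) :
  (forall i, Q i -> S (f i)) -> S (\sum_(i <- r | Q i) f i).
Proof. by move=> h; apply: big_ind => //; [exact: subring0|exact: subringD]. Qed.
Lemma subring_prod (I : Type) (r : seq I) (Q : pred I) (f : I -> F) :
  (forall i, Q i -> S (f i)) -> S (\prod_(i <- r | Q i) f i).
Proof. by move=> h; apply: big_ind => //; [exact: subring1|exact: subringM]. Qed.
Lemma subring_horner p x : coefs_in S p -> S x -> S p.[x].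
Proof.
move=> hp hx; rewrite horner_coef; apply: subring_sum => i _.
by apply: subringM; [apply: hp | apply: subringX].
Qed.

Lemma coefs_inC c : S c -> coefs_in S c%:P.
Proof. by move=> hc i; rewrite coefC; case: ifP => // _; apply: subring0. Qed.
Lemma coefs_inX : coefs_in S 'X.
Proof. by move=> i; rewrite coefX; case: eqP => _; [apply: subring1 | apply: subring0]. Qed.
Lemma coefs_inD p q : coefs_in S p -> coefs_in S q -> coefs_in S (p + q).
Proof. by move=> hp hq i; rewrite coefD; apply: subringD. Qed.
Lemma coefs_inB p q : coefs_in S p -> coefs_in S q -> coefs_in S (p - q).
Proof. by move=> hp hq i; rewrite coefB; apply: subringB. Qed.
Lemma coefs_inM p q : coefs_in S p -> coefs_in S q -> coefs_in S (p * q).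
Proof.
by move=> hp hq i; rewrite coefM; apply: subring_sum => j _; apply: subringM.
Qed.

Lemma lspan_ideal (P : F -> F -> Prop) :
  (forall a b, P a b -> S (a * b)) ->
  (forall c a b, S c -> P a b -> lspan P (c * (a * b))) ->
  ideal_of S (lspan P).
Proof.
move=> h1 h2; split.
- by apply: lspan_sub => //; [apply: subring0 | apply: subringD].
- exact: lspan0.
- exact: lspan_add.
- by move=> c x hc; apply: lspan_map => a b; apply: h2.
Qed.

Definition adjoin x : set F := [set z | exists2 p, coefs_in S p & z = p.[x]].

Lemma adjoin_subring x : subring (adjoin x).
Proof.
split.
  by exists 1%:P; rewrite ?hornerC //; apply: coefs_inC; apply: subring1.
move=> _ _ [p hp ->] [q hq ->]; split.
  by exists (p - q); rewrite ?hornerD ?hornerN //; apply: coefs_inB.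
by exists (p * q); rewrite ?hornerM //; apply: coefs_inM.
Qed.

Lemma adjoin_sub x : S `<=` adjoin x.
Proof. by move=> a ha; exists a%:P; [apply: coefs_inC | rewrite hornerC]. Qed.

Lemma adjoin_mem x : adjoin x x.
Proof. by exists 'X; [apply: coefs_inX | rewrite hornerX]. Qed.

End Closed.

Definition gen_ideal S I := lspan (fun a b => S a /\ I b).

Lemma gen_ideal_ideal S I : subring S -> I `<=` S -> ideal_of S (gen_ideal S I).
Proof.
move=> hS hI; apply: lspan_ideal => //.
  by move=> a b [ha /hI hb]; apply: subringM.
move=> c a b hc [ha hb]; rewrite mulrA; apply: lspan_mem.
by split=> //; apply: subringM.
Qed.

Lemma gen_ideal_id S I : ideal_of S I -> gen_ideal S I `<=` I.
Proof.
case=> _ I0 ID IM; apply: lspan_sub => // a b [ha hb]; exact: IM.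
Qed.

Lemma idealN S I x : subring S -> ideal_of S I -> I x -> I (- x).
Proof.
move=> hS [_ _ _ IM] hx; rewrite -mulN1r; apply: IM => //.
by apply: subringN => //; apply: subring1.
Qed.

Lemma idealB S I x y : subring S -> ideal_of S I -> I x -> I y -> I (x - y).
Proof.
by move=> hS hI hx hy; case: (hI) => _ _ ID _; apply: ID => //; apply: idealN hI hy.
Qed.

Lemma ideal_sum S I (T : Type) (r : seq T) (Q : pred T) (f : T -> F) :
  ideal_of S I -> (forall i, Q i -> I (f i)) -> I (\sum_(i <- r | Q i) f i).
Proof. by case=> _ I0 ID _ h; apply: big_ind. Qed.

(* Used with J the extension of I to S: if 1 belongs both to J[x] and to
   J[1/x], then the leading term of the longer relation can be eliminated. *)
Lemma unit_relation S J x : subring S -> ideal_of S J -> x != 0 ->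
  forall N p q, coefs_in J p -> coefs_in J q -> p.[x] = 1 -> q.[x^-1] = 1 ->
  (size p + size q <= N)%N -> J 1.
Proof.
move=> hS hJ + N; elim: N x => [|N IH] x x0 p q hp hq px qx.
  rewrite leqn0 addn_eq0 size_poly_eq0 => /andP[/eqP p0 _].
  by move: px; rewrite p0 horner0 => /eqP; rewrite eq_sym oner_eq0.
wlog hpq : x x0 p q hp hq px qx / (size q <= size p)%N.
  move=> wl; have [|lt_pq] := leqP (size q) (size p); first exact: wl px qx.
  rewrite addnC; apply: (wl x^-1); rewrite ?invr_eq0 ?invrK //; exact: ltnW.
case: (hJ) => JS J0 JD JM => hN.
have q0 : (0 < size q)%N.
  rewrite lt0n size_poly_eq0; apply/eqP => q0.
  by move: qx; rewrite q0 horner0 => /eqP; rewrite eq_sym oner_eq0.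
have [q1|q1] := leqP (size q) 1.
  by move: qx; rewrite (size1_polyC q1) hornerC => <-; apply: hq.
set n := (size p).-1; set m := (size q).-1.
have sp : size p = n.+1 by rewrite /n prednK //; apply: leq_trans hpq.
have sq : size q = m.+1 by rewrite /m prednK.
have m0 : (0 < m)%N by rewrite -ltnS -sq.
have mn : (m <= n)%N by rewrite -ltnS -sq -sp.
have S1 := subring1 hS.
(* The reversal of [q] without its constant term: multiplying q(1/x) = 1 by x^m turns it into r(x) =
   (1 - q_0) x^m. *)
pose r := \poly_(k < m) q`_(m - k).
have rx : r.[x] = x ^+ m * (1 - q`_0).
  rewrite horner_poly -[in RHS]qx horner_coef sq big_ord_recl expr0 mulr1.
  rewrite addrC addKr mulr_sumr (reindex_inj rev_ord_inj) /=.
  apply: eq_bigr => i _; rewrite /bump /= add1n subKn //.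
  by rewrite mulrCA exprVn -expfB_cond ?(negPf x0) //; apply: ltn_ord.
(* The relation [p] times 1 - q_0, with the leading term traded for a multiple of [r] of degree
   below n; adding q_0 restores the value 1 at [x]. *)
pose p' := (1 - q`_0) *: (p - p`_n *: 'X^n) + p`_n *: ('X^(n - m) * r) + (q`_0)%:P.
suff [hp' px' sp'] : [/\ coefs_in J p', p'.[x] = 1 & (size p' <= n)%N].
  by apply: (IH x x0 p' q) => //; rewrite -ltnS; apply: leq_trans hN; rewrite ltn_add2r sp ltnS.
split.
- move=> i; rewrite !(coefD, coefZ, coefC, coefN, coefXn, coefXnM) coef_poly.
  apply: (JD); first apply: (JD).
  + apply: (JM); first by apply: subringB => //; apply: JS.
    apply: (idealB hS hJ) => //; case: eqP => _; rewrite ?mulr1 ?mulr0 //.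
  + case: ifP => _; first by rewrite mulr0.
    by case: ifP => _; rewrite ?mulr0 //; apply: JM => //; apply: JS.
  + by case: ifP.
- rewrite !(hornerD, hornerZ, hornerC, hornerN, hornerXn, hornerM) px rx.
  rewrite (mulrA (x ^+ (n - m))) -exprD subnK //; ring.
- rewrite /p'; apply/leq_sizeP => j hj.
  rewrite !(coefD, coefZ, coefC, coefN, coefXn, coefXnM) coef_poly.
  have j0 : (j == 0)%N = false by apply/negbTE; rewrite -lt0n; apply: leq_trans hj; apply: leq_trans mn.
  rewrite j0 addr0 [X in if _ then _ else X]ifF; last first.
    by apply/negbTE; rewrite -leqNgt -(leq_add2r (n - m)) subnK ?(leq_trans _ hj) ?leq_subr // subnKC.
  rewrite if_same mulr0 addr0; case: (ltngtP n j) hj => // [nj|->] _.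
    by rewrite [p`_j]nth_default ?sp //= mulr0 subrr mulr0.
  by rewrite mulr1 subrr mulr0.
Qed.

(** Zorn's lemma gives a largest ring A over D in which I still generates a proper ideal. If neither
    x nor 1/x were in A, adjoining either would make I generate 1, and the two polynomial relations
    would contradict [unit_relation]. *)
Lemma chevalley D I : subring D -> ideal_of D I -> ~ I 1 ->
  exists V, [/\ subring V, D `<=` V, forall x, V x \/ V x^-1 & I `<=` maxid V].
Proof.
move=> hD hI I1; have ID : I `<=` D by case: hI.
pose good X := [/\ subring X, D `<=` X & ~ gen_ideal X I 1].
have [|A [[A0|[hA DA A1]] maxA]] := @Zorn_bigcup F (fun X => X = set0 \/ good X).
- move=> C CP Ctot; case: (pselect (exists2 X, C X & X !=set0)); last first.
    move=> h; left; apply/seteqP; split=> // x [X CX Xx]; case: h; exists X => //.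
    by exists x.
  have goodC X x : C X -> X x -> good X.
    by move=> /CP[-> //|].
  case=> X0 CX0 [x0 X0x0]; right; split.
  + split; first by exists X0 => //; case: (goodC _ _ CX0 X0x0) => -[].
    move=> x y [X CX Xx] [Y CY Yy].
    have {X Y CX CY Xx Yy} [Z [CZ Zx Zy]] : exists Z, [/\ C Z, Z x & Z y].
      by case: (Ctot _ _ CX CY) => h; [exists Y|exists X]; split=> //; apply: h.
    have [hZ _ _] := goodC _ _ CZ Zx.
    by split; exists Z => //; [apply: subringB|apply: subringM].
  + by move=> x Dx; exists X0 => //; have [_ h _] := goodC _ _ CX0 X0x0; apply: h.
  + suff h z : gen_ideal (\bigcup_(X in C) X) I z -> exists2 X, C X & gen_ideal X I z /\ X 0.
      move=> /h[X CX [X1 Xz]]; by have [_ _] := goodC _ _ CX Xz.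
    elim=> [|a b y [[X CX Xa] Ib] _ [Y CY [Yy Y0]]].
      exists X0 => //; split; first exact: lspan0.
      by have [hX _ _] := goodC _ _ CX0 X0x0; apply: subring0.
    case: (Ctot _ _ CX CY) => h.
      exists Y => //; split => //; apply: lspanD => //; split=> //; exact: h.
    exists X => //; split; last exact: h.
    apply: lspanD => //; elim: Yy => [|a' b' y' [Ya' Ib'] _]; first exact: lspan0.
    by apply: lspanD; split => //; apply: h.
- case: (maxA D); first rewrite A0.
    split=> //; move=> /(_ 1); apply; exact: subring1.
  right; split=> // /(gen_ideal_id hI); exact: I1.
have hIA : ideal_of A (gen_ideal A I) by apply: gen_ideal_ideal => // x /ID /DA.
have key x : ~ A x -> exists2 p, coefs_in (gen_ideal A I) p & p.[x] = 1.
  move=> Ax; have : ~ good (adjoin A x).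
    move=> h; apply: (maxA (adjoin A x)); last by right.
    split; first exact: adjoin_sub.
    by move=> /(_ x) h'; apply/Ax/h'; apply: adjoin_mem.
  move=> h; case: (pselect (gen_ideal (adjoin A x) I 1)) => [{}h|h1]; last first.
    case: h; split=> //; first exact: adjoin_subring.
    by move=> a /DA; apply: adjoin_sub.
  suff {h} : forall z, gen_ideal (adjoin A x) I z ->
      exists2 p, coefs_in (gen_ideal A I) p & p.[x] = z by apply.
  move=> z; elim=> [|a b y [[p hp ->] Ib] _ [q hq <-]].
    by exists 0; rewrite ?horner0 // => i; rewrite coef0; apply: lspan0.
  exists (p * b%:P + q); last by rewrite !hornerE.
  by move=> i; rewrite coefD coefMC; apply: lspan_add (hq i); apply: lspan_mem.
have val x : A x \/ A x^-1.
  case: (pselect (A x)) => [|Ax]; first by left.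
  right; apply: contrapT => Ax'.
  have x0 : x != 0 by apply/eqP => x0; apply: Ax; rewrite x0; apply: subring0.
  have [p hp px] := key _ Ax; have [q hq qx] := key _ Ax'.
  by apply: A1; apply: (unit_relation hA hIA x0 hp hq px qx (leqnn _)).
exists A; split=> // x Ix; split; first exact/DA/ID.
case: (eqVneq x 0) => [|x0]; [by left|right] => Ax; apply: A1.
by rewrite -(mulVf x0); apply: lspan_mem.
Qed.

End SubringTheory.

(** * Prime ideals and localization *)

Section LocalRings.
Variable F : fieldType.
Implicit Types (S T P I V k : set F) (x y z c : F) (p q : {poly F}).

Lemma prime_ideal S P : prime_of S P -> ideal_of S P. Proof. by case. Qed.
Lemma prime_sub S P : prime_of S P -> P `<=` S. Proof. by case=> -[]. Qed.
Lemma prime0 S P : prime_of S P -> P 0. Proof. by case=> -[]. Qed.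
Lemma prime1 S P : prime_of S P -> ~ P 1. Proof. by case. Qed.
Lemma primeMl S P a x : prime_of S P -> S a -> P x -> P (a * x).
Proof. by case=> -[_ _ _ h] _ _; apply: h. Qed.
Lemma primeMr S P a x : prime_of S P -> S a -> P x -> P (x * a).
Proof. by rewrite mulrC; apply: primeMl. Qed.
Lemma primeD S P x y : prime_of S P -> P x -> P y -> P (x + y).
Proof. by case=> -[_ _ h _] _ _; apply: h. Qed.
Lemma prime_nM S P x y : prime_of S P -> S x -> S y -> ~ P x -> ~ P y -> ~ P (x * y).
Proof. by case=> _ _ h Sx Sy nx ny /(h _ _ Sx Sy)[]. Qed.
Lemma prime_nX S P x n : subring S -> prime_of S P -> S x -> ~ P x -> ~ P (x ^+ n).
Proof.
move=> hS hP Sx nx; elim: n => [|n IH]; first exact: prime1 hP.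
by rewrite exprS; apply: (prime_nM hP) => //; apply: subringX.
Qed.
Lemma prime_n0 S P x : prime_of S P -> ~ P x -> x != 0.
Proof. by move=> hP nx; apply/eqP => x0; apply: nx; rewrite x0; apply: prime0 hP. Qed.

Lemma prime_contract S T P : subring S -> subring T -> T `<=` S -> prime_of S P ->
  prime_of T (P `&` T).
Proof.
move=> hS hT TS hP; split; first split.
- by move=> x [].
- by split; [apply: prime0 hP | apply: subring0].
- by move=> x y [Px Tx] [Py Ty]; split; [apply: (primeD hP)|apply: subringD].
- by move=> a x Ta [Px Tx]; split; [apply: (primeMl hP) => //; apply: TS|apply: subringM].
- by case=> /(prime1 hP).
- move=> x y Tx Ty [Pxy _].
  by case: hP => _ _ /(_ _ _ (TS _ Tx) (TS _ Ty) Pxy)[]; [left|right].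
Qed.

Lemma zero_prime S : subring S -> prime_of S [set 0].
Proof.
move=> hS; split; first split.
- by move=> _ ->; apply: subring0.
- by [].
- by move=> _ _ -> ->; rewrite /= addr0.
- by move=> a _ _ ->; rewrite /= mulr0.
- by move/eqP; rewrite oner_eq0.
- by move=> x y _ _ /= /eqP; rewrite mulf_eq0 => /orP[]/eqP; [left|right].
Qed.

Definition local_ring S := subring S /\ ideal_of S (maxid S).

Lemma maxid_nunit S x : S x -> ~ maxid S x -> S x^-1.
Proof. by move=> Sx nx; apply: contrapT => nx'; apply: nx; split=> //; right. Qed.

Lemma maxid_n0 S x : S x -> ~ maxid S x -> x != 0.
Proof. by move=> Sx nx; apply/eqP => x0; apply: nx; split=> //; left. Qed.

Lemma maxid_sub S : maxid S `<=` S. Proof. by move=> x []. Qed.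

Lemma unit_nmaxid S x : S x^-1 -> x != 0 -> ~ maxid S x.
Proof. by move=> h /eqP x0 [_ [//|]]. Qed.

Lemma local_maxid_prime S : local_ring S -> prime_of S (maxid S).
Proof.
move=> [hS hm]; split=> //.
  by apply: unit_nmaxid; rewrite ?oner_eq0 // invr1; apply: subring1.
move=> x y Sx Sy mxy; apply: contrapT => /not_orP[nx ny].
move: mxy; apply: unit_nmaxid.
  by rewrite invfM; apply: subringM => //; apply: maxid_nunit.
by rewrite mulf_neq0 //; apply: maxid_n0; eauto.
Qed.

Definition val_ring V := subring V /\ forall x, V x \/ V x^-1.

Lemma val_local V : val_ring V -> local_ring V.
Proof.
move=> [hV tot]; split=> //; split.
- exact: maxid_sub.
- by split; [apply: subring0|left].
- have h x y : maxid V x -> maxid V y -> V (y / x) -> x != 0 -> maxid V (x + y).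
    move=> [Vx [->|nx]] [Vy hy] Vyx x0; first by rewrite add0r; split.
    split; first exact: subringD.
    case: (eqVneq (x + y) 0) => [|xy0]; [by left|right] => hxy; apply: nx.
    have -> : x^-1 = (1 + y / x) * (x + y)^-1.
      by apply: (mulfI x0); rewrite mulrA mulrDr mulr1 mulrCA mulfV // mulr1 !mulfV.
    by apply: subringM => //; apply: subringD => //; apply: subring1.
  move=> x y mx my.
  case: (eqVneq x 0) => [->|x0]; first by rewrite add0r.
  case: (eqVneq y 0) => [->|y0]; first by rewrite addr0.
  case: (tot (y / x)) => hyx; first exact: h.
  by rewrite addrC; apply: h => //; rewrite -invf_div.
- move=> a x Va [Vx [->|nx]]; first by rewrite mulr0; split; [apply: subring0|left].
  split; first exact: subringM.
  case: (eqVneq a 0) => [->|a0]; first by left; rewrite mul0r.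
  right=> h; apply: nx; have -> : x^-1 = a * (a * x)^-1 by rewrite invfM mulVKf.
  exact: subringM.
Qed.

Section Localization.
Variables (S P : set F) (hS : subring S) (hP : prime_of S P).

Lemma loc_sub : S `<=` localization S P.
Proof.
by move=> x Sx; exists x, 1; split=> //; [apply: subring1|apply: prime1 hP|rewrite divr1].
Qed.

Lemma loc_subring : subring (localization S P).
Proof.
split; first by apply: loc_sub; apply: subring1.
move=> _ _ [a [b [Sa Sb Pb ->]]] [a' [b' [Sa' Sb' Pb' ->]]].
have b0 := prime_n0 hP Pb; have b'0 := prime_n0 hP Pb'.
split.
  exists (a * b' - a' * b), (b * b'); split; first by apply: subringB => //; apply: subringM.
  - exact: subringM.
  - exact: (prime_nM hP).
  - by field; rewrite b0 b'0.
exists (a * a'), (b * b'); split; [exact: subringM|exact: subringM| |].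
- exact: (prime_nM hP).
- by field; rewrite b0 b'0.
Qed.

Lemma loc_inv b : S b -> ~ P b -> localization S P b^-1.
Proof.
by move=> Sb nb; exists 1, b; split=> //; [apply: subring1|rewrite div1r].
Qed.

Lemma maxid_loc x : maxid (localization S P) x <->
  exists a b, [/\ P a, S b, ~ P b & x = a / b].
Proof.
split=> [[[a [b [Sa Sb Pb ->]]] h]|[a [b [Pa Sb Pb ->]]]].
  exists a, b; split=> //; case: h => [/eqP|h].
    rewrite mulf_eq0 invr_eq0 (negPf (prime_n0 hP Pb)) orbF => /eqP ->.
    exact: prime0 hP.
  by apply: contrapT => na; apply: h; exists b, a; rewrite invf_div.
have Sa := prime_sub hP Pa; split; first by exists a, b.
case: (eqVneq a 0) => [->|a0]; first by left; rewrite mul0r.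
have b0 := prime_n0 hP Pb.
right=> -[a' [b' [Sa' Sb' Pb' e]]]; have b'0 := prime_n0 hP Pb'.
apply: (prime_nM hP Sb Sb' Pb Pb').
have -> : b * b' = a' * a.
  move: e; rewrite invf_div => /(congr1 (fun z => z * a * b')).
  by rewrite mulfVK // => ->; field.
exact: (primeMl hP).
Qed.

Lemma loc_local : local_ring (localization S P).
Proof.
split; first exact: loc_subring.
have hL := loc_subring; split.
- exact: maxid_sub.
- by split; [apply: subring0|left].
- move=> x y /maxid_loc[a [b [Pa Sb Pb ->]]] /maxid_loc[a' [b' [Pa' Sb' Pb' ->]]].
  have b0 := prime_n0 hP Pb; have b'0 := prime_n0 hP Pb'.
  apply/maxid_loc; exists (a * b' + a' * b), (b * b'); split.
  + by apply: (primeD hP); apply: (primeMr hP).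
  + exact: subringM.
  + exact: (prime_nM hP).
  + by field; rewrite b0 b'0.
- move=> _ x [a [b [Sa Sb Pb ->]]] /maxid_loc[a' [b' [Pa' Sb' Pb' ->]]].
  apply/maxid_loc; exists (a * a'), (b * b'); split.
  + exact: (primeMl hP).
  + exact: subringM.
  + exact: (prime_nM hP).
  + by rewrite invfM mulrACA.
Qed.

Lemma maxid_loc_contract : maxid (localization S P) `&` S = P.
Proof.
apply/seteqP; split=> x.
  case=> /maxid_loc[a [b [Pa Sb Pb e]]] Sx; apply: contrapT => nx.
  have b0 := prime_n0 hP Pb; apply: (prime_nM hP Sx Sb nx Pb).
  by rewrite e divfK.
move=> Px; split; last exact: prime_sub hP _ Px.
by apply/maxid_loc; exists x, 1; split=> //; [apply: subring1|apply: prime1 hP|rewrite divr1].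
Qed.

End Localization.

Lemma loc_maxid S : local_ring S -> localization S (maxid S) = S.
Proof.
move=> hS; have hm := local_maxid_prime hS; case: hS => hS _.
apply/seteqP; split; last exact: loc_sub.
by move=> _ [a [b [Sa Sb nb ->]]]; apply: subringM => //; apply: maxid_nunit.
Qed.

Lemma loc_loc T (q p : set F) : subring T -> prime_of T q -> prime_of (localization T q) p ->
  localization (localization T q) p = localization T (p `&` T).
Proof.
move=> hT hq hp; have hL := loc_subring hT hq; have TL := loc_sub hT hq.
have hpT := prime_contract hL hT TL hp.
have qp b : T b -> ~ q b -> ~ p b.
  move=> Tb nb pb; apply: (prime1 hp); rewrite -(mulVf (prime_n0 hq nb)).
  by apply: (primeMl hp) => //; apply: loc_inv.
apply/seteqP; split=> [_ [_ [_ [[a [b [Ta Tb nb ->]]] [a' [b' [Ta' Tb' nb' ->]]] np ->]]]|].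
  have b0 := prime_n0 hq nb; have b'0 := prime_n0 hq nb'.
  have a'p : ~ p a' by move=> h; apply: np; apply: (primeMr hp) => //; apply: loc_inv.
  have a'0 := prime_n0 hp a'p.
  exists (a * b'), (b * a'); split; [exact: subringM|exact: subringM| |].
    by case=> pba _; apply: (prime_nM hp _ _ (qp _ Tb nb) a'p pba); apply: TL.
  by field; rewrite b0 b'0 a'0.
move=> _ [a [b [Ta Tb nb ->]]]; exists a, b; split=> //; try exact: TL.
by move=> pb; apply: nb.
Qed.

(** The ideal extends to a proper ideal of the ring of fractions with denominators in [Mu]; the
    prime is the center on [S] of a valuation ring given there by [chevalley]. *)
Lemma prime_avoiding S I (Mu : set F) : subring S -> ideal_of S I ->
  Mu `<=` S -> Mu 1 -> (forall x y, Mu x -> Mu y -> Mu (x * y)) ->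
  (forall x, I x -> ~ Mu x) ->
  exists P, [/\ prime_of S P, I `<=` P & forall x, P x -> ~ Mu x].
Proof.
move=> hS hI MuS Mu1 MuM dis.
have Mu0 x : Mu x -> x != 0.
  by move=> hx; apply/eqP => x0; apply: (dis 0); [case: hI|rewrite -x0].
pose D : set F := [set z | exists a b, [/\ S a, Mu b & z = a / b]].
pose J : set F := [set z | exists a b, [/\ I a, Mu b & z = a / b]].
have [IS I0 ID IM] := hI.
have SD : S `<=` D by move=> x Sx; exists x, 1; rewrite divr1.
have hD : subring D.
  split; first by apply: SD; apply: subring1.
  move=> _ _ [a [b [Sa Mb ->]]] [a' [b' [Sa' Mb' ->]]].
  have b0 := Mu0 _ Mb; have b'0 := Mu0 _ Mb'; split.
    exists (a * b' - a' * b), (b * b'); split; [|exact: MuM|by field; rewrite b0 b'0].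
    by apply: subringB => //; apply: subringM => //; apply: MuS.
  exists (a * a'), (b * b'); split; [exact: subringM|exact: MuM|by field; rewrite b0 b'0].
have hJ : ideal_of D J.
  split.
  - by move=> _ [a [b [Ia Mb ->]]]; exists a, b; split=> //; apply: IS.
  - by exists 0, 1; rewrite mul0r.
  - move=> _ _ [a [b [Ia Mb ->]]] [a' [b' [Ia' Mb' ->]]].
    have b0 := Mu0 _ Mb; have b'0 := Mu0 _ Mb'.
    exists (b' * a + b * a'), (b * b'); split; [|exact: MuM|by field; rewrite b0 b'0].
    by apply: ID; apply: IM => //; apply: MuS.
  - move=> _ _ [a [b [Sa Mb ->]]] [a' [b' [Ia' Mb' ->]]].
    have b0 := Mu0 _ Mb; have b'0 := Mu0 _ Mb'.
    by exists (a * a'), (b * b'); split; [exact: IM|exact: MuM|field; rewrite b0 b'0].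
have J1 : ~ J 1.
  case=> a [b [Ia Mb e]]; apply: (dis b) => //.
  by have -> : b = a by rewrite -[b]mul1r e divfK // Mu0.
have [V [hV DV tot JV]] := chevalley hD hJ J1.
have hm := local_maxid_prime (val_local (conj hV tot)).
exists (maxid V `&` S); split.
- by apply: prime_contract hm => // x /SD/DV.
- move=> x Ix; split; last exact: IS.
  by apply: JV; exists x, 1; rewrite divr1.
- move=> x [[_ h] Sx] Mx; case: h => [x0|nx]; first by have := Mu0 _ Mx; rewrite x0 eqxx.
  by apply: nx; apply: DV; exists 1, x; split=> //; [apply: subring1|rewrite div1r].
Qed.

Lemma radical_pow S I x : subring S -> ideal_of S I -> S x ->
  (forall P, prime_of S P -> I `<=` P -> P x) -> exists n, I (x ^+ n).
Proof.
move=> hS hI Sx h; apply: contrapT => nI.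
have [] := @prime_avoiding S I [set x ^+ n | n in setT] hS hI.
- by move=> _ [n _ <-]; apply: subringX.
- by exists 0%N.
- by move=> _ _ [n _ <-] [m _ <-]; exists (n + m)%N; rewrite ?exprD.
- by move=> y Iy [n _ e]; apply: nI; exists n; rewrite e.
move=> P [hP IP dis]; apply: (dis x); first exact: h.
by exists 1%N.
Qed.

End LocalRings.

(** * Transcendental elements and specialization *)

Section Transcendence.
Variable F : fieldType.
Implicit Types (S P V k : set F) (x y z c s : F) (p q : {poly F}).

Definition subfield k := subring k /\ forall x, k x -> k x^-1.

Definition transc k c := forall p, coefs_in k p -> p.[c] = 0 -> p = 0.

Definition adj k c : set F := [set z | exists p q,
  [/\ coefs_in k p, coefs_in k q, q.[c] != 0 & z = p.[c] / q.[c]]].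

Lemma adj_sub k c : subfield k -> k `<=` adj k c.
Proof.
move=> [hk _] x kx; exists x%:P, 1%:P; rewrite !hornerC divr1 oner_eq0.
by split=> //; apply: coefs_inC => //; apply: subring1.
Qed.

Lemma adj_mem k c : subfield k -> adj k c c.
Proof.
move=> [hk _]; exists 'X, 1%:P; rewrite hornerX hornerC divr1 oner_eq0.
by split=> //; [apply: coefs_inX | apply: coefs_inC => //; apply: subring1].
Qed.

Lemma adj_subfield k c : subfield k -> subfield (adj k c).
Proof.
move=> hk; split; first split.
- by apply: adj_sub => //; apply: subring1; case: hk.
- move=> _ _ [p [q [hp hq q0 ->]]] [p' [q' [hp' hq' q'0 ->]]]; case: hk => hk _.
  split.
    exists (p * q' - p' * q), (q * q'); rewrite !(hornerM, hornerD, hornerN) mulf_neq0 //; split=> //.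
    + by apply: coefs_inB => //; apply: coefs_inM.
    + exact: coefs_inM.
    + by field; rewrite q0 q'0.
  exists (p * p'), (q * q'); rewrite !hornerM mulf_neq0 //; split=> //.
  + exact: coefs_inM.
  + exact: coefs_inM.
  + by field; rewrite q0 q'0.
- move=> _ [p [q [hp hq q0 ->]]]; case: hk => hk _; rewrite invf_div.
  case: (eqVneq p.[c] 0) => [->|p0]; last by exists q, p.
  exists 0%:P, 1%:P; rewrite !hornerC oner_eq0 invr0 mulr0 mul0r; split=> //.
    by apply: coefs_inC => //; apply: subring0.
  by apply: coefs_inC => //; apply: subring1.
Qed.

Lemma adj_min k k' c : subfield k' -> k `<=` k' -> k' c -> adj k c `<=` k'.
Proof.
move=> [hk' k'V] kk' k'c _ [p [q [hp hq q0 ->]]].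
by apply: subringM => //; [|apply: k'V]; apply: subring_horner => // i; apply: kk'.
Qed.

Lemma transc_sub k k' c : k `<=` k' -> transc k' c -> transc k c.
Proof. by move=> kk' h p hp; apply: h => i; apply: kk'. Qed.

Lemma transc_horner_n0 k c p : transc k c -> coefs_in k p -> p != 0 -> p.[c] != 0.
Proof. by move=> h hp; apply: contra => /eqP /h ->. Qed.

(** Passing to a bivariate polynomial over [k] puts [c] and the indeterminate on the same footing:
    their roles can be exchanged, or [c] replaced by a constant. *)
Lemma clear_denominators k c (Q : {poly F}) : subfield k -> coefs_in (adj k c) Q ->
  exists (P : {poly {poly F}}) (e : {poly F}), [/\ coefs_in k e, e.[c] != 0,
    forall i, coefs_in k P`_i & forall i, (P`_i).[c] = e.[c] * Q`_i].
Proof.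
move=> [hk _]; elim/poly_ind: Q => [|Q a IH] hQ.
  exists 0, 1%:P; rewrite hornerC oner_eq0; split=> //.
  - by apply: coefs_inC => //; apply: subring1.
  - by move=> i j; rewrite !coef0; apply: subring0.
  - by move=> i; rewrite !coef0 horner0 mulr0.
have {}/IH[P [e [he e0 hP eP]]] : coefs_in (adj k c) Q.
  by move=> i; have := hQ i.+1; rewrite coefD coefMX coefC /= addr0.
have [n [d [hn hd d0 ea]]] : adj k c a.
  by have := hQ 0%N; rewrite coefD coefMX coefC /= add0r.
exists (P * d%:P * 'X + (n * e)%:P), (e * d); rewrite hornerM mulf_neq0 //; split=> //.
- exact: coefs_inM.
- case=> [|i]; rewrite coefD coefMX coefC /= ?add0r ?addr0 ?coefMC; exact: coefs_inM.
- case=> [|i]; rewrite coefD coefMX coefC coefD coefMX coefC /= ?add0r ?addr0 ?coefMC hornerM.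
    by rewrite ea; field.
  by rewrite eP; ring.
Qed.

Lemma horner_map_horner (P : {poly {poly F}}) x y :
  (map_poly (horner^~ x) P).[y] = P.[y%:P].[x].
Proof.
rewrite -[RHS]/(horner_eval x _) -horner_map /= /horner_eval hornerC.
by congr (_.[_]).
Qed.

(** Steinitz exchange: a relation for [c] over k(s), cleared of denominators and read as a
    polynomial in [s], is a relation for [s] over k(c). *)
Lemma transc_swap k c s : subfield k -> transc k c -> transc (adj k c) s ->
  transc k s /\ transc (adj k s) c.
Proof.
move=> hk hc hs; split; first exact: transc_sub (adj_sub _ hk) hs.
move=> Q /(clear_denominators hk)[P [e [he e0 hP eP]]] Qc.
suff P0 : P = 0.
  apply/polyP => i; apply: (mulfI e0); rewrite -eP P0 !coef0 horner0 mulr0 //.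
have [hkr _] := hk.
pose R := map_poly (fun p => p.[c]) (swapXY P).
have RE i : R`_i = ((swapXY P)`_i).[c].
  by rewrite /R coef_map_id0 // horner0.
have hsw i : coefs_in k (swapXY P)`_i by move=> j; rewrite coef_swapXY; apply: hP.
have R0 : R = 0.
  apply: hs => [i|].
    rewrite RE; exists (swapXY P)`_i, 1%:P; rewrite hornerC oner_eq0 divr1.
    by split=> //; apply: coefs_inC => //; apply: subring1.
  rewrite horner_map_horner horner2_swapXY -horner_map_horner.
  have -> : map_poly (horner^~ s) P = e.[s] *: Q.
    by apply/polyP => i; rewrite coef_map_id0 ?horner0 // coefZ.
  by rewrite hornerZ Qc mulr0.
apply/eqP; rewrite -swapXY_eq0; apply/eqP/polyP => i; rewrite coef0.
by apply: hc => //; rewrite -RE R0 coef0.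
Qed.

(* The lowest coefficient of p is a unit of S_P while c lies in P; hence p(c)
   is a power of c times a unit of S_P. *)
Lemma transc_prime S P' P k c : subring S -> prime_of S P' -> prime_of S P ->
  P' `<=` P -> subfield k -> k `<=` localization S P -> P c -> ~ P' c ->
  transc k c /\ adj k c `<=` localization S P'.
Proof.
move=> hS hP' hP P'P [hk kV] kL Pc nc; have Sc := prime_sub hP Pc.
have hL := loc_subring hS hP.
have hm := prime_ideal (local_maxid_prime (loc_local hS hP)).
have key p : coefs_in k p -> p != 0 ->
    exists a b, [/\ S a, S b, ~ P' a, ~ P b & p.[c] = a / b].
  elim/poly_ind: p => [|p a IH] hp; first by rewrite eqxx.
  have hp' : coefs_in k p.
    by move=> i; have := hp i.+1; rewrite coefD coefMX coefC /= addr0.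
  have ka : k a by have := hp 0%N; rewrite coefD coefMX coefC /= add0r.
  case: (eqVneq a 0) => [->|a0] pn0.
    rewrite addr0 in pn0 *; case: IH => // [|x [y [Sx Sy nx ny e]]].
      by apply: contraNneq pn0 => ->; rewrite mul0r.
    exists (x * c), y; split=> //; [exact: subringM|exact: (prime_nM hP')|].
    by rewrite hornerM hornerX e mulrAC.
  have La := kL _ (kV _ ka).
  have Lp : localization S P p.[c].
    apply: subring_horner => //; first by move=> i; apply: kL.
    exact: loc_sub Sc.
  have mc : maxid (localization S P) c.
    by apply/maxid_loc => //; exists c, 1; split=> //; [apply: subring1|apply: prime1 hP|rewrite divr1].
  have mpc : maxid (localization S P) (p.[c] * c) by case: hm => _ _ _; apply.
  have nm : ~ maxid (localization S P) ((p * 'X + a%:P).[c]).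
    rewrite !hornerE => h; have : maxid (localization S P) a.
      have -> : a = (p.[c] * c + a) - p.[c] * c by ring.
      exact: (idealB hL hm).
    by apply: unit_nmaxid.
  have : localization S P ((p * 'X + a%:P).[c]).
    by rewrite !hornerE; apply: subringD => //; [apply: maxid_sub mpc|apply: kL].
  case=> x [y [Sx Sy ny e]]; exists x, y; split=> // P'x; apply: nm; rewrite e.
  by apply/maxid_loc => //; exists x, y; split=> //; apply: P'P.
split.
  move=> p hp pc; apply/eqP; apply: contrapT => /negP /(key _ hp)[a [b [Sa Sb na nb]]].
  move/eqP; rewrite pc eq_sym mulf_eq0 invr_eq0 (negPf (prime_n0 hP nb)) orbF => /eqP a0.
  by apply: na; rewrite a0; apply: prime0 hP'.
move=> _ [p [q [hp hq q0 ->]]].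
have [x [y [Sx Sy nx ny ->]]] : exists a b, [/\ S a, S b, ~ P' a, ~ P b & q.[c] = a / b].
  by apply: key => //; apply: contraNneq q0 => ->; rewrite horner0.
case: (eqVneq p 0) => [->|/(key _ hp)[x' [y' [Sx' Sy' nx' ny' ->]]]].
  by rewrite horner0 mul0r; apply: subring0; apply: loc_subring.
have y0 := prime_n0 hP ny; have y'0 := prime_n0 hP ny'; have x0 := prime_n0 hP' nx.
exists (x' * y), (y' * x); split; [exact: subringM|exact: subringM| |by field; rewrite y0 x0 y'0].
apply: (prime_nM hP') => // h; exact/ny'/P'P.
Qed.

End Transcendence.

Section ClosedFieldAvoid.
Variables (K : closedFieldType) (F : fieldType) (iota : {rmorphism K -> F}).

Lemma closed_field_fresh (rs : seq K) : exists a, a \notin rs.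
Proof.
pose p : {poly K} := \prod_(r <- rs) ('X - r%:P) + 1.
case: (boolP (size rs == 0)%N) => [/nilP ->|rs0]; first by exists 0.
have sz : size (\prod_(r <- rs) ('X - r%:P) : {poly K}) = (size rs).+1.
  by rewrite size_prod_XsubC.
have /closed_rootP[a /rootP pa] : size p != 1%N.
  by rewrite /p size_polyDl ?sz ?size_poly1 ?ltnS ?lt0n // eqSS.
exists a; apply/negP => ars; move: pa; rewrite /p hornerD hornerC horner_prod.
rewrite (big_rem a) //= hornerXsubC subrr mul0r add0r => /eqP.
by rewrite oner_eq0.
Qed.

Lemma nonroot_exists (p : {poly F}) : p != 0 -> exists a, p.[iota a] != 0.
Proof.
move=> p0; apply: contrapT => h.
have /= [rs [us ss]] : exists rs : seq K, uniq rs /\ size rs = size p.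
  elim: (size p) => [|n [rs [us ss]]]; first by exists [::].
  have [a ha] := closed_field_fresh rs.
  by exists (a :: rs); rewrite /= ha us ss.
have : (size (map iota rs) < size p)%N.
  apply: max_poly_roots => //.
    apply/allP => _ /mapP[a _ ->]; apply/rootP/eqP; apply: contrapT => pa.
    by apply: h; exists a; apply/negP.
  by rewrite map_inj_uniq //; apply: fmorph_inj.
by rewrite size_map ss ltnn.
Qed.

Lemma nonroot_seq (ps : seq {poly F}) : (forall p, p \in ps -> p != 0) ->
  exists a, forall p, p \in ps -> p.[iota a] != 0.
Proof.
move=> h; have [a ha] : exists a, (\prod_(p <- ps) p).[iota a] != 0.
  apply: nonroot_exists; rewrite prodf_seq_neq0; apply/allP => p pps; exact: h.
exists a => p pps; move: ha; rewrite horner_prod prodf_seq_neq0.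
by move/allP => /(_ _ pps).
Qed.

End ClosedFieldAvoid.

Section Specialization.
Variables (K : closedFieldType) (F : fieldType) (iota : {rmorphism K -> F}).
Implicit Types (V k : set F).

(** For a subfield [k] of [V], the residue class of [s] is algebraic over [k]. With V = F the
    maximal ideal is 0, and this is algebraicity of [s] itself. *)
Definition alg_mod V k (s : F) :=
  exists Q, [/\ coefs_in k Q, Q != 0 & maxid V Q.[s]].

(* A valuation ring V' inside V centered at c = a, for a general constant a:
   the composite of V with an extension of the (c - a)-adic valuation. *)
Lemma specialize (bad : seq K) V k c (ss : seq F) : val_ring V -> subfield k ->
  (forall a, k (iota a)) -> adj k c `<=` V -> transc k c ->
  (forall s, s \in ss -> V s /\ alg_mod V (adj k c) s) ->
  exists2 a, a \notin bad & exists V', [/\ val_ring V',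
    V' `<=` V /\ maxid V `<=` maxid V', k `<=` V', maxid V' (c - iota a) &
      forall s, s \in ss -> V' s /\ alg_mod V' k s].
Proof.
move=> hV hk kK cV tc hss; have [hVs Vtot] := hV; have [hkr hkV] := hk.
have hVm := prime_ideal (local_maxid_prime (val_local hV)).
have [Vm0 VmD VmM] : [/\ maxid V 0, forall x y, maxid V x -> maxid V y -> maxid V (x + y) &
   forall a x, V a -> maxid V x -> maxid V (a * x)] by case: hVm.
have kadj := adj_sub c hk; have ka := adj_mem c hk.
have kV : k `<=` V by move=> x /kadj/cV.
have {}hss s : s \in ss -> exists P : {poly {poly F}}, [/\ V s, P != 0,
    forall i, coefs_in k P`_i & maxid V P.[s%:P].[c]].
  move=> /hss[Vs [Q [hQ Q0 mQ]]].
  have [P [e [he e0 hP eP]]] := clear_denominators hk hQ.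
  exists P; split=> //.
    apply: contraNneq Q0 => P0; apply/eqP/polyP => i; apply: (mulfI e0).
    by rewrite -eP P0 !coef0 horner0 mulr0.
  rewrite -horner_map_horner; have -> : map_poly (horner^~ c) P = e.[c] *: Q.
    by apply/polyP => i; rewrite coef_map_id0 ?horner0 // coefZ.
  rewrite hornerZ; apply: (VmM) => //; apply: cV; exists e, 1%:P.
  by rewrite hornerC divr1 oner_eq0; split=> //; apply: coefs_inC => //; apply: subring1.
(* The constant avoids the zeros of the finitely many leading coefficients, so that the relations of
   the elements of [ss] keep their degree at c = a. *)
have [a abad ha] : exists2 a, a \notin bad & forall s, s \in ss -> exists P : {poly {poly F}},
    [/\ V s, (lead_coef P).[iota a] != 0, forall i, coefs_in k P`_i & maxid V P.[s%:P].[c]].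
  have [ps hps] : exists ps : seq {poly F}, (forall p, p \in ps -> p != 0) /\
      (forall s, s \in ss -> exists P : {poly {poly F}},
      [/\ V s, lead_coef P \in ps, forall i, coefs_in k P`_i & maxid V P.[s%:P].[c]]).
    elim: ss hss => [|s ss IH] hss; first by exists [::].
    have [|ps [h1 h2]] := IH; first by move=> s' hs'; apply: hss; rewrite inE hs' orbT.
    have [|P [Vs P0 hP mP]] := hss s; first by rewrite inE eqxx.
    exists (lead_coef P :: ps); split.
      by move=> p; rewrite inE => /predU1P[->|/h1 //]; rewrite lead_coef_eq0.
    move=> s'; rewrite inE => /predU1P[->|/h2[P' [Vs' P'0 hP' mP']]].
      by exists P; rewrite inE eqxx.
    by exists P'; rewrite inE P'0 orbT.
  case: hps => h1 h2.
  have [|a ha] := @nonroot_seq _ _ iota (ps ++ [seq 'X - (iota b)%:P | b <- bad]).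
    by move=> p; rewrite mem_cat => /orP[/h1 //|/mapP[b _ ->]]; rewrite polyXsubC_eq0.
  exists a.
    apply/negP => abad; have := ha ('X - (iota a)%:P).
    rewrite mem_cat (map_f (fun b => 'X - (iota b)%:P) abad) orbT hornerXsubC subrr eqxx.
    by move/(_ isT).
  move=> s /h2[P [Vs hl hP mP]]; exists P; split=> //; apply: ha.
  by rewrite mem_cat hl.
(* [D] is the preimage in [V] of the polynomial ring k[c] inside the residue field, and [I] below is
   the preimage of the ideal generated by c - a. *)
pose D : set F := [set z | exists p m, [/\ coefs_in k p, maxid V m & z = p.[c] + m]].
pose I : set F := [set z | exists p m, [/\ coefs_in k p, maxid V m & z = (c - iota a) * p.[c] + m]].
have Vc : V c by apply: cV.
have Vp p : coefs_in k p -> V p.[c] by move=> hp; apply: subring_horner => // i; apply: (kV).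
have mV := @maxid_sub F V.
have kC x : k x -> coefs_in k x%:P by apply: coefs_inC.
have k1 : coefs_in k 1%:P by apply: (kC); apply: subring1.
have kX : coefs_in k 'X by apply: coefs_inX.
have kXa : coefs_in k ('X - (iota a)%:P) by apply: coefs_inB => //; apply: (kC).
have hD : subring D.
  split; first by exists 1%:P, 0; rewrite hornerC addr0; split=> //.
  move=> _ _ [p [m [hp mm ->]]] [p' [m' [hp' mm' ->]]]; split.
    exists (p - p'), (m - m'); split; first exact: coefs_inB.
      exact: (idealB hVs hVm).
    by rewrite hornerD hornerN; ring.
  exists (p * p'), (p.[c] * m' + (p'.[c] * m + m * m')); split; first exact: coefs_inM.
    by apply: (VmD); [apply: (VmM) => //; apply: (Vp)|apply: (VmD); apply: (VmM) => //; [apply: (Vp)|apply: (mV)]].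
  by rewrite hornerM; ring.
have ID : I `<=` D.
  move=> _ [p [m [hp mm ->]]]; exists (('X - (iota a)%:P) * p), m; split=> //.
    exact: coefs_inM.
  by rewrite hornerM hornerXsubC.
have hI : ideal_of D I.
  split=> //.
  - exists 0, 0; rewrite horner0 mulr0 addr0; split=> //.
    by move=> i; rewrite coef0; apply: subring0.
  - move=> _ _ [p [m [hp mm ->]]] [p' [m' [hp' mm' ->]]].
    exists (p + p'), (m + m'); split; [exact: coefs_inD|exact: VmD|].
    by rewrite hornerD; ring.
  - move=> _ _ [p [m [hp mm ->]]] [p' [m' [hp' mm' ->]]].
    exists (p * p'), (p.[c] * m' + m * ((c - iota a) * p'.[c] + m')); split.
    + exact: coefs_inM.
    + apply: (VmD); first by apply: (VmM) => //; apply: (Vp).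
      rewrite mulrC; apply: (VmM) => //; apply: subringD => //; last exact: mV.
      by apply: subringM => //; [apply: subringB => //; apply: (kV)|apply: (Vp)].
    + by rewrite hornerM; ring.
(* A nonzero value of a polynomial at [c] is a unit of [V], so 1 in [I] would force 1 = (c - a) p(c)
   exactly; by transcendence this holds identically, and at [a] it reads 1 = 0. *)
have I1 : ~ I 1.
  case=> p [m [hp mm e]].
  pose r := 1 - ('X - (iota a)%:P) * p.
  have hr : coefs_in k r.
    by apply: coefs_inB => //; apply: coefs_inM.
  have rc : r.[c] = m.
    by rewrite /r hornerD hornerN hornerM hornerXsubC hornerC {1}e addrAC subrr add0r.
  have r0 : r.[c] = 0.
    apply/eqP; apply: contrapT => /negP rn0.
    have : V r.[c]^-1.
      apply: cV; exists 1%:P, r; rewrite hornerC div1r; split=> //.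
    by rewrite rc in rn0 * => /unit_nmaxid; apply.
  have /(congr1 (fun q => q.[iota a])) := tc _ hr r0.
  rewrite /r hornerD hornerN hornerM hornerXsubC subrr mul0r hornerC horner0 subr0.
  by move/eqP; rewrite oner_eq0.
have [V' [hV' DV' tot' IV']] := chevalley hD hI I1.
have vV' : val_ring V' by [].
have hm' := prime_ideal (local_maxid_prime (val_local vV')).
have [Vm'0 Vm'D Vm'M] : [/\ maxid V' 0, forall x y, maxid V' x -> maxid V' y -> maxid V' (x + y) &
   forall a x, V' a -> maxid V' x -> maxid V' (a * x)] by case: hm'.
have mm' : maxid V `<=` maxid V'.
  move=> x mx; apply: IV'; exists 0, x; rewrite horner0 mulr0 add0r; split=> //.
  by move=> i; rewrite coef0; apply: subring0.
have V'V : V' `<=` V.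
  move=> x V'x; apply: contrapT => Vx.
  have x0 : x != 0 by apply/eqP => x0; apply: Vx; rewrite x0; apply: subring0.
  have [//|Vx'] := Vtot x.
  have : maxid V x^-1 by split=> //; right; rewrite invrK.
  by move=> /mm'; apply: unit_nmaxid; rewrite ?invrK ?invr_eq0.
have pV' p : coefs_in k p -> V' p.[c].
  by move=> hp; apply: DV'; exists p, 0; rewrite addr0.
have kV' : k `<=` V' by move=> x kx; rewrite -(hornerC x c); apply/pV'/kC.
have mca : maxid V' (c - iota a).
  apply: IV'; exists 1%:P, 0; rewrite hornerC mulr1 addr0; split=> //; exact: k1.
have specp p : coefs_in k p -> maxid V' (p.[c] - p.[iota a]).
  move=> hp; have /factor_theorem[q eq] : root (p - p.[iota a]%:P) (iota a).
    by rewrite rootE hornerD hornerN hornerC subrr.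
  have -> : p.[c] - p.[iota a] = (p - p.[iota a]%:P).[c] by rewrite hornerD hornerN hornerC.
  elim/poly_ind: p hp {q eq} => [|p b IH] hp.
    by rewrite horner0 subrr horner0.
  have hp' : coefs_in k p.
    by move=> i; have := hp i.+1; rewrite coefD coefMX coefC /= addr0.
  have -> : (p * 'X + b%:P - (p * 'X + b%:P).[iota a]%:P).[c] =
    c * (p - p.[iota a]%:P).[c] + p.[iota a] * (c - iota a).
    by rewrite !(hornerD, hornerN, hornerC, hornerM, hornerX); ring.
  apply: (Vm'D); apply: (Vm'M) => //.
  - by rewrite -[c]hornerX; apply: pV'.
  - exact: IH.
  - by apply: (kV'); apply: subring_horner.
exists a => //; exists V'; split=> // s sss; have [P [Vs la hP mP]] := ha _ sss.
have P0 : P != 0 by apply: contraNneq la => ->; rewrite lead_coef0 horner0.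
pose Pc := map_poly (horner^~ c) P.
have PcE i : Pc`_i = (P`_i).[c] by rewrite coef_map_id0 ?horner0.
have mPc : maxid V' Pc.[s] by rewrite horner_map_horner; apply: mm'.
have hPc i : V' Pc`_i by rewrite PcE; apply: pV'.
have sP : size P = (size P).-1.+1 by rewrite prednK // lt0n size_poly_eq0.
have sPc : (size Pc <= (size P).-1.+1)%N by rewrite -sP; apply: size_poly.
(* The leading coefficient stays a unit of [V'] by the choice of [a]. If [s] were outside [V'],
   dividing the relation by the top power of [s] would put this unit into the maximal ideal. *)
have lu : V' (Pc`_(size P).-1)^-1 /\ Pc`_(size P).-1 != 0.
  rewrite PcE; set l := P`_ _.
  have kl : k l.[iota a] by apply: subring_horner => //; apply: hP.
  have nl : ~ maxid V' l.[c].
    move=> ml; have : maxid V' l.[iota a].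
      rewrite -[l.[iota a]](subKr l.[c]); apply: (idealB hV' hm') => //.
      exact/specp/hP.
    by apply: unit_nmaxid => //; apply: (kV'); apply: hkV.
  by split; [apply: maxid_nunit => //; apply: pV'; apply: hP|apply: maxid_n0 nl; apply/pV'/hP].
have V's : V' s.
  apply: contrapT => ns; have [//|V'si] := tot' s.
  have s0 : s != 0 by apply/eqP => s0; apply: ns; rewrite s0; apply: subring0.
  have msi : maxid V' s^-1 by split=> //; right; rewrite invrK.
  have {mPc}: maxid V' (s^-1 ^+ (size P).-1 * Pc.[s]).
    by apply: (Vm'M) => //; apply: subringX.
  rewrite (horner_coef_wide _ sPc) mulr_sumr big_ord_recr /=.
  rewrite [X in _ + X]mulrCA -exprMn mulVf // expr1n mulr1.
  set t := \sum_(i < _) _ => h.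
  have mt : maxid V' t.
    apply: (ideal_sum _ hm') => i _.
    have -> : s^-1 ^+ (size P).-1 * (Pc`_i * s ^+ i) = Pc`_i * s^-1 ^+ ((size P).-1 - i).-1 * s^-1.
      rewrite -mulrA -exprSr prednK ?subn_gt0 // mulrCA; congr (_ * _).
      by rewrite -{1}(subnK (ltnW (ltn_ord i))) exprD -mulrA -exprMn mulVf // expr1n mulr1.
    by apply: (Vm'M) => //; apply: subringM => //; apply: subringX.
  have : maxid V' (Pc`_(size P).-1).
    by rewrite -[Pc`__](addKr t) addrC; apply: (idealB hV' hm').
  by case: lu => l1 l2; apply: unit_nmaxid.
(* The relation of [s] specialized at c = a: its coefficients lie in [k] and are congruent to those
   of [Pc]. *)
split=> //; pose Qa := map_poly (horner^~ (iota a)) P.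
have QaE i : Qa`_i = (P`_i).[iota a] by rewrite coef_map_id0 ?horner0.
exists Qa; split.
- by move=> i; rewrite QaE; apply: subring_horner => //; apply: hP.
- apply/eqP => /(congr1 (fun q : {poly F} => q`_(size P).-1)).
  by rewrite QaE coef0 => h; move: la; rewrite /lead_coef h eqxx.
- have -> : Qa.[s] = Pc.[s] - (Pc - Qa).[s] by rewrite hornerD hornerN; ring.
  apply: (idealB hV' hm') => //.
  rewrite horner_coef; apply: (ideal_sum _ hm') => i _; rewrite mulrC.
  apply: (Vm'M); first exact: subringX.
  by rewrite coefB PcE QaE; apply/specp/hP.
Qed.

End Specialization.

(** * Transcendence degree and lengths of prime chains *)

Section TranscendenceDegree.
Variables (K : closedFieldType) (F : fieldType) (iota : {rmorphism K -> F}).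
Implicit Types (A S V k : set F).

Definition base_field : set F := range iota.
Local Notation k0 := base_field.

Lemma base_subfield : subfield k0.
Proof.
split; first split.
- by exists 1; rewrite ?rmorph1.
- move=> _ _ [a _ <-] [b _ <-]; split; first by exists (a - b); rewrite ?rmorphB.
  by exists (a * b); rewrite ?rmorphM.
- by move=> _ [a _ <-]; exists a^-1; rewrite ?fmorphV.
Qed.

Lemma adjS k k' (c : F) : k `<=` k' -> adj k c `<=` adj k' c.
Proof.
move=> kk' _ [p [q [hp hq q0 ->]]]; exists p, q; split=> // i; exact: kk'.
Qed.

Definition indep3 k (c1 c2 c3 : F) :=
  [/\ transc k c1, transc (adj k c1) c2 & transc (adj (adj k c1) c2) c3].

Lemma indep3_adj k (c1 c2 c3 s : F) : subfield k -> indep3 k c1 c2 c3 ->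
  transc (adj (adj (adj k c1) c2) c3) s -> indep3 (adj k s) c1 c2 c3.
Proof.
move=> hk [h1 h2 h3] hs.
have hk1 := adj_subfield c1 hk; have hk2 := adj_subfield c2 hk1.
have [hs2 h3'] := transc_swap hk2 h3 hs.
have [hs1 h2'] := transc_swap hk1 h2 hs2.
have [hs0 h1'] := transc_swap hk h1 hs1.
have le1 : adj (adj k s) c1 `<=` adj (adj k c1) s.
  apply: adj_min; first exact: adj_subfield.
    by apply: adjS; apply: adj_sub.
  by apply: adj_sub => //; apply: adj_mem.
split=> //; first exact: transc_sub le1 h2'.
apply: transc_sub h3'; apply: adj_min; first exact: adj_subfield.
  by move=> x /le1; apply: adjS; apply: adj_sub.
by apply: adj_sub => //; apply: adj_mem.
Qed.

(** An element of [ss] is adjoined to [k] whenever the three elements remain independent over the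
    larger field; otherwise exchange shows it algebraic over k(c1,c2,c3). This produces the
    algebraicity that [specialize] asks for. *)
Lemma indep3_enlarge k (c1 c2 c3 : F) (ss : seq F) : subfield k ->
  indep3 k c1 c2 c3 ->
  exists k', [/\ subfield k', k `<=` k', indep3 k' c1 c2 c3 &
    forall s, s \in ss -> alg_mod setT (adj (adj (adj k' c1) c2) c3) s].
Proof.
move=> hk hc; elim: ss => [|s ss [k' [hk' kk' hc' hss]]]; first by exists k; split=> // s; rewrite in_nil.
case: (pselect (indep3 (adj k' s) c1 c2 c3)) => h.
  exists (adj k' s); split=> //; first exact: adj_subfield.
    by move=> x /kk'; apply: adj_sub.
  have sub : adj k' s `<=` adj (adj (adj (adj k' s) c1) c2) c3.
    move=> x hx; have hks := adj_subfield s hk'.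
    have h1 := adj_subfield c1 hks; have h2 := adj_subfield c2 h1.
    by do 3! apply: adj_sub => //.
  have hsf : subring (adj (adj (adj (adj k' s) c1) c2) c3).
    by have [] : subfield (adj (adj (adj (adj k' s) c1) c2) c3) by do 4! apply: adj_subfield.
  move=> s'; rewrite inE => /predU1P[->|/hss [Q [hQ Q0 mQ]]].
    exists ('X - s%:P); rewrite polyXsubC_eq0 hornerXsubC subrr; split=> //.
      apply: coefs_inB => //; first exact: coefs_inX.
      by apply: coefs_inC => //; apply/sub/adj_mem.
    by split=> //; left.
  exists Q; split=> // i; apply: adjS (hQ i); apply: adjS; apply: adjS.
  exact: adj_sub.
exists k'; split=> // s'; rewrite inE => /predU1P[->|/hss //].
apply: contrapT => ns; apply: h; apply: indep3_adj => // Q hQ Qs.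
apply/eqP; apply: contrapT => /negP Q0; apply: ns; exists Q; split=> //.
by rewrite Qs; split=> //; left.
Qed.

Lemma polyXsubC_coefs k (a : F) : subring k -> k a -> coefs_in k ('X - a%:P).
Proof.
by move=> hk ka; apply: coefs_inB => //; [apply: coefs_inX|apply: coefs_inC].
Qed.

Lemma transc_XsubC k (c a : F) : subring k -> k a -> transc k c -> c - a != 0.
Proof.
move=> hk ka tc; rewrite -hornerXsubC; apply: (transc_horner_n0 tc).
  exact: polyXsubC_coefs.
by rewrite polyXsubC_eq0.
Qed.

(** Specializing c3, c2, c1 in turn to constants gives valuation rings V1, V2, V3, each inside the
    previous one and all containing [A]. Their centers on [A], together with 0, form a chain of
    length 3. *)
Theorem trdeg_le2 A (c1 c2 c3 : F) : affine_ring iota A ->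
  (~ exists Q, prime_chain A 3 Q) -> ~ indep3 k0 c1 c2 c3.
Proof.
move=> [[hA AK] [gens hgens] fracA] hdim hc.
have [a1 [b1 [Aa1 Ab1 b10 e1]]] := fracA c1.
have [a2 [b2 [Aa2 Ab2 b20 e2]]] := fracA c2.
have [a3 [b3 [Aa3 Ab3 b30 e3]]] := fracA c3.
(* Keeping the generators in V3 keeps [A] in it. Keeping the inverses makes each denominator b_i a
   unit, so the element b_i (c_i - x_i) of [A] witnesses that consecutive centers differ. *)
pose ss := gens ++ [:: b1^-1; b2^-1; b3^-1].
have [k [hk k0k [h1 h2 h3] hss]] := indep3_enlarge ss base_subfield hc.
have hk1 := adj_subfield c1 hk; have hk2 := adj_subfield c2 hk1.
have kK a : k (iota a) by apply: k0k; exists a.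
have kK1 a : adj k c1 (iota a) by apply: adj_sub.
have kK2 a : adj (adj k c1) c2 (iota a) by apply: adj_sub.
have vT : val_ring [set: F] by split=> //; left.
have hss0 s : s \in ss -> [set: F] s /\ alg_mod [set: F] (adj (adj (adj k c1) c2) c3) s.
  by move=> /hss.
have [x3 _ [V1 [vV1 [_ _] kV1 m1 hss1]]] := specialize [::] vT hk2 kK2 (@subsetT _ _) h3 hss0.
have [x2 _ [V2 [vV2 [V21 m12] kV2 m2 hss2]]] := specialize [::] vV1 hk1 kK1 kV1 h2 hss1.
have [x1 _ [V3 [vV3 [V32 m23] kV3 m3 hss3]]] := specialize [::] vV2 hk kK kV2 h1 hss2.
have AV3 : A `<=` V3.
  move=> x /hgens; apply; first by split; [case: vV3|move=> a; apply: kV3].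
  by move=> y yg; have [] := hss3 y; rewrite // mem_cat yg.
have AV2 : A `<=` V2 by move=> x /AV3/V32.
have AV1 : A `<=` V1 by move=> x /AV2/V21.
have binV b : b \in [:: b1; b2; b3] -> V3 b^-1.
  by move=> hb; have [] := hss3 b^-1; rewrite // mem_cat (map_f (fun x => x^-1) hb) orbT.
have prm V : val_ring V -> A `<=` V -> prime_of A (maxid V `&` A).
  move=> vV AV; apply: (@prime_contract _ V) => //; first by case: vV.
  exact/local_maxid_prime/val_local.
have num V a b c x : val_ring V -> A `<=` V -> A a -> A b -> b != 0 -> c = a / b ->
    maxid V (c - iota x) -> (maxid V `&` A) (b * (c - iota x)).
  move=> vV AV Aa Ab b0 ec mc; split.
    have [_ [_ _ _ h]] := val_local vV; apply: h => //; exact: AV.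
  have -> : b * (c - iota x) = a - b * iota x by rewrite ec; field.
  by apply: subringB => //; apply: subringM.
have nnum V b c x : val_ring V -> V b^-1 -> V (c - iota x)^-1 -> b != 0 ->
    c - iota x != 0 -> ~ maxid V (b * (c - iota x)).
  move=> [hV _] Vb Vc b0 c0; apply: unit_nmaxid; last by rewrite mulf_neq0.
  by rewrite invfM; apply: subringM.
have [hkr1 [hkr2 hkr3]] : subring k /\ subring (adj k c1) /\ subring (adj (adj k c1) c2).
  by case: hk; case: hk1; case: hk2.
have n1 := transc_XsubC hkr1 (kK x1) h1.
have n2 := transc_XsubC hkr2 (kK1 x2) h2.
have n3 := transc_XsubC hkr3 (kK2 x3) h3.
apply: hdim; exists (nth setT [:: [set 0]; maxid V1 `&` A; maxid V2 `&` A; maxid V3 `&` A]).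
split.
  case=> [|[|[|[|//]]]] _ /=; [exact: zero_prime|exact: prm|exact: prm|exact: prm].
case=> [|[|[|//]]] _ /=; split.
- move=> _ ->; split; last exact: subring0.
  by split; [apply: subring0; case: vV1|left].
- move=> /(_ _ (num _ _ _ _ _ vV1 AV1 Aa3 Ab3 b30 e3 m1)) /eqP.
  by rewrite mulf_eq0 (negPf b30) (negPf n3).
- by move=> x [/m12 mx Ax].
- move=> /(_ _ (num _ _ _ _ _ vV2 AV2 Aa2 Ab2 b20 e2 m2)) [].
  move=> h _; move: h; apply: nnum => //.
    by apply/V21/V32/binV; rewrite !inE eqxx orbT.
  apply: kV1; have [_ h] := hk2; apply: h; apply: subringB => //; exact: adj_mem.
- by move=> x [/m23 mx Ax].
- move=> /(_ _ (num _ _ _ _ _ vV3 AV3 Aa1 Ab1 b10 e1 m3)) [].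
  move=> h _; move: h; apply: nnum => //.
    by apply/V32/binV; rewrite !inE eqxx.
  apply: kV2; have [_ h] := hk1; apply: h; apply: subringB => //; exact: adj_mem.
Qed.

(** One element from each jump of the chain, starting at the top, gives three independent elements
    by [transc_prime]. Only the function field is compared with [A], so [S] can be any local ring of
    a model. *)
Lemma no_prime_chain3 A S Q : affine_ring iota A ->
  (~ exists Q, prime_chain A 3 Q) -> subalgebra iota S -> ~ prime_chain S 3 Q.
Proof.
move=> hA hdim [hS SK] [hQ ltQ].
have [h0 h1 h2 h3] : [/\ prime_of S (Q 0%N), prime_of S (Q 1%N),
  prime_of S (Q 2%N) & prime_of S (Q 3%N)] by split; apply: hQ.
have [l1 /existsNP[z3 /not_implyP[q3 n3]]] := ltQ 0%N isT.
have [l2 /existsNP[z2 /not_implyP[q2 n2]]] := ltQ 1%N isT.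
have [l3 /existsNP[z1 /not_implyP[q1 n1]]] := ltQ 2%N isT.
have k0S : k0 `<=` localization S (Q 3%N).
  by move=> _ [a _ <-]; apply: loc_sub.
have [t1 a1] := transc_prime hS h2 h3 l3 base_subfield k0S q1 n1.
have hk1 := adj_subfield z1 base_subfield.
have [t2 a2] := transc_prime hS h1 h2 l2 hk1 a1 q2 n2.
have hk2 := adj_subfield z2 hk1.
have [t3 a3] := transc_prime hS h0 h1 l1 hk2 a2 q3 n3.
exact: (@trdeg_le2 _ z1 z2 z3 hA hdim).
Qed.

End TranscendenceDegree.

(** * Dimension, residue fields, codimension *)

Section LocalDimension.
Variable F : fieldType.
Implicit Types (S P Q p : set F).

Lemma prime_chain_le S n m (Q : nat -> set F) : (n <= m)%N -> prime_chain S m Q -> prime_chain S n Q.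
Proof.
move=> nm [hQ ltQ]; split=> i hi; first by apply: hQ; apply: leq_trans nm.
by apply: ltQ; apply: leq_trans nm.
Qed.

Lemma krull_dim_chain S n m (Q : nat -> set F) : krull_dim S n -> prime_chain S m Q -> (m <= n)%N.
Proof.
move=> [_ h] hQ; rewrite leqNgt; apply/negP => nm; apply: h; exists Q.
exact: prime_chain_le hQ.
Qed.

Lemma krull_dim_uniq S n m : krull_dim S n -> krull_dim S m -> n = m.
Proof.
move=> hn hm; apply/eqP; rewrite eqn_leq.
case: (hn) => -[Q hQ] _; case: (hm) => -[Q' hQ'] _.
by rewrite (krull_dim_chain hm hQ) (krull_dim_chain hn hQ').
Qed.

Lemma prime_le_maxid S P : local_ring S -> prime_of S P -> P `<=` maxid S.
Proof.
move=> hS hP x Px; have Sx := prime_sub hP Px; apply: contrapT => nx.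
apply: (prime1 hP); rewrite -(mulVf (maxid_n0 Sx nx)).
by apply: (primeMl hP) => //; apply: maxid_nunit.
Qed.

Lemma set_lt_neq (P Q : set F) : P `<=` Q -> P <> Q -> P `<` Q.
Proof. by move=> PQ ne; split=> // QP; apply: ne; apply/seteqP. Qed.

Lemma prime_chain1 S P Q : prime_of S P -> prime_of S Q -> P `<` Q ->
  prime_chain S 1 (nth setT [:: P; Q]).
Proof. by move=> hP hQ PQ; split=> [[|[|]]|[|]]. Qed.

Lemma prime_chain2 S P1 P2 P3 : prime_of S P1 -> prime_of S P2 -> prime_of S P3 ->
  P1 `<` P2 -> P2 `<` P3 -> prime_chain S 2 (nth setT [:: P1; P2; P3]).
Proof. by move=> *; split=> [[|[|[|]]]|[|[|]]]. Qed.

Lemma prime_chain3 S P1 P2 P3 P4 : prime_of S P1 -> prime_of S P2 ->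
  prime_of S P3 -> prime_of S P4 -> P1 `<` P2 -> P2 `<` P3 -> P3 `<` P4 ->
  prime_chain S 3 (nth setT [:: P1; P2; P3; P4]).
Proof. by move=> *; split=> [[|[|[|[|]]]]|[|[|[|]]]]. Qed.

Lemma dim1_primes S Q : local_ring S -> krull_dim S 1 -> prime_of S Q ->
  Q = [set 0] \/ Q = maxid S.
Proof.
move=> hS hd hQ; apply: contrapT => /not_orP[n0 nm].
have hS' : subring S by case: hS.
have lt1 : [set 0] `<` Q.
  by apply: set_lt_neq; [move=> _ ->; apply: prime0 hQ|move/esym].
have lt2 : Q `<` maxid S by apply: set_lt_neq => //; apply: prime_le_maxid.
have := prime_chain2 (zero_prime hS') hQ (local_maxid_prime hS) lt1 lt2.
by move/(krull_dim_chain hd).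
Qed.

Lemma dim2_primes S p Q : local_ring S -> krull_dim S 2 -> prime_of S p ->
  p <> [set 0] -> prime_of S Q -> p `<=` Q -> Q = p \/ Q = maxid S.
Proof.
move=> hS hd hp p0 hQ pQ; apply: contrapT => /not_orP[n0 nm].
have hS' : subring S by case: hS.
have lt1 : [set 0] `<` p.
  by apply: set_lt_neq; [move=> _ ->; apply: prime0 hp|move/esym].
have lt2 : p `<` Q by apply: set_lt_neq => // /esym.
have lt3 : Q `<` maxid S by apply: set_lt_neq => //; apply: prime_le_maxid.
have := prime_chain3 (zero_prime hS') hp hQ (local_maxid_prime hS) lt1 lt2 lt3.
by move/(krull_dim_chain hd).
Qed.

(* S/p is a local domain of dimension 1 with principal maximal ideal, hence a
   discrete valuation ring; no Noetherian hypothesis is involved. *)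
Lemma dvr_decomposition S p y : local_ring S -> prime_of S p ->
  maxid S y -> ~ p y ->
  (forall z, maxid S z -> exists pi s, [/\ p pi, S s & z = pi + y * s]) ->
  (forall Q, prime_of S Q -> p `<=` Q -> Q = p \/ Q = maxid S) ->
  forall s, S s -> ~ p s -> exists n u, [/\ S u, ~ maxid S u & p (s - y ^+ n * u)].
Proof.
move=> hS hp my ny gen dim s Ss ns.
have [hSr hm] := hS; have hmp := local_maxid_prime hS; have pm := prime_le_maxid hS hp.
have Sy := maxid_sub my; have hpi := prime_ideal hp.
pose D a := exists n u, [/\ S u, ~ maxid S u & p (a - y ^+ n * u)].
(* The intersection of all p + y^n S. Elements without the desired form lie in it, and this makes it
   prime; it contains [p], so it is [p] or the maximal ideal. *)
pose Q := [set a | S a /\ forall n, exists2 t, S t & p (a - y ^+ n * t)].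
have DQ a : S a -> ~ D a -> Q a.
  move=> Sa nD; split=> //; elim=> [|n [t St pt]].
    by exists a; rewrite // expr0 mul1r subrr; apply: prime0 hp.
  have mt : maxid S t by apply: contrapT => nt; apply: nD; exists n, t.
  have [pi [t' [ppi St' et]]] := gen _ mt; exists t' => //.
  have -> : a - y ^+ n.+1 * t' = (a - y ^+ n * t) + y ^+ n * pi by rewrite et exprS; ring.
  by apply: (primeD hp) => //; apply: (primeMl hp) => //; apply: subringX.
apply: contrapT => nD; have Qs := DQ _ Ss nD.
have hQ : prime_of S Q.
  split; first split.
  - by move=> a [].
  - split; first exact: subring0.
    move=> n; exists 0; first exact: subring0.
    by rewrite mulr0 subrr; apply: prime0 hp.
  - move=> a b [Sa Qa] [Sb Qb]; split; first exact: subringD.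
    move=> n; have [t St pt] := Qa n; have [t' St' pt'] := Qb n.
    exists (t + t'); first exact: subringD.
    by rewrite mulrDr opprD addrACA; apply: (primeD hp).
  - move=> a b Sa [Sb Qb]; split; first exact: subringM.
    move=> n; have [t St pt] := Qb n; exists (a * t); first exact: subringM.
    by rewrite mulrCA -mulrBr; apply: (primeMl hp).
  - move=> [_ /(_ 1%N)[t St pt]]; apply: (prime1 hmp).
    have -> : 1 = (1 - y ^+ 1 * t) + t * y by rewrite expr1; ring.
    by apply: (primeD hmp); [apply: pm|apply: (primeMl hmp)].
  - move=> a b Sa Sb [_ Qab]; apply: contrapT => /not_orP[nQa nQb].
    have [i [u [Su nu pu]]] : D a by apply: contrapT => /(DQ _ Sa).
    have [j [v [Sv nv pv]]] : D b by apply: contrapT => /(DQ _ Sb).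
    have [t St pt] := Qab (i + j).+1.
    have h : p (y ^+ (i + j) * (u * v - y * t)).
      have -> : y ^+ (i + j) * (u * v - y * t) =
        (a * b - y ^+ (i + j).+1 * t) - (b * (a - y ^+ i * u) + y ^+ i * u * (b - y ^+ j * v)).
        by rewrite exprS exprD; ring.
      apply: (idealB hSr hpi) => //; apply: (primeD hp); apply: (primeMl hp) => //.
      by apply: subringM => //; apply: subringX.
    have Suv : S (u * v) by apply: subringM.
    have Sd : S (u * v - y * t) by apply: subringB => //; apply: subringM.
    have pd : p (u * v - y * t).
      by apply: contrapT => nd; move: h; apply: (prime_nM hp) => //; [exact: subringX|exact: (prime_nX hSr hp)].
    have : maxid S (u * v).
      have -> : u * v = (u * v - y * t) + t * y by ring.
      by apply: (primeD hmp); [apply: pm|apply: (primeMl hmp)].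
    exact: (prime_nM hmp).
have pQ : p `<=` Q.
  move=> a pa; have Sa := prime_sub hp pa; split=> // n; exists 0; first exact: subring0.
  by rewrite mulr0 subr0.
(* In the other case [y] itself is divisible by y^2 modulo [p], and cancelling [y] gives a unit in
   [p]. *)
case: (dim _ hQ pQ) => e; first by apply: ns; rewrite -e.
have [_ /(_ 2%N)[t St pt]] : Q y by rewrite e.
have S1 : S (1 - y * t) by apply: subringB; [| apply: subring1|apply: subringM].
have : p (1 - y * t).
  apply: contrapT => n1; have {}pt : p (y * (1 - y * t)).
    by have -> : y * (1 - y * t) = y - y ^+ 2 * t by ring.
  by move: pt; apply: (prime_nM hp).
move=> /pm m1; apply: (prime1 hmp); have -> : 1 = (1 - y * t) + t * y by ring.
by apply: (primeD hmp) => //; apply: (primeMl hmp).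
Qed.

Lemma mem_localization_at S V p : local_ring V -> subring S -> S `<=` V ->
  p = maxid V `&` S -> dominates V (localization S p) /\ prime_of S p.
Proof.
move=> hV hS SV ->; have [hVr hVm] := hV.
have hp := prime_contract hVr hS SV (local_maxid_prime hV).
split=> //; split=> [_ [a [b [Sa Sb nb ->]]]|z /(maxid_loc hp)[a [b [[ma Sa] Sb nb ->]]]].
  apply: subringM => //; first exact: SV.
  by apply: maxid_nunit; [apply: SV|move=> mb; apply: nb].
rewrite mulrC; case: hVm => _ _ _; apply=> //; apply: maxid_nunit; first exact: SV.
by move=> mb; apply: nb.
Qed.

End LocalDimension.

Section ResidueFields.
Variables (K : closedFieldType) (F : fieldType) (iota : {rmorphism K -> F}).
Variables (A : set F) (hA : affine_ring iota A).
Hypothesis dimA : ~ exists Q, prime_chain A 3 Q.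
Local Notation k0 := (base_field iota).
Implicit Types S : set F.

Lemma transc_mod_maxid S k (c : F) : local_ring S -> subfield k -> k `<=` S -> S c ->
  (forall p, coefs_in k p -> p != 0 -> ~ maxid S p.[c]) ->
  transc k c /\ adj k c `<=` S.
Proof.
move=> [hS hm] hk kS Sc h; split.
  move=> p hp pc; apply/eqP; apply: contrapT => /negP /(h _ hp); apply; rewrite pc.
  by case: hm.
have Sp p : coefs_in k p -> S p.[c] by move=> hp; apply: subring_horner => // i; apply: kS.
move=> _ [p [q [hp hq q0 ->]]]; apply: subringM => //; first exact: Sp.
apply: maxid_nunit; first exact: Sp.
by apply: h => //; apply: contraNneq q0 => ->; rewrite horner0.
Qed.

Lemma base_sub S : subalgebra iota S -> k0 `<=` S.
Proof. by case=> _ h _ [a _ <-]. Qed.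

(** The list of roots is fixed before the local ring: one finite list of values serves all points,
    which [zeros_finite] exploits. *)
Lemma root_residue (p : {poly F}) : coefs_in k0 p -> p != 0 ->
  exists r : seq K, forall S (t : F), local_ring S -> subalgebra iota S -> S t ->
    maxid S p.[t] -> exists2 a, a \in r & maxid S (t - iota a).
Proof.
move=> hp p0; have [q eq] : exists q : {poly K}, p = map_poly iota q.
  have hq i : exists a, iota a = p`_i by have [a _ <-] := hp i; exists a.
  exists (\poly_(i < size p) sval (cid (hq i))).
  apply/polyP => i; rewrite coef_map coef_poly; case: ltnP => hi.
    exact/esym/(svalP (cid (hq i))).
  by rewrite nth_default // [RHS]rmorph0.
have [r er] := closed_field_poly_normal q.
have q0 : lead_coef q != 0.
  by rewrite lead_coef_eq0; apply: contraNneq p0 => q0; rewrite eq q0 rmorph0.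
exists r => S t hS hSK St mp; have [hSr hm] := hS; have hmp := local_maxid_prime hS.
have k0S := base_sub hSK.
have : maxid S (\prod_(a <- r) (t - iota a)).
  have -> : \prod_(a <- r) (t - iota a) = iota (lead_coef q)^-1 * p.[t].
    suff -> : p.[t] = iota (lead_coef q) * \prod_(a <- r) (t - iota a).
      by rewrite mulrA -rmorphM mulVf // rmorph1 mul1r.
    rewrite eq {1}er map_polyZ hornerZ rmorph_prod horner_prod; congr (_ * _).
    by apply: eq_bigr => a _; rewrite rmorphB /= map_polyX map_polyC hornerXsubC.
  by apply: (primeMl hmp) => //; apply: k0S; exists (lead_coef q)^-1.
elim: r {er} => [|a r IH]; first by rewrite big_nil => /(prime1 hmp).
rewrite big_cons; case: (pselect (maxid S (t - iota a))) => [ma _|na].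
  by exists a; rewrite ?inE ?eqxx.
have Sta b : S (t - iota b) by apply: subringB => //; apply: k0S; exists b.
case: (pselect (maxid S (\prod_(a <- r) (t - iota a)))) => [/IH[b br mb] _|nm].
  by exists b; rewrite ?inE ?br ?orbT.
move=> h; case: (prime_nM hmp _ _ na nm h) => //.
by apply: subring_prod => // b _.
Qed.

(** The Nullstellensatz at a closed point. A residue that is not a constant is transcendental over
    K; together with one element from each jump of a chain of length 2 it would give three
    independent elements. *)
Lemma residue_constant S (t : F) : local_ring S -> subalgebra iota S ->
  krull_dim S 2 -> S t -> exists a, maxid S (t - iota a).
Proof.
move=> hS hSK hd St; apply: contrapT => nex.
have [hSr hm] := hS; have hmp := local_maxid_prime hS.
have k0S := base_sub hSK; have hk0 := base_subfield iota.
have h p : coefs_in k0 p -> p != 0 -> ~ maxid S p.[t].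
  move=> hp p0 mp.
  have [r hr] := root_residue hp p0; have [a _ ma] := hr S t hS hSK St mp.
  by apply: nex; exists a.
have [tt tS] := transc_mod_maxid hS hk0 k0S St h.
have [[Q [hQ ltQ]] _] := hd.
have [h0 h1 h2] : [/\ prime_of S (Q 0%N), prime_of S (Q 1%N) & prime_of S (Q 2%N)].
  by split; apply: hQ.
have [l1 /existsNP[z2 /not_implyP[q2 n2]]] := ltQ 0%N isT.
have [l2 /existsNP[z1 /not_implyP[q1 n1]]] := ltQ 1%N isT.
have m1 := prime_le_maxid hS h2 q1; have l3 := prime_le_maxid hS h1.
have hk1 := adj_subfield t hk0; have hk2 := adj_subfield z1 hk1.
rewrite -(loc_maxid hS) in tS.
have [t1 a1] := transc_prime hSr h1 hmp l3 hk1 tS m1 n1.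
have [t2 a2] := transc_prime hSr h0 h1 l1 hk2 a1 q2 n2.
exact: (@trdeg_le2 _ _ iota A t z1 z2 hA dimA).
Qed.

(** The residue field has transcendence degree at most 1: two independent residues and a nonzero
    element [w] of the maximal ideal would be three independent elements. *)
Lemma residue_algebraic S (h x w : F) : local_ring S -> subalgebra iota S ->
  maxid S w -> w != 0 -> S h -> S x ->
  (forall p, coefs_in k0 p -> p != 0 -> ~ maxid S p.[h]) ->
  alg_mod S (adj k0 h) x.
Proof.
move=> hS hSK mw w0 Sh Sx trh; apply: contrapT => nex.
have [hSr hm] := hS; have hmp := local_maxid_prime hS.
have k0S := base_sub hSK; have hk0 := base_subfield iota.
have [th hS1] := transc_mod_maxid hS hk0 k0S Sh trh.
have hk1 := adj_subfield h hk0; have hk2 := adj_subfield x hk1.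
have [tx hS2] : transc (adj k0 h) x /\ adj (adj k0 h) x `<=` S.
  by apply: transc_mod_maxid => // p hp p0 mp; apply: nex; exists p.
rewrite -(loc_maxid hS) in hS2.
have l : [set 0] `<=` maxid S by move=> _ ->; apply: prime0 hmp.
have nw : ~ [set 0] w by move=> e; move: w0; rewrite e eqxx.
have [tw _] := transc_prime hSr (zero_prime hSr) hmp l hk2 hS2 mw nw.
exact: (@trdeg_le2 _ _ iota A h x w hA dimA).
Qed.

End ResidueFields.

Section Codimension.
Variables (K : fieldType) (F : fieldType) (iota : {rmorphism K -> F}).
Implicit Types (V W I Y : set F) (d e : nat).

Definition ksubspace V :=
  V 0 /\ forall a x y, V x -> V y -> V (iota a * x + y).

(** For subspaces, [spans] bounds the dimension of V/(V meet W) from above by [d], and [indep]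
    bounds it from below. One-sided bounds suffice, so no dimension is ever defined. *)
Definition spans V W d := exists b : 'I_d -> F, (forall i, V (b i)) /\
  forall x, V x -> exists c : 'rV[K]_d, W (x - \sum_i iota (c 0 i) * b i).

Definition indep V W d := exists b : 'I_d -> F, (forall i, V (b i)) /\
  forall c : 'rV[K]_d, W (\sum_i iota (c 0 i) * b i) -> c = 0.

Lemma ksub_sum V (T : Type) (r : seq T) (P : pred T) (c : T -> K) (f : T -> F) :
  ksubspace V -> (forall i, P i -> V (f i)) -> V (\sum_(i <- r | P i) iota (c i) * f i).
Proof.
by move=> [V0 VD] h; elim/big_rec: _ => // i x Pi Vx; apply: VD => //; apply: h.
Qed.

Lemma ksubD V x y : ksubspace V -> V x -> V y -> V (x + y).
Proof. by move=> [_ h] Vx Vy; rewrite -[x]mul1r -(rmorph1 iota); apply: h. Qed.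

Lemma ksubZ V a x : ksubspace V -> V x -> V (iota a * x).
Proof. by move=> [h0 h] Vx; rewrite -[_ * _]addr0; apply: h. Qed.

Lemma ksubN V x : ksubspace V -> V x -> V (- x).
Proof. by move=> hV Vx; rewrite -mulN1r -(rmorph1 iota) -rmorphN; apply: ksubZ. Qed.

Lemma ksubB V x y : ksubspace V -> V x -> V y -> V (x - y).
Proof. by move=> hV Vx Vy; apply: ksubD => //; apply: ksubN. Qed.

Lemma sum_row_mx d e (c : 'rV[K]_(d + e)) (b : 'I_(d + e) -> F) :
  \sum_i iota (c 0 i) * b i = \sum_i iota (lsubmx c 0 i) * b (lshift e i)
    + \sum_i iota (rsubmx c 0 i) * b (rshift d i).
Proof.
rewrite big_split_ord; congr (_ + _); apply: eq_bigr => i _; first by rewrite mxE.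
by rewrite mxE.
Qed.

Definition cat_fun d e (b : 'I_d -> F) (b' : 'I_e -> F) (i : 'I_(d + e)) : F :=
  match fintype.split i with inl j => b j | inr j => b' j end.

Lemma cat_funl d e (b : 'I_d -> F) (b' : 'I_e -> F) i : cat_fun b b' (lshift e i) = b i.
Proof. by rewrite /cat_fun -[lshift e i]/(unsplit (inl i)) unsplitK. Qed.
Lemma cat_funr d e (b : 'I_d -> F) (b' : 'I_e -> F) i : cat_fun b b' (rshift d i) = b' i.
Proof. by rewrite /cat_fun -[rshift d i]/(unsplit (inr i)) unsplitK. Qed.

Lemma sum_cat_fun d e (c : 'rV[K]_(d + e)) (b : 'I_d -> F) (b' : 'I_e -> F) :
  \sum_i iota (c 0 i) * cat_fun b b' i = \sum_i iota (lsubmx c 0 i) * b i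
    + \sum_i iota (rsubmx c 0 i) * b' i.
Proof.
rewrite sum_row_mx; congr (_ + _); apply: eq_bigr => i _.
  by rewrite cat_funl.
by rewrite cat_funr.
Qed.

Lemma cat_funP V d e (b : 'I_d -> F) (b' : 'I_e -> F) :
  (forall i, V (b i)) -> (forall i, V (b' i)) -> forall i, V (cat_fun b b' i).
Proof. by move=> h h' i; rewrite /cat_fun; case: fintype.split. Qed.

Lemma spans_trans V W I d e : W `<=` V -> spans V W d -> spans W I e -> spans V I (d + e).
Proof.
move=> WV [b [hb sb]] [b' [hb' sb']]; exists (cat_fun b b'); split.
  by apply: cat_funP => // i; apply: WV.
move=> x /sb[c /sb'[c' hc]]; exists (row_mx c c').
by rewrite sum_cat_fun row_mxKl row_mxKr opprD addrA.
Qed.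

Lemma spans0 V W : V `<=` W -> spans V W 0.
Proof.
move=> VW; exists (fun=> 0); split=> [[]//|x /VW Wx]; exists 0.
by rewrite big_ord0 subr0.
Qed.

Lemma spans_le V W d e : V 0 -> (d <= e)%N -> spans V W d -> spans V W e.
Proof.
move=> V0 /subnKC <- [b [hb sb]]; exists (cat_fun b (fun=> 0)); split.
  exact: cat_funP.
move=> x /sb[c hc]; exists (row_mx c 0); rewrite sum_cat_fun row_mxKl row_mxKr.
by rewrite [X in _ - (_ + X)]big1 ?addr0 // => i _; rewrite mulr0.
Qed.

Lemma spans_sub V W W' d : W `<=` W' -> spans V W d -> spans V W' d.
Proof. by move=> WW' [b [hb sb]]; exists b; split=> // x /sb[c /WW']; exists c. Qed.

Lemma spans1 V W : V 0 ->
  (forall x y, V x -> V y -> ~ W y -> exists a, W (x - iota a * y)) -> spans V W 1.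
Proof.
move=> V0 h; case: (pselect (V `<=` W)) => [VW|].
  exact: spans_le (leq0n _) (spans0 VW).
move=> /existsNP[y /not_implyP[Vy nWy]]; exists (fun=> y); split=> // x Vx.
by have [a Wa] := h _ _ Vx Vy nWy; exists (a%:M); rewrite big_ord1 mxE eqxx mulr1n.
Qed.

Lemma indep_trans V W I d e : W `<=` V -> I `<=` W -> ksubspace W ->
  indep V W d -> indep W I e -> indep V I (d + e).
Proof.
move=> WV cycle_ideal hW [b [hb ib]] [b' [hb' ib']]; exists (cat_fun b b'); split.
  by apply: cat_funP => // i; apply: WV.
move=> c; rewrite sum_cat_fun => Ic.
have l0 : lsubmx c = 0.
  apply: ib; pose t := \sum_i iota (rsubmx c 0 i) * b' i.
  rewrite -[\sum_i _](addrK t); apply: (ksubB hW); first exact: cycle_ideal.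
  exact: ksub_sum.
have r0 : rsubmx c = 0.
  apply: ib'; move: Ic; rewrite l0 [X in X + _]big1 ?add0r // => i _.
  by rewrite mxE rmorph0 mul0r.
by rewrite -[c]hsubmxK l0 r0 row_mx0.
Qed.

Lemma indep0 V W : indep V W 0.
Proof. by exists (fun=> 0); split=> [[]//|c _]; apply/rowP => -[]. Qed.

Lemma indep_le V W d e : (e <= d)%N -> indep V W d -> indep V W e.
Proof.
move=> /subnKC <- [b [hb ib]]; exists (fun i => b (lshift _ i)); split=> // c hc.
have := ib (row_mx c 0); rewrite sum_row_mx row_mxKl row_mxKr [X in _ + X]big1 ?addr0.
  by move=> /(_ hc) /(congr1 lsubmx); rewrite row_mxKl => ->; apply/rowP => i; rewrite !mxE.
by move=> i _; rewrite mxE rmorph0 mul0r.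
Qed.

Lemma indep_sub V V' W W' d : V `<=` V' -> W' `<=` W -> indep V W d -> indep V' W' d.
Proof.
by move=> VV' WW' [b [hb ib]]; exists b; split=> [i|c /WW']; [apply: VV'|apply: ib].
Qed.

Lemma indep_mul V W V' W' d a : ksubspace V -> (forall x, V x -> V' (a * x)) ->
  (forall x, V x -> W' (a * x) -> W x) -> indep V W d -> indep V' W' d.
Proof.
move=> hV h1 h2 [b [hb ib]]; exists (fun i => a * b i); split=> [i|c hc]; first exact: h1.
apply/ib/h2; first exact: ksub_sum.
by rewrite mulr_sumr; under eq_bigr do rewrite mulrCA.
Qed.

Lemma indep_rep V W Y d : ksubspace W -> (forall x, V x -> exists2 y, Y y & W (x - y)) ->
  indep V W d -> indep Y W d.
Proof.
move=> hW h [b [hb ib]]; pose y i := sval (cid2 (h _ (hb i))).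
have hy i : Y (y i) /\ W (b i - y i) by rewrite /y; case: cid2.
exists y; split=> [i|c hc]; first by case: (hy i).
apply: ib; have -> : \sum_i iota (c 0 i) * b i =
   \sum_i iota (c 0 i) * (b i - y i) + \sum_i iota (c 0 i) * y i.
  by rewrite -big_split /=; apply: eq_bigr => i _; rewrite -mulrDr subrK.
by apply: ksubD => //; apply: ksub_sum => // i _; case: (hy i).
Qed.

(* The kernel of the coordinate matrix modulo W has rank at least e - d. *)
Lemma indep_spans V W I d e : ksubspace W ->
  indep V I e -> spans V W d -> indep W I (e - d).
Proof.
move=> hW [b [hb ib]] [s [hs ss]].
pose cf i := sval (cid (ss _ (hb i))).
have cfP i : W (b i - \sum_j iota (cf i 0 j) * s j) := svalP (cid (ss _ (hb i))).
pose C : 'M[K]_(e, d) := \matrix_(i, j) cf i 0 j.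
pose N := row_base (kermx C).
have rN : row_free N := row_base_free _.
have NC : N *m C = 0.
  by apply/sub_kermxP; rewrite eq_row_base.
have rk : (e - d <= \rank (kermx C))%N by rewrite mxrank_ker leq_sub2l // rank_leq_col.
apply: (indep_le rk); exists (fun k => \sum_i iota (N k i) * b i); split=> [k|c hc].
  have -> : \sum_i iota (N k i) * b i =
      \sum_i iota (N k i) * (b i - \sum_j iota (cf i 0 j) * s j).
    apply/eqP; rewrite -subr_eq0 -sumrB; apply/eqP.
    transitivity (\sum_i \sum_j iota (N k i * C i j) * s j).
      apply: eq_bigr => i _; rewrite -mulrBr subKr mulr_sumr; apply: eq_bigr => j _.
      by rewrite [C i j]mxE rmorphM mulrA.
    rewrite exchange_big /= big1 // => j _; rewrite -mulr_suml -rmorph_sum /=.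
    have /matrixP/(_ k j) := NC; rewrite !mxE => ->; by rewrite rmorph0 mul0r.
  by apply: ksub_sum.
have cN : c *m N = 0.
  apply: ib; suff -> : \sum_i iota ((c *m N) 0 i) * b i =
      \sum_k iota (c 0 k) * \sum_i iota (N k i) * b i by [].
  under [RHS]eq_bigr do rewrite mulr_sumr.
  rewrite exchange_big /=; apply: eq_bigr => i _; rewrite mxE rmorph_sum mulr_suml.
  by apply: eq_bigr => k _; rewrite rmorphM mulrA.
by apply: (row_free_inj rN); rewrite cN mul0mx.
Qed.

Lemma indep_spans_le V W d e : ksubspace W -> indep V W e -> spans V W d -> (e <= d)%N.
Proof.
move=> hW hi hs; have [b [hb ib]] := indep_spans hW hi hs.
rewrite -subn_eq0; case: (e - d)%N b hb ib => // n b hb ib; exfalso.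
have /matrixP/(_ 0 0) := ib (const_mx 1) (ksub_sum _ _ hW (fun i _ => hb i)).
by rewrite !mxE => /eqP; rewrite oner_eq0.
Qed.

End Codimension.

(** * The components of the exceptional divisor *)

Section Surface.
Variables (K : closedFieldType) (F : fieldType) (iota : {rmorphism K -> F}).
Variables (A mO : set F) (hX : normal_surface_singularity iota A mO).
Variables (M : set (set F)) (hM : good_resolution iota A mO M).
Implicit Types (R S T V p : set F) (f g h x y z : F).

Lemma surface_affine : affine_ring iota A. Proof. by case: hX. Qed.
Lemma surface_no_chain : ~ exists Q, prime_chain A 3 Q.
Proof. by case: hX => _ _ []. Qed.
Lemma surface_subalgebra : subalgebra iota A. Proof. by case: surface_affine. Qed.
Lemma surface_subring : subring A. Proof. by case: surface_subalgebra. Qed.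
Lemma mO_maximal : maximal_of A mO. Proof. by case: hX. Qed.
Lemma mO_sub : mO `<=` A. Proof. by case: mO_maximal => -[]. Qed.

Lemma model_chart S : M S -> exists T q,
  [/\ affine_ring iota T, prime_of T q & S = localization T q].
Proof.
case: hM => -[[[s hs ->] _] _ _ _ _] _ [T Ts [q hq ->]].
by exists T, q; split=> //; apply: hs.
Qed.

Lemma model_local S : M S -> local_ring S.
Proof. by move=> /model_chart[T [q [[[hT _] _ _] hq ->]]]; apply: loc_local. Qed.

Lemma model_subring S : M S -> subring S. Proof. by case/model_local. Qed.

Lemma model_base S : M S -> forall c, S (iota c).
Proof.
by move=> /model_chart[T [q [[[hT TK] _ _] hq ->]]] c; apply: loc_sub.
Qed.

Lemma model_subalgebra S : M S -> subalgebra iota S.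
Proof. by move=> MS; split; [apply: model_subring|apply: model_base]. Qed.

Lemma model_sub S : M S -> A `<=` S.
Proof. by case: hM => -[_ h _ _ _] _; apply: h. Qed.

Lemma model_prime S p : M S -> prime_of S p -> M (localization S p).
Proof.
case: hM => -[[[s hs ->] _] _ _ _ _] _ [T Ts [q hq ->]] hp.
have [[hT _] _ _] := hs _ Ts; exists T => //; exists (p `&` T).
  apply: prime_contract hp => //; last exact: loc_sub.
  exact: loc_subring.
exact: loc_loc.
Qed.

Lemma model_no_chain S Q : M S -> ~ prime_chain S 3 Q.
Proof.
move=> MS; apply: (no_prime_chain3 surface_affine surface_no_chain).
exact: model_subalgebra.
Qed.

Lemma model_separated V S S' : val_ring V -> (forall c, V (iota c)) -> M S -> M S' ->
  dominates V S -> dominates V S' -> S = S'.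
Proof.
case: hM => -[[_ h] _ _ _ _] _ [hV tot] VK; apply: h; by split.
Qed.

Lemma model_off_O S : M S -> ~ over_O A mO S ->
  prime_of A (maxid S `&` A) /\ S = localization A (maxid S `&` A).
Proof.
move=> MS nO; case: hM => -[_ _ _ _ /(_ S)[+ _]] _ => /(_ (conj MS nO)).
move=> [[P hP eS] _]; have hA := surface_subring.
have e : maxid S `&` A = P by rewrite eS maxid_loc_contract.
by rewrite e.
Qed.

Lemma over_O_intro S : M S -> mO `<=` maxid S -> over_O A mO S.
Proof.
move=> MS mS; case: mO_maximal => _ _; apply.
- have := prime_contract (model_subring MS) surface_subring (model_sub MS)
    (local_maxid_prime (model_local MS)).
  by case.
- by move=> x mx; split; [apply: mS|apply: mO_sub].
- by case=> /(prime1 (local_maxid_prime (model_local MS))).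
Qed.

Definition exc := exceptional A mO M.

Definition closed_pt S := [/\ M S, over_O A mO S & krull_dim S 2].

Section Divisor.
Variables (R : set F) (hR : exc R).

Lemma exc_M : M R. Proof. by case: hR. Qed.
Lemma exc_over : maxid R `&` A = mO. Proof. by case: hR. Qed.
Lemma exc_dim : krull_dim R 1. Proof. by case: hR. Qed.
Lemma exc_local : local_ring R. Proof. exact: model_local exc_M. Qed.
Lemma exc_subring : subring R. Proof. by case: exc_local. Qed.
Lemma exc_prime : prime_of R (maxid R). Proof. exact: local_maxid_prime exc_local. Qed.

End Divisor.

Definition unif R : F := xget 0 [set w | maxid R = principal R w].

Section Divisor2.
Variables (R : set F) (hR : exc R).
Let hRl := exc_local hR.
Let hRr := exc_subring hR.
Let hRp := exc_prime hR.

Lemma maxidE : maxid R = principal R (unif R).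
Proof.
suff h : exists w, maxid R = principal R w.
  exact: (@xgetPex _ 0 [set w | maxid R = principal R w] h).
have [d hd [s es]] : regular_local R by case: hM => -[_ _ _ h _] _; apply: h (exc_M hR).
have d1 := krull_dim_uniq hd (exc_dim hR); subst d.
exists (s 0); rewrite es; apply/seteqP; split=> x.
  by case=> c hc ->; exists (c 0); rewrite // big_ord1.
by case=> a Ra ->; exists (fun=> a); rewrite // big_ord1.
Qed.

Lemma maxid_unif : maxid R (unif R).
Proof. by rewrite maxidE; exists 1; [apply: subring1|rewrite mul1r]. Qed.

Lemma unif_n0 : unif R != 0.
Proof.
apply/eqP => w0; have [[Q [hQ ltQ]] _] := exc_dim hR.
have [l01 n01] := ltQ 0%N isT; apply: n01 => x /(prime_le_maxid hRl (hQ 1%N isT)).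
rewrite maxidE w0 => -[a _ ->]; rewrite mulr0.
exact: prime0 (hQ 0%N isT).
Qed.

Lemma exc_decomp x : R x -> x != 0 ->
  exists n u, [/\ R u, ~ maxid R u & x = unif R ^+ n * u].
Proof.
move=> Rx x0.
have [||||||n [u [Ru nu /= e]]] := @dvr_decomposition _ R [set 0] (unif R) hRl _ _ _ _ _ x Rx.
- exact: zero_prime.
- exact: maxid_unif.
- by move=> /= e; move: unif_n0; rewrite e eqxx.
- move=> z; rewrite maxidE => -[a Ra ->]; exists 0, a; split=> //.
  by rewrite add0r mulrC.
- by move=> Q hQ _; apply: dim1_primes hQ => //; apply: exc_dim.
- by move=> /= e; move: x0; rewrite e eqxx.
by exists n, u; split=> //; apply/eqP; rewrite -subr_eq0 e.
Qed.

Lemma exc_val : val_ring R.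
Proof.
split=> // x; case: (eqVneq x 0) => [->|x0]; first by left; apply: subring0.
have [T [q [[[hT _] _ frac] hq eR]]] := model_chart (exc_M hR).
have TR : T `<=` R by rewrite eR; apply: loc_sub.
have [a [b [Ta Tb b0 e]]] := frac x.
have a0 : a != 0 by apply: contraNneq x0 => a0; rewrite e a0 mul0r.
have [n [u [Ru nu eu]]] := exc_decomp (TR _ Ta) a0.
have [m [v [Rv nv ev]]] := exc_decomp (TR _ Tb) b0.
have w0 := unif_n0; have Rw := maxid_sub maxid_unif.
have u0 := maxid_n0 Ru nu; have v0 := maxid_n0 Rv nv.
have Ru' := maxid_nunit Ru nu; have Rv' := maxid_nunit Rv nv.
case: (leqP m n) => mn; [left|right]; rewrite e eu ev.
  rewrite -(subnK mn) exprD.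
  have -> : unif R ^+ (n - m) * unif R ^+ m * u / (unif R ^+ m * v) =
     unif R ^+ (n - m) * u / v by field; rewrite v0 expf_neq0.
  by apply: subringM => //; apply: subringM => //; apply: subringX.
rewrite -(subnK (ltnW mn)) exprD.
have -> : (unif R ^+ n * u / (unif R ^+ (m - n) * unif R ^+ n * v))^-1 =
   unif R ^+ (m - n) * v / u by field; rewrite u0 v0 !expf_neq0.
by apply: subringM => //; apply: subringM => //; apply: subringX.
Qed.

(** Order at least [k] along the component. As a membership it holds for 0 at every [k], so no order
    has to be assigned to 0. *)
Definition vge k x := R (x / unif R ^+ k).

Lemma vge0 x : vge 0 x <-> R x. Proof. by rewrite /vge expr0 divr1. Qed.

Lemma vge_le k l x : (l <= k)%N -> vge k x -> vge l x.
Proof.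
move=> lk h; rewrite /vge; have w0 := unif_n0.
have -> : x / unif R ^+ l = x / unif R ^+ k * unif R ^+ (k - l).
  by rewrite -{1}(subnK lk) exprD; field; rewrite !expf_neq0.
by apply: subringM => //; apply: subringX => //; exact: maxid_sub maxid_unif.
Qed.

Lemma vge1 x : vge 1 x <-> maxid R x.
Proof.
rewrite maxidE /vge expr1; split=> [h|[a Ra ->]]; last by rewrite mulfK // unif_n0.
by exists (x / unif R); rewrite // divfK // unif_n0.
Qed.

Lemma vgeD k x y : vge k x -> vge k y -> vge k (x + y).
Proof. by rewrite /vge mulrDl; apply: subringD. Qed.

Lemma vgeM k l x y : vge k x -> vge l y -> vge (k + l) (x * y).
Proof. by rewrite /vge exprD invfM mulrACA; apply: subringM. Qed.

Lemma vge_unit k x u : R u^-1 -> u != 0 -> vge k (x * u) -> vge k x.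
Proof.
move=> Ru u0 h; rewrite /vge; have -> : x / unif R ^+ k = x * u / unif R ^+ k * u^-1.
  by rewrite -[RHS]mulrA [_^-1 / u]mulrC mulrA mulfK.
exact: subringM.
Qed.

Lemma vgeS_maxid k x : R (x / unif R ^+ k) -> vge k.+1 x <-> maxid R (x / unif R ^+ k).
Proof. by move=> _; rewrite -vge1 /vge expr1 exprSr invfM mulrA. Qed.

Lemma vge_gen k x z : maxid R = principal R x -> vge k z <-> R (z / x ^+ k).
Proof.
move=> ex; have w0 := unif_n0.
have [a Ra ea] : principal R x (unif R) by rewrite -ex; apply: maxid_unif.
have [b Rb eb] : principal R (unif R) x.
  by rewrite -maxidE ex; exists 1; [apply: subring1|rewrite mul1r].
have x0 : x != 0 by apply: contraNneq w0 => x0; rewrite ea x0 mulr0.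
have a0 : a != 0 by apply: contraNneq w0 => a0; rewrite ea a0 mul0r.
have b0 : b != 0 by apply: contraNneq x0 => b0; rewrite eb b0 mul0r.
rewrite /vge; split=> h.
  have -> : z / x ^+ k = z / unif R ^+ k * a ^+ k.
    by rewrite ea exprMn; field; rewrite !expf_neq0.
  by apply: subringM => //; apply: subringX.
have -> : z / unif R ^+ k = z / x ^+ k * b ^+ k.
  by rewrite eb exprMn; field; rewrite !expf_neq0.
by apply: subringM => //; apply: subringX.
Qed.

(** The valuation ring [R] dominates both itself and the localization of [S] at the ideal of the
    component. Both belong to [M], and centers are unique. *)
Lemma exc_localization S : M S -> S `<=` R ->
  prime_of S (maxid R `&` S) /\ R = localization S (maxid R `&` S).
Proof.
move=> MS SR; have hS := model_subring MS.
have [dom hp] := mem_localization_at hRl hS SR erefl; split=> //.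
apply: (@model_separated R) => //; [exact: exc_val|exact: model_base (exc_M hR)|exact: exc_M|exact: model_prime|].
by split.
Qed.

Lemma exc_over_sub S : M S -> S `<=` R -> over_O A mO S.
Proof.
move=> MS SR; apply: over_O_intro => // x; rewrite -(exc_over hR) => -[mx Ax].
have [hp _] := exc_localization MS SR.
by apply: (prime_le_maxid (model_local MS) hp); split=> //; apply: model_sub Ax.
Qed.

Lemma component_n0 S : M S -> S `<=` R -> component_ideal R S <> [set 0].
Proof.
move=> MS SR e; have [hp eR] := exc_localization MS SR.
have : maxid R (unif R) := maxid_unif.
rewrite {1}eR => /(maxid_loc hp)[a [b [+ _ _ ew]]].
rewrite -[_ `&` _]/(component_ideal R S) e => /= a0.
by move: unif_n0; rewrite ew a0 mul0r eqxx.
Qed.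

(** If S <> R, the chain from 0 through the component ideal to the maximal ideal is strict, so the
    dimension is at least 2; chains of length 3 are excluded. *)
Lemma exc_sub_cases S : M S -> S `<=` R -> S = R \/ points_on M R S.
Proof.
move=> MS SR; case: (pselect (S = R)) => [|nSR]; [by left|right; split=> //].
have hSl := model_local MS; have [hp eR] := exc_localization MS SR.
have [d hd _] : regular_local S by case: hM => -[_ _ _ h _] _; apply/h.
suff e : d = 2%N by rewrite -e.
apply/eqP; rewrite eqn_leq; apply/andP; split.
  rewrite leqNgt; apply/negP => d3; have [[Q hQ] _] := hd.
  exact: model_no_chain MS (prime_chain_le d3 hQ).
have hS0 : subring S := model_subring MS.
have l1 : [set 0] `<` maxid R `&` S.
  apply: set_lt_neq; first by move=> _ ->; apply: prime0 hp.
  by move/esym; apply: component_n0.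
have l2 : maxid R `&` S `<` maxid S.
  apply: set_lt_neq; first exact: prime_le_maxid.
  by move=> e; apply: nSR; rewrite eR e loc_maxid.
exact: krull_dim_chain hd (prime_chain2 (zero_prime hS0) hp (local_maxid_prime hSl) l1 l2).
Qed.

Lemma points_closed S : points_on M R S -> closed_pt S.
Proof. by case=> MS SR dS; split=> //; apply: exc_over_sub. Qed.

End Divisor2.

Definition eqn S R : F := xget 1 [set x | component_ideal R S = principal S x].

Lemma principal_sub S x y : subring S -> principal S x = principal S y ->
  exists2 a, S a & x = a * y.
Proof.
move=> hS e; have : principal S x x by exists 1; [apply: subring1|rewrite mul1r].
by rewrite e.
Qed.

Section Local.
Variables (R S : set F) (hR : exc R) (hS : points_on M R S).
Let MS : M S. Proof. by case: hS. Qed.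
Let SR : S `<=` R. Proof. by case: hS. Qed.
Let dS : krull_dim S 2. Proof. by case: hS. Qed.
Let hSl := model_local MS.
Let hSr := model_subring MS.
Let hSp := local_maxid_prime hSl.
Local Notation cp := (component_ideal R S).
Local Notation X := (eqn S R).

Lemma component_prime : prime_of S cp.
Proof. by have [] := exc_localization hR MS SR. Qed.

Lemma loc_component : R = localization S cp.
Proof. by have [] := exc_localization hR MS SR. Qed.

Lemma eqnE : cp = principal S X.
Proof.
suff h : exists x, cp = principal S x.
  exact: (@xgetPex _ 1 [set x | cp = principal S x] h).
have [_ OS _] := points_closed hR hS; have [_ snc] := hM.
have [x [y [Sx Sy mS h]]] := snc _ MS OS dS.
by case: (h _ hR SR) => e; [exists x|exists y].
Qed.

Lemma cp_eqn : cp X.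
Proof. by rewrite eqnE; exists 1; [apply: subring1|rewrite mul1r]. Qed.
Lemma eqn_in : S X. Proof. exact: prime_sub component_prime _ cp_eqn. Qed.
Lemma eqn_n0 : X != 0.
Proof.
apply/eqP => X0; apply: (component_n0 hR MS SR); rewrite eqnE X0.
by apply/seteqP; split=> [_ [a _ ->]|_ ->]; [rewrite mulr0|exists 0; [apply: subring0|rewrite mulr0]].
Qed.

Lemma cpP z : cp z <-> exists2 a, S a & z = a * X.
Proof. by rewrite eqnE. Qed.

Lemma cp_iff z : S z -> cp z <-> maxid R z.
Proof. by move=> Sz; split=> [[]|] //. Qed.

Lemma maxid_eqn : maxid R = principal R X.
Proof.
apply/seteqP; split=> z.
  rewrite {1}loc_component => /(maxid_loc component_prime)[a [b [/cpP[s Ss ->] Sb nb ->]]].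
  exists (s / b); last by rewrite mulrAC.
  apply: subringM; [exact: exc_subring|exact: SR|].
  by apply: maxid_nunit; [apply: SR|move=> mb; apply: nb].
case=> a Ra ->; apply: (primeMl (exc_prime hR)) => //.
by have [] := cp_eqn.
Qed.

Lemma vge_eqn k z : vge R k z <-> R (z / X ^+ k).
Proof. by apply: vge_gen => //; apply: maxid_eqn. Qed.

Lemma div_eqn k z : S z -> vge R k z -> S (z / X ^+ k).
Proof.
move=> Sz; elim: k => [|k IH]; first by rewrite expr0 divr1.
move=> h; have Sk := IH (vge_le hR (leqnSn k) h); have X0 := eqn_n0.
have [a Sa ea] : exists2 a, S a & z / X ^+ k = a * X.
  apply/cpP/cp_iff => //; rewrite maxid_eqn; exists (z / X ^+ k.+1); first exact/vge_eqn.
  by rewrite exprSr invfM mulrA divfK.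
by rewrite exprSr invfM mulrA ea mulfK.
Qed.

Lemma component_neq_maxid : cp <> maxid S.
Proof.
move=> e; have eS : R = S by rewrite loc_component e loc_maxid.
by have := krull_dim_uniq dS; rewrite -eS => /(_ _ (exc_dim hR)).
Qed.

(** One of the two normal crossings coordinates generates the ideal of [R] and may be replaced by
    [X]. Any other component through the point has the other coordinate as equation, since two
    components with the same ideal coincide. *)
Lemma second_coordinate : exists y, [/\ S y,
  maxid S = [set z | exists a b, [/\ S a, S b & z = a * X + b * y]] &
  forall R', exc R' -> S `<=` R' -> R' <> R -> component_ideal R' S = principal S y].
Proof.
have [_ OS _] := points_closed hR hS; have [_ snc] := hM.
have [x [y [Sx Sy mS h]]] := snc _ MS OS dS.
have main x' y' : S x' -> S y' -> 
    maxid S = [set z | exists a b, [/\ S a, S b & z = a * x' + b * y']] ->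
    (forall R, exc R -> S `<=` R -> component_ideal R S = principal S x' \/
             component_ideal R S = principal S y') ->
    cp = principal S x' -> exists y, [/\ S y,
  maxid S = [set z | exists a b, [/\ S a, S b & z = a * X + b * y]] &
  forall R', exc R' -> S `<=` R' -> R' <> R -> component_ideal R' S = principal S y].
  move=> Sx' Sy' mS' h' ex; exists y'; split=> //.
    have exX : principal S X = principal S x' by rewrite -eqnE.
    have [c Sc ec] := principal_sub hSr exX; have [d Sd ed] := principal_sub hSr (esym exX).
    rewrite mS'; apply/seteqP; split=> z -[a [b [Sa Sb ->]]].
      by exists (a * d), b; split=> //; [apply: subringM|rewrite {1}ed mulrA].
    by exists (a * c), b; split=> //; [apply: subringM|rewrite {1}ec mulrA].
  move=> R' hR' SR' nR; case: (h' _ hR' SR') => // e; case: nR.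
  have [_ ->] := exc_localization hR' MS SR'; rewrite loc_component.
  by rewrite -[_ `&` _]/(component_ideal R' S) e ex.
case: (h _ hR SR) => e; first exact: (main x y).
apply: (main y x) => //; last by move=> R' hR' SR'; case: (h _ hR' SR'); [right|left].
by rewrite mS; apply/seteqP; split=> z -[a [b [Sa Sb ->]]]; exists b, a; rewrite addrC.
Qed.

End Local.

(** One function with two uses: it restricts to a uniformizer of the component at the point, and it
    is an equation of any other component passing there. *)
Definition coord R S : F := xget 0 [set y | [/\ S y,
  maxid S = [set z | exists a b, [/\ S a, S b & z = a * eqn S R + b * y]] &
  forall R', exc R' -> S `<=` R' -> R' <> R -> component_ideal R' S = principal S y]].

(** * Orders at a point of an exceptional curve *)

Section CurveOrder.
Variables (R S : set F) (hR : exc R) (hS : points_on M R S).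
Let MS : M S. Proof. by case: hS. Qed.
Let SR : S `<=` R. Proof. by case: hS. Qed.
Let dS : krull_dim S 2. Proof. by case: hS. Qed.
Let hSl := model_local MS.
Let hSr := model_subring MS.
Let hSp := local_maxid_prime hSl.
Let hRr := exc_subring hR.
Let hRp := exc_prime hR.
Let hRi := prime_ideal hRp.
Let hcp := component_prime hR hS.
Local Notation cp := (component_ideal R S).
Local Notation X := (eqn S R).
Local Notation y := (coord R S).

Lemma coordP : [/\ S y,
  maxid S = [set z | exists a b, [/\ S a, S b & z = a * X + b * y]] &
  forall R', exc R' -> S `<=` R' -> R' <> R -> component_ideal R' S = principal S y].
Proof.
exact: (@xgetPex _ 0 [set y | [/\ S y,
  maxid S = [set z | exists a b, [/\ S a, S b & z = a * eqn S R + b * y]] &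
  forall R', exc R' -> S `<=` R' -> R' <> R -> component_ideal R' S = principal S y]]
  (second_coordinate hR hS)).
Qed.

Lemma coord_in : S y. Proof. by case: coordP. Qed.

Lemma maxid_coord z : maxid S z -> exists b s, [/\ cp b, S s & z = b + y * s].
Proof.
have [Sy -> _] := coordP; move=> [a [b [Sa Sb ->]]]; exists (a * X), b; split=> //.
  exact: (primeMl hcp Sa (cp_eqn hR hS)).
by rewrite [b * _]mulrC.
Qed.

Lemma coord_maxid : maxid S y.
Proof.
have [Sy -> _] := coordP; exists 0, 1; rewrite mul0r mul1r add0r.
by split=> //; [apply: subring0|apply: subring1].
Qed.

Lemma coord_ncp : ~ cp y.
Proof.
move=> cy; apply: (component_neq_maxid hR hS); apply/seteqP; split.
  exact: prime_le_maxid.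
move=> z /maxid_coord[b [s [cb Ss ->]]]; apply: (primeD hcp) => //.
exact: (primeMr hcp).
Qed.

Lemma coord_nmaxid : ~ maxid R y.
Proof. by move=> my; apply: coord_ncp; split=> //; apply: coord_in. Qed.

Lemma coord_decomp s : S s -> ~ cp s ->
  exists n u, [/\ S u, ~ maxid S u & cp (s - y ^+ n * u)].
Proof.
apply: dvr_decomposition => //.
- exact: coord_maxid.
- exact: coord_ncp.
- exact: maxid_coord.
- move=> Q hQ; apply: dim2_primes => //.
  exact: component_n0.
Qed.

Lemma unit_nmaxidR u : S u -> ~ maxid S u -> [/\ u != 0, R u^-1 & ~ maxid R u].
Proof.
move=> Su nu; have u0 := maxid_n0 Su nu; have Ru : R u^-1 by apply: SR; apply: maxid_nunit.
by split=> //; apply: unit_nmaxid.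
Qed.

(** Equality of the restrictions to the component, that is, in its function field. *)
Definition cong f g := maxid R (f - g).

Lemma cong_sym f g : cong f g -> cong g f.
Proof. by move=> h; rewrite /cong -opprB; exact: (idealN hRr hRi h). Qed.

Lemma cong_trans g f h : cong f g -> cong g h -> cong f h.
Proof. by move=> h1 h2; rewrite /cong -(subrKA g); apply: (primeD hRp). Qed.

Lemma cong_refl f : cong f f.
Proof. by rewrite /cong subrr; apply: prime0 hRp. Qed.

Lemma congM f f' g g' : R f -> R g' -> cong f f' -> cong g g' -> cong (f * g) (f' * g').
Proof.
move=> Rf Rg' h1 h2; rewrite /cong.
have -> : f * g - f' * g' = f * (g - g') + g' * (f - f') by ring.
by apply: (primeD hRp); apply: (primeMl hRp).
Qed.

Definition runit f := R f /\ ~ maxid R f.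

Lemma runitV f : runit f -> runit f^-1.
Proof.
move=> [Rf nf]; split; first exact: maxid_nunit.
by apply: unit_nmaxid; rewrite ?invrK ?invr_eq0 //; apply: maxid_n0 nf.
Qed.

Lemma runit_n0 f : runit f -> f != 0.
Proof. by case=> Rf; apply: maxid_n0. Qed.

Lemma runitM f g : runit f -> runit g -> runit (f * g).
Proof.
by move=> [Rf nf] [Rg ng]; split; [apply: subringM|apply: (prime_nM hRp)].
Qed.

Lemma runitX f (n : int) : runit f -> runit (f ^ n).
Proof.
have main (m : nat) : runit f -> runit (f ^+ m).
  by move=> [Rf nf]; split; [apply: subringX|apply: (prime_nX hRr hRp)].
case: n => m hf; first exact: main.
by rewrite NegzE -exprnN; apply/runitV/main.
Qed.

Lemma cong_unit f g : R f -> runit g -> cong f g -> runit f.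
Proof.
move=> Rf [Rg ng] h; split=> // mf; apply: ng.
by rewrite -(subKr f g); apply: (idealB hRr hRi).
Qed.

Lemma cong_runit f g : runit g -> cong f g -> runit f.
Proof.
move=> [Rg ng] h; apply: (@cong_unit _ g) => //.
by rewrite -(subrK g f); apply: subringD => //; apply: maxid_sub h.
Qed.

Lemma congV f g : runit f -> runit g -> cong f g -> cong f^-1 g^-1.
Proof.
move=> uf ug h; rewrite /cong.
have -> : f^-1 - g^-1 = (- (f^-1 * g^-1)) * (f - g).
  by field; rewrite (runit_n0 uf) (runit_n0 ug).
apply: (primeMl hRp) => //; apply: subringN => //.
by have [] := runitM (runitV uf) (runitV ug).
Qed.

Lemma congX f g (n : int) : runit f -> runit g -> cong f g -> cong (f ^ n) (g ^ n).
Proof.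
move=> uf ug h; have main (m : nat) : cong (f ^+ m) (g ^+ m).
  elim: m => [|m IH]; first exact: cong_refl.
  rewrite !exprS; apply: congM => //; first by case: uf.
  by have [] := runitX m ug.
case: n => m; first exact: main.
rewrite NegzE -!exprnN; apply: congV; last exact: main.
  exact: runitX m.+1 uf.
exact: runitX m.+1 ug.
Qed.

Lemma coord_runit : runit y.
Proof. by split; [apply: SR; apply: coord_in|apply: coord_nmaxid]. Qed.

Lemma sunit_runit u : S u -> ~ maxid S u -> runit u.
Proof. by move=> Su nu; split; [apply: SR|have [] := unit_nmaxidR Su nu]. Qed.

Lemma sunitX a (n : int) : S a -> ~ maxid S a -> S (a ^ n) /\ ~ maxid S (a ^ n).
Proof.
move=> Sa na; have main (m : nat) : S (a ^+ m) /\ ~ maxid S (a ^+ m).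
  by split; [apply: subringX|apply: (prime_nX hSr hSp)].
case: n => m; first exact: main.
rewrite NegzE -exprnN; have [h1 h2] := main m.+1; split; first exact: maxid_nunit.
by apply: unit_nmaxid; rewrite ?invrK ?invr_eq0 //; apply: maxid_n0 h2.
Qed.

(** Modulo the component ideal t = c y and y = a t, so y (1 - a c) lies in this prime ideal; as [y]
    does not, c is a unit. Hence every order can be computed with the fixed uniformizer [coord]. *)
Lemma uniformizer_coord t : curve_uniformizer R S t ->
  exists a, [/\ S a, ~ maxid S a & cong t (a * y)].
Proof.
case=> St mS; have mt : maxid S t.
  rewrite mS; exists 1, 0; rewrite mul1r addr0; split=> //; first exact: subring1.
  exact: prime0 hcp.
have [d [c [cd Sc et]]] := maxid_coord mt.
have : maxid S y by exact: coord_maxid.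
rewrite {1}mS => -[a [b [Sa cb ey]]]; exists c; split=> //.
  move=> mc; have h : cp (y * (1 - a * c)).
    have -> : y * (1 - a * c) = a * d + b by rewrite mulrBr mulr1 {1}ey et; ring.
    by apply: (primeD hcp) => //; apply: (primeMl hcp).
  have S1 : S (1 - a * c) by apply: subringB; [|apply: subring1|apply: subringM].
  have c1 : cp (1 - a * c).
    apply: contrapT => n1; move: h; apply: (prime_nM hcp) => //; first exact: coord_in.
    exact: coord_ncp.
  apply: (prime1 hSp); have -> : 1 = (1 - a * c) + a * c by ring.
  by apply: (primeD hSp); [apply: prime_le_maxid c1|apply: (primeMl hSp)].
by rewrite /cong et mulrC addrK; case: cd.
Qed.

Lemma curve_ordP f n : curve_ord R S f n <->
  exists u, [/\ S u, ~ maxid S u & cong f (u * y ^ n)].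
Proof.
split=> [[t [u [ut Su u0 Su' h]]]|[u [Su nu h]]].
  have [a [Sa na ta]] := uniformizer_coord ut.
  have ua := sunit_runit Sa na; have uy := coord_runit.
  have nu : ~ maxid S u by apply: unit_nmaxid.
  have utt : runit t by apply: cong_runit ta; apply: runitM.
  have [San nan] := sunitX n Sa na.
  exists (u * a ^ n); split; [exact: subringM|exact: (prime_nM hSp)|].
  apply: (cong_trans h); rewrite -mulrA -exprMz_comm ?fmorph_unit //; last exact: mulrC.
    apply: congM => //; first exact: SR.
    + by have [] := runitX n (runitM ua uy).
    + exact: cong_refl.
    + by apply: congX => //; apply: runitM.
  - by rewrite unitfE; apply: runit_n0.
  - by rewrite unitfE; apply: runit_n0.
exists y, u; split=> //; last exact: maxid_nunit.
  split; first exact: coord_in.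
  apply/seteqP; split=> z.
    by move=> /maxid_coord[b [s [cb Ss ->]]]; exists s, b; rewrite addrC [y * s]mulrC.
  move=> [a [b [Sa cb ->]]]; apply: (primeD hSp).
    by apply: (primeMl hSp) => //; apply: coord_maxid.
  exact: prime_le_maxid cb.
exact: maxid_n0 nu.
Qed.

Lemma curve_ord_runit f n : curve_ord R S f n -> runit f.
Proof.
move=> /curve_ordP[u [Su nu]]; apply: cong_runit.
by apply: runitM; [apply: sunit_runit|apply: runitX; apply: coord_runit].
Qed.

Lemma curve_ord_cong f g n : cong f g -> curve_ord R S g n -> curve_ord R S f n.
Proof.
by move=> fg /curve_ordP[u [Su nu h]]; apply/curve_ordP; exists u; split=> //; apply: cong_trans h.
Qed.

Lemma curve_ord_uniq f n m : curve_ord R S f n -> curve_ord R S f m -> n = m.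
Proof.
wlog nm : n m / n <= m.
  move=> wl hn hm; case: (lerP n m) => [|/ltW] h; first exact: wl.
  by apply/esym; apply: wl.
move=> /curve_ordP[u [Su nu hu]] /curve_ordP[v [Sv nv hv]].
have uy := coord_runit; have y0 := runit_n0 uy.
move: nm; rewrite le_eqVlt => /predU1P[//|lt_nm]; exfalso.
have [k ek] : exists k : nat, m = n + k.+1%:Z.
  exists `|m - n|.-1%N; rewrite prednK; last by rewrite absz_gt0 subr_eq0 gt_eqF.
  by rewrite gtz0_abs ?subr_gt0 // addrCA subrr addr0.
apply: (nu); have h : cong u (v * y ^+ k.+1).
  have h1 : cong (u * y ^ n) (v * y ^ m) := cong_trans (cong_sym hu) hv.
  have -> : u = u * y ^ n * y ^ (- n).
    by rewrite -mulrA -expfzDr // subrr expr0z mulr1.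
  have -> : v * y ^+ k.+1 = v * y ^ m * y ^ (- n).
    by rewrite -mulrA -expfzDr // ek addrAC subrr add0r.
  have un := runitX n uy; have unn := runitX (- n) uy; have uu := sunit_runit Su nu.
  apply: congM => //; [by have [] := runitM uu un|by case: unn|exact: cong_refl].
have {h} : cp (u - v * y ^+ k.+1).
  split=> //; apply: subringB => //; apply: subringM => //; apply: subringX => //.
  exact: coord_in.
move=> /(prime_le_maxid hSl hcp) h.
rewrite -[u](subrK (v * y ^+ k.+1)); apply: (primeD hSp) => //.
rewrite exprSr mulrA; apply: (primeMl hSp); last exact: coord_maxid.
by apply: subringM => //; apply: subringX => //; apply: coord_in.
Qed.

Lemma curve_ordM f g n m : curve_ord R S f n -> curve_ord R S g m ->
  curve_ord R S (f * g) (n + m).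
Proof.
move=> hf hg; have [Rf _] := curve_ord_runit hf.
move: hf hg => /curve_ordP[u [Su nu hu]] /curve_ordP[v [Sv nv hv]].
have uy := coord_runit; have y0 := runit_n0 uy.
apply/curve_ordP; exists (u * v); split; [exact: subringM|exact: (prime_nM hSp)|].
rewrite expfzDr // mulrACA; apply: congM => //.
by have [] := runitM (sunit_runit Sv nv) (runitX m uy).
Qed.

Lemma curve_ordV f n : curve_ord R S f n -> curve_ord R S f^-1 (- n).
Proof.
move=> hf; have uf := curve_ord_runit hf.
move: hf => /curve_ordP[u [Su nu hu]].
have uy := coord_runit; have uu := sunit_runit Su nu.
have [Sui nui] := sunitX (-1) Su nu; rewrite exprN1 in Sui nui.
apply/curve_ordP; exists u^-1; split=> //.
rewrite -invr_expz -invfM; apply: congV => //.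
by apply: runitM => //; apply: runitX.
Qed.

Lemma curve_ord_sunit u : S u -> ~ maxid S u -> curve_ord R S u 0.
Proof. by move=> Su nu; apply/curve_ordP; exists u; rewrite expr0z mulr1; split=> //; exact: cong_refl. Qed.

Lemma curve_ord1 : curve_ord R S 1 0.
Proof. by apply: curve_ord_sunit; [apply: subring1|apply: prime1 hSp]. Qed.

Lemma curve_ord_coord : curve_ord R S y 1.
Proof.
apply/curve_ordP; exists 1; rewrite expr1z mul1r; split; [exact: subring1|exact: prime1 hSp|].
exact: cong_refl.
Qed.

Lemma curve_ordX f n k : curve_ord R S f n -> curve_ord R S (f ^+ k) (n *+ k).
Proof.
move=> hf; elim: k => [|k IH]; first by rewrite expr0 mulr0n; apply: curve_ord1.
by rewrite exprS mulrS; apply: curve_ordM.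
Qed.

Lemma curve_ord_mem s : S s -> ~ maxid R s -> exists n : nat, curve_ord R S s n.
Proof.
move=> Ss ns; have [|n [u [Su nu [h _]]]] := coord_decomp Ss; first by case.
by exists n; apply/curve_ordP; exists u; rewrite mulrC.
Qed.

Lemma curve_ord_ge0 s n : S s -> curve_ord R S s n -> 0 <= n.
Proof.
move=> Ss hs; have [_ ns] := curve_ord_runit hs.
by have [m hm] := curve_ord_mem Ss ns; rewrite (curve_ord_uniq hs hm).
Qed.

Lemma curve_ord0_unit s : S s -> curve_ord R S s 0 -> ~ maxid S s.
Proof.
move=> Ss /curve_ordP[u [Su nu]]; rewrite expr0z mulr1 => h ms; apply: nu.
have /(prime_le_maxid hSl hcp) mc : cp (s - u) by split=> //; apply: subringB.
by rewrite -(subKr s u); apply: (idealB hSr (prime_ideal hSp)).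
Qed.

Lemma curve_ord_gt0 f n : curve_ord R S f n -> 0 < n -> exists2 s, maxid S s & cong f s.
Proof.
move=> /curve_ordP[u [Su nu h]]; case: n h => [[|n]|n] // h _.
exists (u * y ^+ n.+1) => //; rewrite exprSr mulrA; apply: (primeMl hSp).
  by apply: subringM => //; apply: subringX => //; apply: coord_in.
exact: coord_maxid.
Qed.

Lemma curve_ord_ex f : R f -> ~ maxid R f -> exists n, curve_ord R S f n.
Proof.
rewrite {1}(loc_component hR hS) => -[a [b [Sa Sb nb ->]]] nf.
have nb' : ~ maxid R b by move=> mb; apply: nb.
have na : ~ maxid R a.
  move=> ma; apply: nf; rewrite mulrC; apply: (primeMl hRp) => //.
  by apply: maxid_nunit => //; apply: SR.
have [n hn] := curve_ord_mem Sa na; have [m hm] := curve_ord_mem Sb nb'.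
by exists (n%:Z - m%:Z); apply: curve_ordM => //; apply: curve_ordV.
Qed.

(** The residue field at the point is K, so the ratio of leading coefficients is a constant. This is
    why raising the order at a point by one costs at most one dimension. *)
Lemma curve_ord_cancel f g n : curve_ord R S f n -> curve_ord R S g n ->
  exists a, maxid R (f - iota a * g) \/
    exists2 m, n < m & curve_ord R S (f - iota a * g) m.
Proof.
move=> /curve_ordP[u [Su nu hu]] /curve_ordP[v [Sv nv hv]].
have Sv' := maxid_nunit Sv nv; have v0 := maxid_n0 Sv nv.
have [a ma] := residue_constant surface_affine surface_no_chain hSl
  (model_subalgebra MS) dS (subringM hSr Su Sv').
exists a; pose w := u - iota a * v.
have Sia : S (iota a) by apply: model_base.
have mw : maxid S w.
  have -> : w = v * (u / v - iota a) by rewrite /w; field.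
  exact: (primeMl hSp).
have uyn := runitX n coord_runit.
have hw : cong (f - iota a * g) (w * y ^ n).
  rewrite /cong; have -> : f - iota a * g - w * y ^ n =
    (f - u * y ^ n) - iota a * (g - v * y ^ n) by rewrite /w; ring.
  by apply: (idealB hRr hRi) => //; apply: (primeMl hRp) => //; apply: SR.
case: (pselect (maxid R w)) => mRw.
  left; rewrite -[_ - _](subrK (w * y ^ n)); apply: (primeD hRp) => //.
  by apply: (primeMr hRp) => //; case: uyn.
right; have [k hk] := curve_ord_mem (maxid_sub mw) mRw.
exists (k%:Z + n).
  rewrite ltrDr ltz_nat lt0n; apply/negP => /eqP k0; rewrite k0 in hk.
  exact: (curve_ord0_unit (maxid_sub mw) hk).
apply: (curve_ord_cong hw); apply: curve_ordM => //.
apply/curve_ordP; exists 1; rewrite mul1r; split; [exact: subring1|exact: prime1 hSp|].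
exact: cong_refl.
Qed.

End CurveOrder.

(** * Divisors of functions on a component *)

Lemma ideal_horner_sub (T I : set F) (p : {poly F}) a b : subring T -> ideal_of T I ->
  coefs_in T p -> T a -> T b -> I (a - b) -> I (p.[a] - p.[b]).
Proof.
move=> hT [_ I0 ID IM] + Ta Tb Iab; elim/poly_ind: p => [|p c IH] hp.
  by rewrite !horner0 subrr.
have hp' : coefs_in T p.
  by move=> i; have := hp i.+1; rewrite coefD coefMX coefC /= addr0.
have -> : (p * 'X + c%:P).[a] - (p * 'X + c%:P).[b] =
    a * (p.[a] - p.[b]) + p.[b] * (a - b).
  by rewrite !(hornerD, hornerM, hornerC, hornerX); ring.
by apply: ID; apply: IM => //; [apply: IH|apply: subring_horner].
Qed.

(** The finite set of candidate coordinate vectors of a point whose coordinates have finitely many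
    possible values each. *)
Fixpoint choices (T : eqType) (ls : seq (seq T)) : seq (seq T) :=
  if ls is l :: ls' then [seq a :: w | a <- l, w <- choices ls'] else [:: [::]].

Lemma mem_choices (I T : eqType) (xs : seq I) (r : I -> seq T) (v : I -> T) :
  (forall x : I, x \in xs -> v x \in r x) -> map v xs \in choices (map r xs).
Proof.
elim: xs => [|x xs IH] h //=; apply: allpairs_f.
  by apply: h; rewrite inE eqxx.
by apply: IH => x' hx'; apply: h; rewrite inE hx' orbT.
Qed.

Section Zeros.
Variables (R : set F) (hR : exc R).
Let hRr := exc_subring hR.
Let hRp := exc_prime hR.

Definition zeros_of h : set (set F) :=
  [set S | points_on M R S /\ exists2 s, maxid S s & maxid R (h - s)].

Lemma points_component_in S z : points_on M R S -> S z -> maxid R z -> maxid S z.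
Proof.
move=> hS Sz mz; apply: (prime_le_maxid (model_local _) (component_prime hR hS)).
  by case: hS.
by split.
Qed.

Lemma constant_zeros h a : ~ maxid R h -> maxid R (h - iota a) ->
  zeros_of h = set0.
Proof.
move=> nh ma; apply/seteqP; split=> // S [hS [s ms hs]].
have MS : M S by case: hS.
have Sa : S (iota a) := model_base MS a.
have hSp := local_maxid_prime (model_local MS).
have msa : maxid S (s - iota a).
  apply: points_component_in => //.
    by apply: subringB => //; [exact: model_subring|exact: maxid_sub ms].
  have -> : s - iota a = (h - iota a) - (h - s) by ring.
  exact: (idealB hRr (prime_ideal hRp)).
have : maxid S (iota a).
  rewrite -(subKr s (iota a)).
  exact: (idealB (model_subring MS) (prime_ideal hSp)).
apply: unit_nmaxid; first by rewrite -fmorphV; apply: model_base.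
rewrite fmorph_eq0; apply/eqP => a0; apply: nh.
by move: ma; rewrite a0 rmorph0 subr0.
Qed.

(** A relation between [h] and [x] on the component, not divisible by [h], leaves at a zero of [h] a
    nonzero polynomial equation in [x] alone. *)
Lemma alg_zeros h x : R h -> R x -> ~ maxid R h ->
  alg_mod R (adj (base_field iota) h) x ->
  exists q : {poly F}, [/\ coefs_in (base_field iota) q, q != 0 &
    forall S, zeros_of h S -> S x -> maxid S q.[x]].
Proof.
move=> Rh Rx nh [Q [hQ Q0 mQ]]; have hk0 := base_subfield iota; have [hk0r _] := hk0.
have [P [e [he e0 hP eP]]] := clear_denominators hk0 hQ.
have k0R : base_field iota `<=` R by apply: base_sub; apply/model_subalgebra/exc_M.
have P0 : swapXY P != 0.
  rewrite swapXY_eq0; apply: contraNneq Q0 => P0; apply/eqP/polyP => i.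
  by apply: (mulfI e0); rewrite -eP P0 !coef0 horner0 mulr0.
have hsw i : coefs_in (base_field iota) (swapXY P)`_i.
  by move=> j; rewrite coef_swapXY; apply: hP.
have : maxid R (swapXY P).[h%:P].[x].
  rewrite horner2_swapXY -horner_map_horner.
  have -> : map_poly (horner^~ h) P = e.[h] *: Q.
    by apply/polyP => i; rewrite coef_map_id0 ?horner0 // coefZ.
  rewrite hornerZ; apply: (primeMl hRp) => //; apply: subring_horner => // i.
  exact: k0R.
(* After the swap the relation is a polynomial in [h] with coefficients in K[x]. Factors [h] are
   cancelled until the coefficient free of [h] is nonzero. *)
elim/poly_ind: (swapXY P) P0 hsw => [|W q IH]; first by rewrite eqxx.
move=> W0 hW.
have hW' i : coefs_in (base_field iota) W`_i.
  by have := hW i.+1; rewrite coefD coefMX coefC /= addr0.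
have hq : coefs_in (base_field iota) q.
  by have := hW 0%N; rewrite coefD coefMX coefC /= add0r.
have mapR (k : set F) i : base_field iota `<=` k -> subring k -> k x ->
    k (map_poly (horner^~ x) W)`_i.
  move=> k0k hk kx; rewrite coef_map_id0 ?horner0 //; apply: subring_horner => // j.
  exact/k0k/hW'.
have WR : R W.[h%:P].[x].
  by rewrite -horner_map_horner; apply: subring_horner => // i; apply: mapR.
rewrite !(hornerD, hornerM, hornerX, hornerC).
case: (eqVneq q 0) W0 => [->|q0] W0.
  rewrite horner0 addr0 => mWh; apply: IH => //.
    by apply: contraNneq W0 => ->; rewrite mul0r add0r.
  apply: contrapT => nW; exact: (prime_nM hRp WR Rh nW nh).
move=> mW; exists q; split=> // S [hS [s ms hs]] Sx.
have MS : M S by case: hS.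
have SR : S `<=` R by case: hS.
have hSr := model_subring MS; have hSp := local_maxid_prime (model_local MS).
have k0S : base_field iota `<=` S by apply: base_sub; apply: model_subalgebra.
have Ss := maxid_sub ms.
have Sq : S q.[x] by apply: subring_horner => // i; apply: k0S.
have SW : S W.[s%:P].[x].
  by rewrite -horner_map_horner; apply: subring_horner => // i; apply: mapR.
have h1 : maxid R (W.[h%:P].[x] - W.[s%:P].[x]).
  rewrite -!horner_map_horner; apply: (ideal_horner_sub hRr (prime_ideal hRp)) => //.
    by move=> i; apply: mapR.
  exact: SR.
have h2 : maxid S (W.[s%:P].[x] * s + q.[x]).
  apply: points_component_in => //; first by apply: subringD => //; apply: subringM.
  have -> : W.[s%:P].[x] * s + q.[x] = (W.[h%:P].[x] * h + q.[x])
     - (W.[s%:P].[x] * (h - s) + h * (W.[h%:P].[x] - W.[s%:P].[x])) by ring.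
  apply: (idealB hRr (prime_ideal hRp)) => //; apply: (primeD hRp); apply: (primeMl hRp) => //.
  exact: SR.
have -> : q.[x] = (W.[s%:P].[x] * s + q.[x]) - W.[s%:P].[x] * s by ring.
by apply: (idealB hSr (prime_ideal hSp)) => //; apply: (primeMl hSp).
Qed.

(** A constant restriction has no zeros. Otherwise every function on the curve is algebraic over
    K(h), so on each chart the generators take finitely many values at the zeros of [h], and these
    values determine the point. *)
Lemma zeros_finite h : R h -> ~ maxid R h -> finite_set (zeros_of h).
Proof.
move=> Rh nh; have hk0 := base_subfield iota.
have k0R : base_field iota `<=` R by apply: base_sub; apply/model_subalgebra/exc_M.
case: (pselect (exists2 p : {poly F}, coefs_in (base_field iota) p /\ p != 0 & maxid R p.[h])).
  move=> [p [hp p0] mp]; have [r hr] := root_residue hp p0.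
  have [a _ ma] := hr R h (exc_local hR) (model_subalgebra (exc_M hR)) Rh mp.
  by rewrite (constant_zeros nh ma); apply: finite_set0.
move=> ntr; have trh (p : {poly F}) : coefs_in (base_field iota) p -> p != 0 -> ~ maxid R p.[h].
  by move=> hp p0 mp; apply: ntr; exists p.
have alg x : R x -> alg_mod R (adj (base_field iota) h) x.
  move=> Rx; apply: (residue_algebraic surface_affine surface_no_chain (w := unif R)) => //.
  - exact: exc_local.
  - exact/model_subalgebra/exc_M.
  - exact: maxid_unif.
  - exact: unif_n0.
have roots x : exists r : seq K, R x -> forall S, zeros_of h S -> S x ->
    exists2 a, a \in r & maxid S (x - iota a).
  case: (pselect (R x)) => Rx; last by exists [::].
  have [q [hq q0 hz]] := alg_zeros Rh Rx nh (alg _ Rx).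
  have [r hr] := root_residue hq q0; exists r => _ S zS Sx.
  have MS : M S by case: zS => -[].
  exact: hr (model_local MS) (model_subalgebra MS) Sx (hz _ zS Sx).
pose rt x := sval (cid (roots x)); have rtP x := svalP (cid (roots x)).
case: hM => -[[[s hs eM] _] _ _ _ _] _.
pose ZT T := [set S | zeros_of h S /\ exists2 q, prime_of T q & S = localization T q].
apply: (@sub_finite_set _ _ (\bigcup_(T in [set` s]) ZT T)).
  move=> S zS; have : M S by case: zS => -[].
  by rewrite eM => -[T Ts hT]; exists T.
apply: bigcup_finite; first exact: finite_seq.
move=> T /= Ts; have [[hT TK] [xs hxs] _] := hs _ Ts.
pose val S x := xget 0 [set a | maxid S (x - iota a)].
have valP S x : zeros_of h S -> S x -> R x ->
    maxid S (x - iota (val S x)) /\ val S x \in rt x.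
  move=> zS Sx Rx; have [a ar ma] := rtP x Rx S zS Sx.
  have MS : M S by case: zS => -[].
  have mv : maxid S (x - iota (val S x)).
    exact: (@xgetPex _ 0 [set a | maxid S (x - iota a)] (ex_intro _ a ma)).
  split=> //; suff -> : val S x = a by [].
  apply/eqP; rewrite -subr_eq0; apply: contrapT => /negP na.
  have : maxid S (iota (val S x - a)).
    have -> : iota (val S x - a) = (x - iota a) - (x - iota (val S x)).
      by rewrite rmorphB; ring.
    by apply: (idealB (model_subring MS)) => //; apply/prime_ideal/local_maxid_prime/model_local.
  by apply: unit_nmaxid; rewrite ?fmorph_eq0 // -fmorphV; apply: model_base.
pose v S := map (val S) xs.
have TS S : ZT T S -> T `<=` S /\ T `<=` R.
  move=> [[hS _] [q hq eS]].
  have TS : T `<=` S by rewrite eS; apply: loc_sub.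
  by split=> // z /TS; case: hS => _ SR _; apply: SR.
have xT x : x \in xs -> T x by move=> hx; apply/hxs => T' _; apply.
have vinj S S' : ZT T S -> ZT T S' -> v S = v S' -> S = S'.
  move=> ZS ZS' ev; have [TS1 TR] := TS _ ZS; have [TS2 _] := TS _ ZS'.
  case: (ZS) => zS [q hq eS]; case: (ZS') => zS' [q' hq' eS'].
  have MS : M S by case: zS => -[].
  have MS' : M S' by case: zS' => -[].
  have mS := local_maxid_prime (model_local MS).
  have mS' := local_maxid_prime (model_local MS').
  have iS := prime_ideal mS; have iS' := prime_ideal mS'.
  have hSr := model_subring MS; have hSr' := model_subring MS'.
  (* The functions on the chart with equal values at the two points form a subalgebra; it contains
     the generators, hence is all of [T], and the two primes of [T] agree. *)
  pose D := [set t | T t /\ exists a, maxid S (t - iota a) /\ maxid S' (t - iota a)].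
  have hD : subalgebra iota D.
    split; last first.
      move=> c; split=> //; exists c; rewrite subrr; split; [exact: prime0 mS|exact: prime0 mS'].
    split; first split.
    - exact: subring1.
    - exists 1; rewrite rmorph1 subrr; split; [exact: prime0 mS|exact: prime0 mS'].
    - move=> t t' [Tt [a [ma ma']]] [Tt' [b [mb mb']]]; split; split.
      + exact: subringB.
      + exists (a - b); rewrite rmorphB.
        have -> : t - t' - (iota a - iota b) = (t - iota a) - (t' - iota b) by ring.
        by split; [apply: (idealB hSr iS)|apply: (idealB hSr' iS')].
      + exact: subringM.
      + exists (a * b); rewrite rmorphM.
        have -> : t * t' - iota a * iota b = t * (t' - iota b) + iota b * (t - iota a) by ring.
        split; [apply: (primeD mS); apply: (primeMl mS) => //|apply: (primeD mS'); apply: (primeMl mS') => //].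
        * exact: TS1.
        * exact: model_base.
        * exact: TS2.
        * exact: model_base.
  have TD : T `<=` D.
    move=> t /hxs; apply=> // x hx; have Tx := xT _ hx.
    split=> //; exists (val S x); split; first by have [] := valP S x zS (TS1 _ Tx) (TR _ Tx).
    have -> : val S x = val S' x.
      have := congr1 (fun w => nth 0 w (index x xs)) ev.
      by rewrite !(nth_map 0) ?index_mem // !nth_index.
    by have [] := valP S' x zS' (TS2 _ Tx) (TR _ Tx).
  have key S1 S2 : M S1 -> M S2 -> T `<=` S1 ->
      (forall t, T t -> exists a, maxid S1 (t - iota a) /\ maxid S2 (t - iota a)) ->
      maxid S1 `&` T `<=` maxid S2 `&` T.
    move=> M1 M2 TS' hh t [mt Tt]; split=> //; have [a [ma1 ma2]] := hh _ Tt.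
    suff a0 : a = 0 by move: ma2; rewrite a0 rmorph0 subr0.
    apply/eqP; apply: contrapT => /negP na.
    have : maxid S1 (iota a).
      rewrite -(subKr t (iota a)); apply: (idealB (model_subring M1)) => //.
      exact/prime_ideal/local_maxid_prime/model_local.
    by apply: unit_nmaxid; rewrite ?fmorph_eq0 // -fmorphV; apply: model_base.
  have eq : q = q'.
    rewrite -(maxid_loc_contract hT hq) -(maxid_loc_contract hT hq') -eS -eS'.
    apply/seteqP; split; apply: key => // t /TD[_ [a [h1 h2]]]; by exists a.
  by rewrite eS eS' eq.
pose g w := xget set0 [set S | ZT T S /\ v S = w].
apply: (@sub_finite_set _ _ (g @` [set` choices (map rt xs)])).
  move=> S ZS; have [TS1 TR] := TS _ ZS; exists (v S) => /=.
    apply: mem_choices => x hx; have Tx := xT _ hx.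
    by case: ZS => zS _; have [] := valP S x zS (TS1 _ Tx) (TR _ Tx).
  have [ZS' ev] := @xgetPex _ set0 [set S' | ZT T S' /\ v S' = v S] (ex_intro _ S (conj ZS erefl)).
  exact: vinj.
by apply: finite_image; apply: finite_seq.
Qed.

Definition ordc S h : int := xget 0 [set n | curve_ord R S h n].

Lemma ordcP S h : points_on M R S -> R h -> ~ maxid R h -> curve_ord R S h (ordc S h).
Proof.
move=> hS Rh nh.
exact: (@xgetPex _ 0 [set n | curve_ord R S h n] (curve_ord_ex hR hS Rh nh)).
Qed.

Lemma ordcE S h n : points_on M R S -> curve_ord R S h n -> ordc S h = n.
Proof.
move=> hS hn; have [Rh nh] := curve_ord_runit hR hS hn.
exact: curve_ord_uniq (ordcP hS Rh nh) hn.
Qed.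

Lemma ordc_divisor h : R h -> ~ maxid R h -> divisor_on M R (ordc^~ h).
Proof.
move=> Rh nh; have [Rh' nh'] := runitV (conj Rh nh).
apply: (@sub_finite_set _ _ (zeros_of h `|` zeros_of h^-1)); last first.
  by rewrite finite_setU; split; apply: zeros_finite.
move=> S [hS /= /eqP]; have := ordcP hS Rh nh.
move: (ordc S h) => n hn n0; case: (ltgtP n 0) => [ln|ln|//].
  right; split=> //.
  have [|s ms hs] := curve_ord_gt0 hR hS (curve_ordV hR hS hn); first by rewrite oppr_gt0.
  by exists s.
by left; split=> //; have [s ms hs] := curve_ord_gt0 hR hS hn ln; exists s.
Qed.

End Zeros.

Lemma fsumD (T : choiceType) (P : set T) (a b : T -> int) :
  finite_set (P `&` [set x | a x != 0]) -> finite_set (P `&` [set x | b x != 0]) ->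
  \sum_(x \in P) (a x + b x) = \sum_(x \in P) a x + \sum_(x \in P) b x.
Proof.
move=> fa fb; set Pa := P `&` _ in fa; set Pb := P `&` _ in fb.
have fX : finite_set (Pa `|` Pb) by rewrite finite_setU.
have XP : Pa `|` Pb `<=` P by move=> x [[]|[]].
have out (x : T) : (P `\` (Pa `|` Pb)) x -> a x = 0 /\ b x = 0.
  move=> [Px /not_orP[n1 n2]]; split; apply/eqP; apply: contrapT => /negP h.
    by apply: n1.
  by apply: n2.
have wid (f : T -> int) : (forall x : T, (P `\` (Pa `|` Pb)) x -> f x = 0) ->
    \sum_(x \in P) f x = \sum_(x \in Pa `|` Pb) f x.
  by move=> hf; apply/esym/fsbig_widen.
rewrite !wid; first exact: fsbig_split.
- by move=> x /out[].
- by move=> x /out[].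
- by move=> x /out[-> ->].
Qed.

Section Degree.
Variables (R : set F) (hR : exc R).
Let hRr := exc_subring hR.
Let hRp := exc_prime hR.
Implicit Types D : set F -> int.

Lemma divisor_onD D D' : divisor_on M R D -> divisor_on M R D' ->
  divisor_on M R (fun S => D S + D' S).
Proof.
move=> h1 h2; apply: (@sub_finite_set _ _ ((points_on M R `&` [set S | D S != 0]) `|`
  (points_on M R `&` [set S | D' S != 0]))); last by rewrite finite_setU.
move=> S [hS /= n0]; case: (eqVneq (D S) 0) => e; last by left.
by right; split=> //=; apply: contraNneq n0 => e'; rewrite e e' addr0.
Qed.

Lemma divisor_onZ D (c : int) : divisor_on M R D -> divisor_on M R (fun S => c * D S).
Proof.
apply: sub_finite_set => S [hS /= n0]; split=> //=.
by apply: contraNneq n0 => ->; rewrite mulr0.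
Qed.

Lemma divisor_degreeD D D' : divisor_on M R D -> divisor_on M R D' ->
  divisor_degree M R (fun S => D S + D' S) = divisor_degree M R D + divisor_degree M R D'.
Proof. exact: fsumD. Qed.

Lemma divisor_degreeZ D (c : int) :
  divisor_degree M R (fun S => c * D S) = c * divisor_degree M R D.
Proof. by rewrite /divisor_degree mulr_fsumr. Qed.

Lemma rr_shift h D l : R h -> ~ maxid R h ->
  quotient_dim iota (rr_space M R D) (maxid R) l ->
  quotient_dim iota (rr_space M R (fun S => D S + ordc R S h)) (maxid R) l.
Proof.
move=> Rh nh; have uh : runit R h by [].
have [Rh' nh'] := runitV uh; have h0 := runit_n0 uh.
have sp f : rr_space M R (fun S => D S + ordc R S h) f <-> rr_space M R D (f * h).
  split=> -[Rf hf].
    split; first exact: subringM.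
    case: hf => [mf|hf]; first by left; apply: (primeMr hRp).
    right=> S hS; have [n hn le] := hf S hS; have hh := ordcP hR hS Rh nh.
    exists (n + ordc R S h); first exact: curve_ordM.
    by rewrite -lerBlDr -opprD.
  have Rf' : R f by rewrite -(mulfK h0 f); apply: subringM.
  split=> //; case: hf => [mf|hf].
    left; apply: contrapT => nf; exact: (prime_nM hRp Rf' Rh nf nh).
  right=> S hS; have [n hn le] := hf S hS; have hh := ordcP hR hS Rh nh.
  exists (n - ordc R S h).
    rewrite -(mulfK h0 f); apply: curve_ordM => //; exact: curve_ordV.
  by rewrite opprD lerD2r.
case=> b hb hw; exists (fun i => b i / h).
  by move=> i; apply/sp; rewrite divfK.
have iff (w : F) (c : 'rV[K]_l) : maxid R (w * h - \sum_i iota (c 0 i) * b i) <->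
    maxid R (w - \sum_i iota (c 0 i) * (b i / h)).
  have e : w - \sum_i iota (c 0 i) * (b i / h) = (w * h - \sum_i iota (c 0 i) * b i) / h.
    rewrite mulrBl mulfK // mulr_suml; congr (_ - _).
    by apply: eq_bigr => i _; rewrite mulrA.
  split=> hm; first by rewrite e; apply: (primeMr hRp).
  by rewrite -[_ - _](divfK h0) -e; apply: (primeMr hRp).
move=> w /sp /hw[c [hc uc]]; exists c; split; first exact/iff.
by move=> c' /iff; apply: uc.
Qed.

(* Multiplication by h identifies L(D + n div h) with L(D) for all integers n, so
   that the genus bounds n deg(div h) from above. *)
Lemma degree_ordc (g : nat) h : curve_genus iota M R g -> R h -> ~ maxid R h ->
  divisor_degree M R (ordc R ^~ h) = 0.
Proof.
move=> [bound [D [l [hD hl _]]]].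
suff main f : R f -> ~ maxid R f -> divisor_degree M R (ordc R ^~ f) <= 0.
  move=> Rh nh; apply/eqP; rewrite eq_le main //=.
  have uh : runit R h by []; have [Rh' nh'] := runitV uh.
  have := main _ Rh' nh'.
  have -> : divisor_degree M R (ordc R ^~ h^-1) = - divisor_degree M R (ordc R ^~ h).
    rewrite -mulN1r -divisor_degreeZ; apply: eq_fsbigr => S; rewrite inE => hS.
    by apply: ordcE => //; rewrite mulN1r; apply: curve_ordV => //; apply: ordcP.
  by rewrite oppr_le0.
move=> Rf nf; have hf := ordc_divisor hR Rf nf.
set d := divisor_degree _ _ _.
have hDk : forall k : nat, divisor_on M R (fun S => D S + k%:Z * ordc R S f) /\
    quotient_dim iota (rr_space M R (fun S => D S + k%:Z * ordc R S f)) (maxid R) l.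
  move=> k; split; first by apply: divisor_onD => //; apply: divisor_onZ.
  elim: k => [|k IH].
    by have -> : (fun S => D S + 0%:Z * ordc R S f) = D by apply/funext => S; rewrite mul0r addr0.
  have := rr_shift Rf nf IH.
  congr (quotient_dim _ (rr_space _ _ _) _ _); apply/funext => S.
  by rewrite -addrA intS mulrDl mul1r [ordc R S f + _]addrC.
rewrite leNgt; apply/negP => d0.
(* The genus bound reads k d <= c, and it fails for this [k] as soon as d >= 1. *)
pose c : int := g%:Z - divisor_degree M R D - 1 + l%:Z; pose k := `|c|%N.+1.
have [hDk1 hlk] := hDk k.
have := bound _ _ hDk1 hlk; rewrite divisor_degreeD //; last exact: divisor_onZ.
rewrite divisor_degreeZ -/d => h1.
have h2 : k%:Z <= k%:Z * d by rewrite ler_peMr // -gtz0_ge1.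
have h3 : c < k%:Z by rewrite /k; lia.
move: h3; rewrite /c; lia.
Qed.

End Degree.

(** * Local equations of cycles and intersection numbers *)

Variables (G : weighted_graph) (E : G -> set F) (hE : is_dual_graph iota A mO M E).
Implicit Types (i j u v w : G) (W Z : G -> nat).

Lemma excE v : exc (E v).
Proof. by case: hE => -[h _ _] _ _ _; apply: h. Qed.

Lemma E_inj u v : E u = E v -> u = v.
Proof. by case: hE => -[_ h _] _ _ _ e; apply: h; rewrite ?inE. Qed.

Definition comp_eqn S v : F := if pselect (S `<=` E v) then eqn S (E v) else 1.

(** A generator of O(-W) at the point; components not through the point contribute the unit 1. *)
Definition cycle_eqn S W : F := \prod_v comp_eqn S v ^+ W v.

Lemma comp_eqn_in S v : S `<=` E v -> comp_eqn S v = eqn S (E v).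
Proof. by rewrite /comp_eqn; case: pselect. Qed.

Lemma comp_eqn_out S v : ~ S `<=` E v -> comp_eqn S v = 1.
Proof. by rewrite /comp_eqn; case: pselect. Qed.

Lemma closed_points S v : closed_pt S -> S `<=` E v -> points_on M (E v) S.
Proof. by case=> MS _ dS SE; split. Qed.

Lemma comp_eqn_S S v : closed_pt S -> S (comp_eqn S v).
Proof.
move=> cS; case: (pselect (S `<=` E v)) => h.
  by rewrite comp_eqn_in //; apply: eqn_in (closed_points cS h); apply: excE.
by rewrite comp_eqn_out //; apply: subring1; apply: model_subring; case: cS.
Qed.

Lemma comp_eqn_n0 S v : closed_pt S -> comp_eqn S v != 0.
Proof.
move=> cS; case: (pselect (S `<=` E v)) => h.
  by rewrite comp_eqn_in //; apply: eqn_n0 (closed_points cS h); apply: excE.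
by rewrite comp_eqn_out // oner_eq0.
Qed.

Lemma cycle_eqn_n0 S W : closed_pt S -> cycle_eqn S W != 0.
Proof. by move=> cS; apply/prodf_neq0 => v _; rewrite expf_neq0 // comp_eqn_n0. Qed.

Lemma cycle_eqn_S S W : closed_pt S -> S (cycle_eqn S W).
Proof.
move=> cS; have hS : subring S by apply: model_subring; case: cS.
by apply: subring_prod => // v _; apply: subringX => //; apply: comp_eqn_S.
Qed.

Lemma eqn_coord R R' S : exc R -> exc R' -> points_on M R S -> S `<=` R' -> R' <> R ->
  exists2 a, S a /\ ~ maxid S a & eqn S R' = a * coord R S.
Proof.
move=> hR hR' hS SR' ne; have MS : M S by case: hS.
have hS' : points_on M R' S by case: hS => ? ? ?; split.
have hSr := model_subring MS.
have [Sy _ /(_ _ hR' SR' ne) e] := coordP hR hS.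
have e' : principal S (eqn S R') = principal S (coord R S) by rewrite -eqnE.
have [a Sa ea] := principal_sub hSr e'; have [b Sb eb] := principal_sub hSr (esym e').
exists a => //; split=> //; apply: unit_nmaxid.
  have y0 : coord R S != 0.
    apply/eqP => y0; apply: (coord_ncp hR hS); rewrite y0.
    exact: prime0 (component_prime hR hS).
  have ba : b * a = 1 by apply: (mulIf y0); rewrite mul1r -mulrA -ea -eb.
  have a0 : a != 0 by apply/eqP => a0; move/eqP: ba; rewrite a0 mulr0 eq_sym oner_eq0.
  by have -> : a^-1 = b by rewrite -[LHS]mul1r -ba mulfK.
by apply: contraTneq (eqn_n0 hR' hS') => a0; rewrite ea a0 mul0r eqxx.
Qed.

Lemma comp_eqn_other S u v : closed_pt S -> S `<=` E v -> u != v -> ~ maxid (E v) (comp_eqn S u).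
Proof.
move=> cS Sv uv; have hS := closed_points cS Sv.
case: (pselect (S `<=` E u)) => Su; last first.
  rewrite comp_eqn_out //; exact: prime1 (exc_prime (excE v)).
rewrite comp_eqn_in //.
have [|a [Sa na] ->] := eqn_coord (excE v) (excE u) hS Su.
  by move/E_inj/eqP; rewrite (negPf uv).
apply: (prime_nM (exc_prime (excE v))).
- exact: Sv.
- exact/Sv/(coord_in (excE v) hS).
- by have [_ _] := unit_nmaxidR hS Sa na.
- exact: coord_nmaxid (excE v) hS.
Qed.

(** The components are divided out one at a time. The equation of one is a unit in the local ring of
    every other component through the point, so the remaining orders do not change. *)
Lemma div_cycle_eqn S W h : closed_pt S -> S h ->
  (forall v, S `<=` E v -> vge (E v) (W v) h) -> S (h / cycle_eqn S W).
Proof.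
move=> cS Sh hv; rewrite /cycle_eqn.
suff : S (h / \prod_(v <- enum G) comp_eqn S v ^+ W v) /\
   (forall v, v \notin enum G -> S `<=` E v -> vge (E v) (W v) (h / \prod_(v <- enum G) comp_eqn S v ^+ W v)).
  by case=> + _; rewrite big_enum.
elim: (enum G) (enum_uniq G) => [|j s IH] /=.
  by rewrite big_nil divr1; split=> // v _; apply: hv.
move=> /andP[js /IH[Sq hq]]; rewrite big_cons invfM mulrCA mulrC.
set q := h / _ in Sq hq *.
case: (pselect (S `<=` E j)) => Sj; last first.
  rewrite comp_eqn_out // expr1n divr1; split=> // v; rewrite inE negb_or => /andP[_]; exact: hq.
split; first by rewrite comp_eqn_in //; apply: (div_eqn (excE j) (closed_points cS Sj)) => //; apply: hq.
move=> v; rewrite inE negb_or => /andP[vj vs] Sv.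
have ne : comp_eqn S j ^+ W j != 0 by rewrite expf_neq0 // comp_eqn_n0.
apply: (vge_unit (excE v) (u := comp_eqn S j ^+ W j)) => //; last by rewrite divfK //; apply: hq.
rewrite -exprVn; apply: subringX; first exact: exc_subring (excE v).
by apply: maxid_nunit; [apply: Sv; apply: comp_eqn_S|apply: comp_eqn_other; rewrite // eq_sym].
Qed.

Lemma vge_cycle_eqn S W v : closed_pt S -> S `<=` E v -> vge (E v) (W v) (cycle_eqn S W).
Proof.
move=> cS Sv; have hS := closed_points cS Sv; apply/(vge_eqn (excE v) hS).
rewrite /cycle_eqn (bigD1 v) //= comp_eqn_in // mulrAC divff ?mul1r ?expf_neq0 ?(eqn_n0 (excE v) hS) //.
have hr := exc_subring (excE v).
by apply: subring_prod => // j _; apply: subringX => //; apply: Sv; apply: comp_eqn_S.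
Qed.

Lemma div_cycle_eqn_nmaxid S W v h : closed_pt S -> S `<=` E v -> ~ vge (E v) (W v).+1 h ->
  ~ maxid (E v) (h / cycle_eqn S W).
Proof.
move=> cS Sv nh /(vge1 (excE v)) mq; apply: nh.
rewrite -(divfK (cycle_eqn_n0 W cS) h) -add1n; apply: (vgeM (excE v)) => //.
exact: vge_cycle_eqn.
Qed.

Lemma fsum_card (T : choiceType) (X : set T) n : (X #= `I_n)%card ->
  \sum_(x \in X) (1 : int) = n%:Z.
Proof.
move=> hX'; have fX : finite_set X by apply/finite_setP; exists n.
rewrite fsbig_finite //= big_const_seq count_predT.
rewrite (_ : size _ = n); last by rewrite -(card_fset_set hX').
by rewrite iter_addr addr0 natz.
Qed.

Definition inter v j : int := if v == j then selfint v else (edges v j)%:Z.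

Definition wdot W v : int := \sum_j (W j)%:Z * inter v j.

Definition incident S j : int := if pselect (S `<=` E j) then 1 else 0.

Lemma incident_divisor v j : v != j -> divisor_on M (E v) (incident ^~ j) /\
  divisor_degree M (E v) (incident ^~ j) = (edges v j)%:Z.
Proof.
move=> vj; have [_ _ _ /(_ v j vj) hc] := hE.
have fin : finite_set (points_on M (E v) `&` points_on M (E j)) by apply/finite_setP; exists (edges v j).
split.
  apply: sub_finite_set fin => S [hS /=]; rewrite /incident; case: pselect => //= Sj _.
  by split=> //; case: hS.
rewrite -(fsum_card hc) /divisor_degree.
rewrite -[LHS](fsbig_widen (points_on M (E v) `&` points_on M (E j))).
- by apply: eq_fsbigr => S; rewrite inE => -[_ [_ Sj _]]; rewrite /incident; case: pselect.
- by move=> S [].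
- move=> S [hS /not_andP[//|local_colength]] /=; rewrite /incident; case: pselect => // Sj; case: local_colength.
  by case: hS => ? ? ?; split.
Qed.

Lemma divisor_sum v (I : Type) (r : seq I) (P : pred I) (D : I -> set F -> int) :
  (forall i : I, P i -> divisor_on M (E v) (D i)) ->
  divisor_on M (E v) (fun S => \sum_(i <- r | P i) D i S) /\
  divisor_degree M (E v) (fun S => \sum_(i <- r | P i) D i S) =
    \sum_(i <- r | P i) divisor_degree M (E v) (D i).
Proof.
move=> hD; have zero : divisor_on M (E v) (fun=> 0) /\ divisor_degree M (E v) (fun=> 0) = 0.
  split; first by apply: sub_finite_set (finite_set0 _) => S [_ /eqP h]; case: h.
  exact: fsbig1.
elim: r => [|i r [IH1 IH2]].
  have -> : (fun S => \sum_(i <- [::] | P i) D i S) = fun=> 0 by apply/funext => S; rewrite big_nil.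
  by rewrite big_nil.
case: (boolP (P i)) => Pi; last first.
  have -> : (fun S => \sum_(j <- i :: r | P j) D j S) = (fun S => \sum_(j <- r | P j) D j S).
    by apply/funext => S; rewrite big_cons (negPf Pi).
  by rewrite big_cons (negPf Pi).
have -> : (fun S => \sum_(j <- i :: r | P j) D j S) = (fun S => D i S + \sum_(j <- r | P j) D j S).
  by apply/funext => S; rewrite big_cons Pi.
rewrite big_cons Pi -IH2; split; first by apply: divisor_onD => //; apply: hD.
by apply: divisor_degreeD => //; apply: hD.
Qed.

Lemma comp_eqn_ord v j S : points_on M (E v) S -> v != j ->
  curve_ord (E v) S (comp_eqn S j) (incident S j).
Proof.
move=> hS vj; have hv := excE v; rewrite /incident; case: pselect => Sj; last first.
  by rewrite comp_eqn_out //; apply: curve_ord1.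
rewrite comp_eqn_in //; have [|a [Sa na] ->] := eqn_coord hv (excE j) hS Sj.
  by move/E_inj/eqP; rewrite eq_sym (negPf vj).
rewrite -[1]add0r; apply: curve_ordM => //; last exact: curve_ord_coord.
exact: curve_ord_sunit.
Qed.

Lemma prod_ord v W S (r : seq G) : points_on M (E v) S ->
  curve_ord (E v) S (\prod_(j <- r | j != v) comp_eqn S j ^+ W j)
    (\sum_(j <- r | j != v) (W j)%:Z * incident S j).
Proof.
move=> hS; have hv := excE v; elim: r => [|j r IH].
  by rewrite !big_nil; apply: curve_ord1.
rewrite !big_cons; case: eqVneq => //= jv; apply: curve_ordM => //.
rewrite -(natz (W j)) mulr_natl; apply: curve_ordX => //.
by apply: comp_eqn_ord => //; rewrite eq_sym.
Qed.

Definition strict_ord v W h S : int := ordc (E v) S (h / cycle_eqn S W).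

Lemma strict_transform_degree v W h : A h -> (forall j, vge (E j) (W j) h) ->
  ~ vge (E v) (W v).+1 h ->
  [/\ forall S, points_on M (E v) S -> curve_ord (E v) S (h / cycle_eqn S W) (strict_ord v W h S),
      forall S, points_on M (E v) S -> 0 <= strict_ord v W h S,
      divisor_on M (E v) (strict_ord v W h) &
      divisor_degree M (E v) (strict_ord v W h) = - wdot W v].
Proof.
move=> Ah hW nh; have hv := excE v; set R := E v in hv nh *; set k := W v in nh *.
have hRr := exc_subring hv; have hRp := exc_prime hv.
have Sq S : points_on M R S -> S (h / cycle_eqn S W).
  move=> hS; apply: div_cycle_eqn => //; first exact: points_closed hS.
  by case: hS => MS _ _; apply: model_sub.
have nq S : points_on M R S -> ~ maxid R (h / cycle_eqn S W).
  move=> hS; apply: div_cycle_eqn_nmaxid => //; first exact: points_closed hS.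
  by case: hS.
have ha S : points_on M R S -> curve_ord R S (h / cycle_eqn S W) (strict_ord v W h S).
  move=> hS; apply: ordcP => //; last exact: nq.
  by case: (hS) => _ SR _; apply: SR; apply: Sq.
have [_ /(_ v) hgen /(_ v)[f0 [n [ef0 hn fn eb]]] _] := hE.
rewrite -/R in hgen ef0 hn fn eb.
have mf0 : maxid R f0 by rewrite ef0; exists 1; [apply: subring1|rewrite mul1r].
have f00 : f0 != 0.
  apply/eqP => f00; have : maxid R (unif R) := maxid_unif hv.
  by rewrite ef0 f00 => -[a _ /eqP]; rewrite mulr0 (negPf (unif_n0 hv)).
have hnX S : points_on M R S -> curve_ord R S (f0 / eqn S R) (n S).
  move=> hS; have [x ex ox] := hn S hS; have MS : M S by case: hS.
  have hSr := model_subring MS.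
  have eX : principal S x = principal S (eqn S R) by rewrite -ex -eqnE.
  have [c Sc ec] := principal_sub hSr eX; have [d Sd ed] := principal_sub hSr (esym eX).
  have X0 := eqn_n0 hv hS.
  have x0 : x != 0 by apply: contraNneq X0 => x0; rewrite ed x0 mulr0.
  have dc : d * c = 1 by apply: (mulIf X0); rewrite mul1r -mulrA -ec -ed.
  have c0 : c != 0 by apply/eqP => c0; move/eqP: dc; rewrite c0 mulr0 eq_sym oner_eq0.
  have -> : f0 / eqn S R = (f0 / x) * c by rewrite ec; field; rewrite X0 c0.
  rewrite -[n S]addr0; apply: curve_ordM => //; apply: curve_ord_sunit => //.
  apply: unit_nmaxid => //; suff -> : c^-1 = d by [].
  by rewrite -[LHS]mul1r -dc mulfK.
pose g := h / f0 ^+ k.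
have Rg : R g by apply/(vge_gen hv k h ef0)/hW.
have ng : ~ maxid R g.
  rewrite ef0 => -[a Ra ea]; apply: nh; apply/(vge_gen hv k.+1 h ef0).
  suff -> : h / f0 ^+ k.+1 = a by [].
  by rewrite exprSr invfM mulrA -/g ea mulfK.
pose c S := \sum_(j | j != v) (W j)%:Z * incident S j.
have hg S : points_on M R S -> ordc R S g = strict_ord v W h S + (c S + (- k%:Z) * n S).
  move=> hS; have cS := points_closed hv hS; have SR : S `<=` R by case: hS.
  have X0 := eqn_n0 hv hS; have z0 := cycle_eqn_n0 W cS.
  apply: ordcE => //.
  have -> : g = (h / cycle_eqn S W) * ((\prod_(j | j != v) comp_eqn S j ^+ W j) * ((f0 / eqn S R) ^+ k)^-1).
    have ez : cycle_eqn S W = eqn S R ^+ k * \prod_(j | j != v) comp_eqn S j ^+ W j.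
      by rewrite /cycle_eqn (bigD1 v) //= comp_eqn_in.
    rewrite ez in z0 *; move: z0; rewrite mulf_eq0 negb_or => /andP[z1 z2].
    by rewrite /g expr_div_n; field; do ?[apply/andP; split]; rewrite ?expf_neq0.
  apply: curve_ordM => //; first exact: ha.
  apply: curve_ordM => //; first exact: prod_ord.
  rewrite mulNr; apply: curve_ordV => //; rewrite -(natz k) mulr_natl.
  by apply: curve_ordX => //; apply: hnX.
have dg := degree_ordc hv hgen Rg ng.
have fg := ordc_divisor hv Rg ng.
have [fc dc] : divisor_on M R c /\ divisor_degree M R c = \sum_(j | j != v) (W j)%:Z * (edges v j)%:Z.
  have [|h1 h2] := @divisor_sum v G (index_enum G) (fun j => j != v) (fun j S => (W j)%:Z * incident S j).
    by move=> j jv; apply: divisor_onZ; have [] := @incident_divisor v j; rewrite // eq_sym.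
  split=> //; rewrite h2; apply: eq_bigr => j jv; rewrite divisor_degreeZ.
  have vj : v != j by rewrite eq_sym.
  by have [_ ->] := incident_divisor vj.
have fk := divisor_onZ (- k%:Z) fn.
have fck := divisor_onD fc fk.
have fa : divisor_on M R (strict_ord v W h).
  have := divisor_onD fg (divisor_onZ (-1) fck).
  apply: sub_finite_set => S [hS /= n0]; split=> //=.
  by rewrite hg // mulN1r addrK.
split=> //; first by move=> S hS; apply: curve_ord_ge0 (ha S hS) => //; apply: Sq.
have e : divisor_degree M R (ordc R ^~ g) =
    divisor_degree M R (fun S => strict_ord v W h S + (c S + (- k%:Z) * n S)).
  by apply: eq_fsbigr => S; rewrite inE; apply: hg.
move: dg; rewrite e divisor_degreeD // divisor_degreeD // divisor_degreeZ dc.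
rewrite mulNr -mulrN -eb => /eqP; rewrite addr_eq0 => /eqP ->; congr (- _).
rewrite /wdot [RHS](bigD1 v) //= /inter eqxx addrC; congr (_ + _).
by apply: eq_bigr => j jv; rewrite eq_sym (negPf jv).
Qed.

(** * Upper bound for the colength of O(-W) *)

Lemma fsum_ge_term (T : choiceType) (P : set T) (a : T -> int) (x : T) :
  finite_set (P `&` [set y | a y != 0]) -> (forall y : T, P y -> 0 <= a y) -> P x ->
  a x <= \sum_(y \in P) a y.
Proof.
move=> fa a0 Px; have fQ : finite_set ((P `&` [set y | a y != 0]) `|` [set x]).
  by rewrite finite_setU.
set Q := _ `|` _ in fQ.
have QP : Q `<=` P by move=> y [[]|-> //].
rewrite -(fsbig_widen Q P) // => [|y [Py nQy] /=]; last first.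
  by apply/eqP; apply: contrapT => /negP h; apply: nQy; left.
rewrite (fsbigD1 x) //=; last by right.
  by rewrite lerDl; apply: fsumr_ge0 => y [/QP Py _]; apply: a0.
Qed.

(* The global sections of O(-W). *)
Definition cycle_ideal W : set F := [set h | A h /\ forall v, vge (E v) (W v) h].

Definition cycle_add W Z : G -> nat := fun j => (W j + Z j)%N.

Definition cycle_unit v : G -> nat := fun j => (j == v)%N.

Lemma vgeZ v k (a : K) h : vge (E v) k h -> vge (E v) k (iota a * h).
Proof.
move=> hk; rewrite /vge -mulrA; apply: subringM => //; first exact: exc_subring (excE v).
exact: model_base (exc_M (excE v)) a.
Qed.

Lemma cycle_ideal_ksub W : ksubspace iota (cycle_ideal W).
Proof.
have hA := surface_subring; split.
  split; first exact: subring0.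
  by move=> v; rewrite /vge mul0r; apply: subring0; apply: exc_subring (excE v).
move=> a x y [Ax hx] [Ay hy]; split.
  by apply: subringD => //; apply: subringM => //; have [_] := surface_subalgebra; apply.
by move=> v; apply: vgeD (excE v) _ _ _ _ _ => //; apply: vgeZ.
Qed.

Lemma cycle_ideal_le W Z : (forall v, (W v <= Z v)%N) -> cycle_ideal Z `<=` cycle_ideal W.
Proof.
by move=> WZ h [Ah hZ]; split=> // v; apply: (vge_le (excE v) (WZ v)).
Qed.

Lemma cycle_ideal0 : cycle_ideal (fun=> 0%N) = A.
Proof.
apply/seteqP; split=> [h []//|h Ah]; split=> // v; apply/vge0.
exact/(model_sub (exc_M (excE v))).
Qed.

Lemma maxid_div_cycle_eqn S W v h : closed_pt S -> S `<=` E v -> maxid (E v) (h / cycle_eqn S W) ->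
  vge (E v) (W v).+1 h.
Proof. by move=> cS Sv mh; apply: contrapT => nh; exact: (div_cycle_eqn_nmaxid cS Sv nh mh). Qed.

(* A section restricting to E_v with a zero of order greater than the degree
   -W.E_v at one point vanishes on E_v. *)
Lemma spans_step W v d : (exists S, points_on M (E v) S) -> 1 - wdot W v <= d%:Z ->
  spans iota (cycle_ideal W) (cycle_ideal (cycle_add W (cycle_unit v))) d.
Proof.
move=> [S hS] hd; have hv := excE v; have cS := points_closed hv hS.
have Sv : S `<=` E v by case: hS.
have z0 := cycle_eqn_n0 W cS.
(* The filtration by the order at one point of the restriction to E_v, where sections vanishing on
   E_v count as having every order. Successive quotients have dimension at most 1. *)
pose V (k : nat) := [set h | cycle_ideal W h /\ (vge (E v) (W v).+1 h \/
   exists2 n : int, k%:Z <= n & curve_ord (E v) S (h / cycle_eqn S W) n)].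
have V0 k : V k 0.
  split; first by case: (cycle_ideal_ksub W).
  by left; rewrite /vge mul0r; apply: subring0; apply: exc_subring.
have VV k : V k.+1 `<=` V k.
  move=> h [hW hh]; split=> //; case: hh => [|[n kn hn]]; [by left|right].
  by exists n => //; apply: le_trans kn; rewrite lez_nat.
have step k : spans iota (V k) (V k.+1) 1.
  apply: spans1 => // x y [hx xx] [hy yy] nVy.
  have ny : ~ vge (E v) (W v).+1 y by move=> h; apply: nVy; split=> //; left.
  case: yy => // -[n kn hn].
  have en : n = k%:Z.
    apply/eqP; rewrite eq_le kn andbT leNgt; apply/negP => kn'; apply: nVy; split=> //.
    by right; exists n => //; rewrite -addn1 PoszD lezD1.
  case: (pselect (V k.+1 x)) => [Vx|nVx].
    by exists 0; rewrite rmorph0 mul0r subr0.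
  have nx : ~ vge (E v) (W v).+1 x by move=> h; apply: nVx; split=> //; left.
  case: xx => // -[m km hm].
  have em : m = k%:Z.
    apply/eqP; rewrite eq_le km andbT leNgt; apply/negP => km'; apply: nVx; split=> //.
    by right; exists m => //; rewrite -addn1 PoszD lezD1.
  rewrite em in hm; rewrite en in hn.
  have [a ha] := curve_ord_cancel hv hS hm hn; exists a.
  have e : x / cycle_eqn S W - iota a * (y / cycle_eqn S W) = (x - iota a * y) / cycle_eqn S W by ring.
  rewrite e in ha; split.
    by apply: ksubB (cycle_ideal_ksub W) hx _; apply: ksubZ (cycle_ideal_ksub W) hy.
  case: ha => [mh|[l kl hl]]; first by left; apply: maxid_div_cycle_eqn mh.
  by right; exists l => //; rewrite -addn1 PoszD lezD1.
have path k : spans iota (V 0%N) (V k) k.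
  elim: k => [|k IH]; first exact: spans0.
  have Vk : V k `<=` V 0%N by elim: (k) => // l IHl h /VV; apply: IHl.
  by have := spans_trans Vk IH (step k); rewrite addn1.
have hV0 : V 0%N = cycle_ideal W.
  apply/seteqP; split=> [h []//|h hW]; split=> //.
  case: (pselect (vge (E v) (W v).+1 h)) => [|nh]; [by left|right].
  have [Ah hj] := hW; have [h1 h2 _ _] := strict_transform_degree Ah hj nh.
  by exists (strict_ord v W h S); [apply: h2|apply: h1].
rewrite -hV0; apply: spans_sub (path d) => h [[Ah hj] hh].
have hv1 : vge (E v) (W v).+1 h.
  case: hh => [//|[n dn hn]]; apply: contrapT => nh.
  have [h1 h2 h3 h4] := strict_transform_degree Ah hj nh.
  have := fsum_ge_term h3 h2 hS; rewrite -/(divisor_degree M (E v) (strict_ord v W h)) h4.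
  rewrite (curve_ord_uniq hv hS (h1 _ hS) hn); lia.
split=> // j; rewrite /cycle_add /cycle_unit; case: eqVneq => [->|_]; first by rewrite addn1.
by rewrite addn0.
Qed.

(* The number -W.W. *)
Definition cycle_form W : int := - \sum_v (W v)%:Z * wdot W v.

Lemma inter_sym v j : inter v j = inter j v.
Proof.
by rewrite /inter eq_sym; case: eqVneq => [->//|_]; rewrite edges_sym.
Qed.

Lemma wdotD W Z v : wdot (cycle_add W Z) v = wdot W v + wdot Z v.
Proof.
by rewrite /wdot -big_split /=; apply: eq_bigr => j _; rewrite /cycle_add PoszD mulrDl.
Qed.

Lemma wdot_unit v j : wdot (cycle_unit v) j = inter j v.
Proof.
rewrite /wdot (bigD1 v) //= /cycle_unit eqxx mul1r big1 ?addr0 // => i iv.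
by rewrite (negPf iv) mul0r.
Qed.

Lemma wdot_scale n W v : wdot (fun j => (n * W j)%N) v = n%:Z * wdot W v.
Proof. by rewrite /wdot mulr_sumr; apply: eq_bigr => j _; rewrite PoszM mulrA. Qed.

Lemma cycle_form_scale n W : cycle_form (fun j => (n * W j)%N) = n%:Z ^+ 2 * cycle_form W.
Proof.
rewrite /cycle_form mulrN mulr_sumr; congr (- _); apply: eq_bigr => j _.
by rewrite PoszM wdot_scale; ring.
Qed.

Lemma wdot_adj W Z : \sum_v (W v)%:Z * wdot Z v = \sum_v (Z v)%:Z * wdot W v.
Proof.
rewrite /wdot; under eq_bigr do rewrite mulr_sumr.
rewrite exchange_big /=; apply: eq_bigr => j _; rewrite mulr_sumr; apply: eq_bigr => i _.
by rewrite inter_sym; ring.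
Qed.

Lemma cycle_form_unit W v : cycle_form (cycle_add W (cycle_unit v)) = cycle_form W - 2%:R * wdot W v - selfint v.
Proof.
rewrite /cycle_form; have -> : \sum_j (cycle_add W (cycle_unit v) j)%:Z * wdot (cycle_add W (cycle_unit v)) j =
   \sum_j (W j)%:Z * wdot W j + \sum_j (W j)%:Z * wdot (cycle_unit v) j
   + (\sum_j (cycle_unit v j)%:Z * wdot W j + \sum_j (cycle_unit v j)%:Z * wdot (cycle_unit v) j).
  rewrite -!big_split /=; apply: eq_bigr => j _; rewrite wdotD /cycle_add PoszD; ring.
rewrite wdot_adj.
have u1 (a : G -> int) : \sum_j (cycle_unit v j)%:Z * a j = a v.
  rewrite (bigD1 v) //= /cycle_unit eqxx mul1r big1 ?addr0 // => i iv.
  by rewrite (negPf iv) mul0r.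
by rewrite !u1 wdot_unit /inter eqxx; ring.
Qed.

Section Paths.
Hypothesis hpts : forall v, exists S, points_on M (E v) S.
Hypothesis hself : forall v, selfint v < 0.

Definition wbound Z : nat := (\sum_v \sum_j Z j * edges v j)%N.

Lemma wdot_le Z Z' v : (forall j, (Z j <= Z' j)%N) -> wdot Z v <= (wbound Z')%:Z.
Proof.
move=> ZZ'; apply: (@le_trans _ _ (\sum_j (Z' j * edges v j)%N%:Z)).
  apply: ler_sum => j _; rewrite /inter; case: eqVneq => [_|_].
    apply: (@le_trans _ _ 0) => //; apply: mulr_ge0_le0 => //; exact: ltW.
  by rewrite -PoszM lez_nat leq_mul2r ZZ' orbT.
rewrite -(big_morph Posz PoszD (erefl (Posz 0))) lez_nat.
by rewrite /wbound [leqRHS](bigD1 v) //= leq_addr.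
Qed.

(** An error of 2 + 2C for each component added, where C bounds W.E_v along the path. It depends on
    [Z] alone and not on the starting cycle. *)
Definition pathcost Z : nat := ((2 + 2 * wbound Z) * \sum_j Z j)%N.

(** Components are added one by one, in any order. Starting from an antinef cycle, every
    intersection number met on the way is bounded by the contribution of [Z]. *)
Lemma spans_path W Z : (forall v, wdot W v <= 0) ->
  exists2 d, spans iota (cycle_ideal W) (cycle_ideal (cycle_add W Z)) d &
    2%:R * d%:Z <= cycle_form (cycle_add W Z) - cycle_form W + (pathcost Z)%:Z.
Proof.
move=> hW; set C := wbound Z; rewrite /pathcost -/C.
have : forall Y, (forall j, (Y j <= Z j)%N) -> forall v, wdot (cycle_add W Y) v <= C%:Z.
  by move=> Y YZ v; rewrite wdotD -[C%:Z]add0r; apply: lerD => //; apply: wdot_le.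
clearbody C; move: {hW} W; have [n hn] : exists n, n = (\sum_j Z j)%N by exists (\sum_j Z j)%N.
rewrite -hn; elim: n Z hn => [|n IH] Z hn W hC.
  have Z0 j : Z j = 0%N.
    by apply/eqP; rewrite -leqn0 hn (bigD1 j) //= leq_addr.
  have -> : cycle_add W Z = W by apply/funext => j; rewrite /cycle_add Z0 addn0.
  by exists 0%N; [apply: spans0|rewrite subrr muln0 mulr0].
have [v Zv] : exists v, (0 < Z v)%N.
  apply: contrapT => h; suff : (\sum_j Z j = 0)%N by rewrite -hn.
  by apply: big1 => j _; apply/eqP; rewrite -leqn0 leqNgt; apply/negP => Zj; apply: h; exists j.
pose Z' j := (Z j - cycle_unit v j)%N.
have uZ j : (cycle_unit v j <= Z j)%N by rewrite /cycle_unit; case: eqVneq => [->|].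
have eZ : cycle_add (cycle_unit v) Z' = Z by apply/funext => j; rewrite /cycle_add /Z' subnKC.
have hn' : n = (\sum_j Z' j)%N.
  apply/eqP; rewrite -eqSS hn -eZ /cycle_add big_split /= -add1n; apply/eqP; congr (_ + _)%N.
  by rewrite (bigD1 v) //= /cycle_unit eqxx big1 // => i; case: eqVneq.
have eWZ : cycle_add (cycle_add W (cycle_unit v)) Z' = cycle_add W Z.
  by rewrite -eZ; apply/funext => j; rewrite /cycle_add addnA.
have [|d sd hd] := IH Z' hn' (cycle_add W (cycle_unit v)).
  move=> Y YZ' j; have -> : cycle_add (cycle_add W (cycle_unit v)) Y = cycle_add W (cycle_add (cycle_unit v) Y).
    by apply/funext => i; rewrite /cycle_add addnA.
  by apply: hC => i; rewrite -eZ /cycle_add leq_add2l.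
rewrite eWZ in sd hd.
have hw : wdot W v <= C%:Z.
  have -> : W = cycle_add W (fun=> 0%N) by apply/funext => i; rewrite /cycle_add addn0.
  exact: hC.
(* This is nonnegative and at least the bound 1 - W.E_v of [spans_step]. Since E_v^2 < 0, its double
   exceeds the growth -2 W.E_v - E_v^2 of the form by at most 2 + 2C. *)
pose c : int := 1 + C%:Z - wdot W v; pose e := `|c|%N.
have he : e%:Z = 1 + C%:Z - wdot W v by rewrite /e /c; lia.
exists (e + d)%N.
  apply: spans_trans sd; first by apply: cycle_ideal_le => j; rewrite /cycle_add leq_addr.
  by apply: spans_step => //; rewrite he; lia.
rewrite PoszD mulrDr he; move: hd; rewrite cycle_form_unit => hd.
have := hself v; rewrite !PoszM !PoszD; move: hd; rewrite !PoszM !PoszD.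
rewrite -[in n.+1%:Z]addn1 PoszD.
set a := 2 * C%:Z; nia.
Qed.

(** Restarting at an antinef cycle before each copy of [Z] keeps the total error linear in [n];
    along a single path to nZ the available bound would grow quadratically. *)
Lemma spans_blocks W Z n : (forall k, (k < n)%N -> forall v,
    wdot (cycle_add W (fun j => (k * Z j)%N)) v <= 0) ->
  exists2 d, spans iota (cycle_ideal W) (cycle_ideal (cycle_add W (fun j => (n * Z j)%N))) d &
    2%:R * d%:Z <= cycle_form (cycle_add W (fun j => (n * Z j)%N)) - cycle_form W + (n * pathcost Z)%N%:Z.
Proof.
elim: n => [|n IH] hW.
  have -> : cycle_add W (fun j => (0 * Z j)%N) = W by apply/funext => j; rewrite /cycle_add mul0n addn0.
  by exists 0%N; [apply: spans0|rewrite subrr mul0n mulr0].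
have [d sd hd] := IH (fun k kn => hW k (ltnW kn)).
have [e se he] := spans_path Z (hW n (ltnSn n)).
have eW : cycle_add (cycle_add W (fun j => (n * Z j)%N)) Z = cycle_add W (fun j => (n.+1 * Z j)%N).
  by apply/funext => j; rewrite /cycle_add mulSn addnA addnAC.
rewrite eW in se he; exists (d + e)%N.
  apply: spans_trans se => //; apply: cycle_ideal_le => j; exact: leq_addr.
rewrite PoszD mulrDr mulSn PoszD; lia.
Qed.

End Paths.

(** * Lower bound for the colength of O(-mZ) *)

(** The constant coefficient lies in the maximal ideal, hence is 0, and [t] can be cancelled modulo
    [P]. This gives both the independence of powers of a parameter and the uniqueness of power
    series expansions. *)
Lemma poly_low S P (t : F) n (p : {poly K}) : local_ring S -> (forall a, S (iota a)) ->
  ideal_of S P -> P `<=` maxid S -> maxid S t -> (forall z, S z -> P (t * z) -> P z) ->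
  forall s, S s -> P ((map_poly iota p).[t] - t ^+ n * s) -> forall i : nat, (i < n)%N -> p`_i = 0.
Proof.
move=> hS SK hP Pm mt cancel; have [hSr hm] := hS; have St := maxid_sub mt.
elim: n p => [|n IH] // p.
have Sp (q : {poly K}) : S (map_poly iota q).[t].
  by apply: subring_horner => // i; rewrite coef_map; apply: SK.
elim/poly_ind: p => [|p c _] s Ss; first by move=> _ i _; rewrite coef0.
rewrite rmorphD rmorphM /= map_polyX map_polyC hornerD hornerM hornerX hornerC => h.
have c0 : c = 0.
  apply/eqP; apply: contrapT => /negP c0.
  have : maxid S (iota c).
    have -> : iota c = ((map_poly iota p).[t] * t + iota c - t ^+ n.+1 * s)
       - ((map_poly iota p).[t] - t ^+ n * s) * t by rewrite exprS; ring.
    apply: (idealB hSr hm); first exact: Pm.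
    case: hm => _ _ _; apply=> //; apply: subringB => //.
    by apply: subringM => //; apply: subringX.
  by apply: unit_nmaxid; rewrite ?fmorph_eq0 // -fmorphV.
have {}h : P ((map_poly iota p).[t] - t ^+ n * s).
  apply: cancel; first by apply: subringB => //; apply: subringM => //; apply: subringX.
  have -> : t * ((map_poly iota p).[t] - t ^+ n * s) =
      (map_poly iota p).[t] * t + iota c - t ^+ n.+1 * s; last exact: h.
    have -> : iota c = 0 by apply/eqP; rewrite fmorph_eq0 c0.
    by rewrite exprS; ring.
move=> [|i] hi; rewrite coefD coefMX coefC /= ?add0r // addr0.
exact: (IH p s Ss h).
Qed.

Lemma poly_of_row n (c : 'rV[K]_n) (t : F) :
  \sum_i iota (c 0 i) * t ^+ i =
    (map_poly iota (\poly_(i < n) (if insub i is Some j then c 0 j else 0))).[t].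
Proof.
rewrite (@horner_coef_wide _ n); last by apply: (leq_trans (size_poly _ _)); apply: size_poly.
apply: eq_bigr => i _; rewrite coef_map coef_poly ltn_ord insubT //= => hi.
by rewrite (_ : Sub _ _ = i) //; apply: val_inj.
Qed.

Definition ideal2 S (a b : F) : set F := [set z | exists s t, [/\ S s, S t & z = s * a + t * b]].

Lemma ideal2_ideal S a b : subring S -> S a -> S b -> ideal_of S (ideal2 S a b).
Proof.
move=> hS Sa Sb; split.
- by move=> _ [s [t [Ss St ->]]]; apply: subringD => //; apply: subringM.
- by exists 0, 0; rewrite !mul0r addr0; split=> //; apply: subring0.
- move=> _ _ [s [t [Ss St ->]]] [s' [t' [Ss' St' ->]]].
  by exists (s + s'), (t + t'); split; [exact: subringD|exact: subringD|ring].
- move=> c _ Sc [s [t [Ss St ->]]].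
  by exists (c * s), (c * t); split; [exact: subringM|exact: subringM|ring].
Qed.

Lemma ideal2_l S a b s : subring S -> S s -> ideal2 S a b (s * a).
Proof. by move=> hS Ss; exists s, 0; rewrite mul0r addr0; split=> //; apply: subring0. Qed.
Lemma ideal2_r S a b s : subring S -> S s -> ideal2 S a b (s * b).
Proof. by move=> hS Ss; exists 0, s; rewrite mul0r add0r; split=> //; apply: subring0. Qed.

Lemma ideal2_a S a b : subring S -> ideal2 S a b a.
Proof. by move=> hS; have := ideal2_l a b hS (subring1 hS); rewrite mul1r. Qed.
Lemma ideal2_b S a b : subring S -> ideal2 S a b b.
Proof. by move=> hS; have := ideal2_r a b hS (subring1 hS); rewrite mul1r. Qed.

Lemma ideal_ksub S I : subring S -> (forall a, S (iota a)) -> ideal_of S I -> ksubspace iota I.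
Proof.
move=> hS SK [IS I0 ID IM]; split=> // a x y Ix Iy; apply: ID => //; exact: IM.
Qed.

Lemma subalg_ksub S : subring S -> (forall a, S (iota a)) -> ksubspace iota S.
Proof.
move=> hS SK; split; first exact: subring0.
by move=> a x y Sx Sy; apply: subringD => //; apply: subringM.
Qed.

Lemma closed_coords S : closed_pt S -> exists x y, [/\ maxid S x, maxid S y &
  forall z, maxid S z -> exists a b, [/\ S a, S b & z = a * x + b * y]].
Proof.
move=> [MS OS dS]; have [_ snc] := hM; have [x [y [Sx Sy mS _]]] := snc _ MS OS dS.
have hS := model_subring MS.
exists x, y; rewrite mS; split.
- by exists 1, 0; split; [exact: subring1|exact: subring0|ring].
- by exists 0, 1; split; [exact: subring0|exact: subring1|ring].
- by [].
Qed.

(** * Ideals of finite colength and primes at a closed point *)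

Section Cofinite.
Variables (S : set F) (cS : closed_pt S).
Let MS : M S. Proof. by case: cS. Qed.
Let dS : krull_dim S 2. Proof. by case: cS. Qed.
Let hSl := model_local MS.
Let hSr := model_subring MS.
Let SK : forall a, S (iota a) := model_base MS.

Lemma spans_ideal2_pow x y a b : maxid S x -> maxid S y ->
  (forall z, maxid S z -> exists a b, [/\ S a, S b & z = a * x + b * y]) ->
  exists d, spans iota S (ideal2 S (x ^+ a) (y ^+ b)) d.
Proof.
move=> mx my gen; have Sx := maxid_sub mx; have Sy := maxid_sub my.
have S0 := subring0 hSr.
have res s : S s -> exists c : K, exists p q : F, [/\ S p, S q & s = iota c + (p * x + q * y)].
  move=> Ss; have [c mc] := residue_constant surface_affine surface_no_chain hSl
    (model_subalgebra MS) dS Ss.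
  have [p [q [Sp Sq e]]] := gen _ mc; exists c, p, q; split=> //.
  by rewrite -e addrC subrK.
have stepx k : spans iota (ideal2 S (x ^+ k) y) (ideal2 S (x ^+ k.+1) y) 1.
  exists (fun=> x ^+ k); split.
    by move=> _; apply: ideal2_a.
  move=> _ [s [t [Ss St ->]]]; have [c [p [q [Sp Sq ->]]]] := res s Ss.
  exists (c%:M); rewrite big_ord1 mxE eqxx mulr1n.
  exists p, (t + q * x ^+ k); split=> //; last by rewrite exprS; ring.
  by apply: subringD => //; apply: subringM => //; apply: subringX.
have spx k : spans iota S (ideal2 S (x ^+ k) y) k.
  elim: k => [|k IH].
    by apply: spans0 => s Ss; have := ideal2_l (x ^+ 0) y hSr Ss; rewrite expr0 mulr1.
  rewrite -addn1; apply: spans_trans IH _; last by rewrite addn1; apply: stepx.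
  by have [] := ideal2_ideal hSr (subringX hSr k Sx) Sy.
have stepy l : spans iota (ideal2 S (x ^+ a) (y ^+ l)) (ideal2 S (x ^+ a) (y ^+ l.+1)) a.
  have [b0 [hb0 sb0]] := spx a; exists (fun i : 'I_a => b0 i * y ^+ l); split.
    by move=> i; apply: ideal2_r.
  move=> _ [s [t [Ss St ->]]]; have [c [p [q [Sp Sq e]]]] := sb0 t St.
  exists c; have -> : \sum_i iota (c 0 i) * (b0 i * y ^+ l) = (\sum_i iota (c 0 i) * b0 i) * y ^+ l.
    by rewrite mulr_suml; apply: eq_bigr => i _; rewrite mulrA.
  exists (s + p * y ^+ l), q; split=> //.
    by apply: subringD => //; apply: subringM => //; apply: subringX.
  have -> : t = p * x ^+ a + q * y + \sum_i iota (c 0 i) * b0 i by rewrite -e subrK.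
  by rewrite exprS; ring.
elim: b => [|b [d IH]].
  by exists 0%N; apply: spans0 => s Ss; have := ideal2_r (x ^+ a) (y ^+ 0) hSr Ss; rewrite expr0 mulr1.
exists (d + a)%N; apply: spans_trans IH (stepy b).
have [h _ _ _] := ideal2_ideal hSr (subringX hSr a Sx) (subringX hSr b Sy).
exact: h.
Qed.

(** By [radical_pow] the ideal contains powers of both coordinates, and the quotient by such powers
    is finite because residues are constants. *)
Lemma cofinite I : ideal_of S I ->
  (forall P, prime_of S P -> I `<=` P -> P = maxid S) ->
  (exists d, spans iota S I d) /\
  (exists x y n, [/\ maxid S x, maxid S y,
     forall z, maxid S z -> exists a b, [/\ S a, S b & z = a * x + b * y] &
     I (x ^+ n) /\ I (y ^+ n)]).
Proof.
move=> hI hP; have [x [y [mx my gen]]] := closed_coords cS.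
have Sx := maxid_sub mx; have Sy := maxid_sub my.
have [n In] : exists n, I (x ^+ n) by apply: (radical_pow hSr) => // P hP' /(hP _ hP') ->.
have [m Im] : exists m, I (y ^+ m) by apply: (radical_pow hSr) => // P hP' /(hP _ hP') ->.
case: (hI) => IS I0 ID IM; split.
  have [d hd] := spans_ideal2_pow n m mx my gen; exists d; apply: spans_sub hd.
  by move=> _ [s [t [Ss St ->]]]; apply: ID; apply: IM.
exists x, y, (n + m)%N; split=> //; split.
  by rewrite exprD mulrC; apply: IM => //; apply: subringX.
by rewrite exprD; apply: IM => //; apply: subringX.
Qed.

(** The ideal quotient (I : m^k), with m the maximal ideal of [S]. *)
Fixpoint colon I k : set F :=
  if k is k'.+1 then [set s | S s /\ forall m, maxid S m -> colon I k' (m * s)] else I.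

Lemma colon_ideal I k : ideal_of S I -> ideal_of S (colon I k).
Proof.
move=> hI; elim: k => [|k [h1 h2 h3 h4]] //=; split.
- by move=> s [].
- by split=> [|m mm]; [exact: subring0|rewrite mulr0].
- move=> s t [Ss hs] [St ht]; split=> [|m mm]; first exact: subringD.
  by rewrite mulrDr; apply: h3; [apply: hs|apply: ht].
- move=> c s Sc [Ss hs]; split=> [|m mm]; first exact: subringM.
  by rewrite mulrCA; apply: h4 => //; apply: hs.
Qed.

Lemma colon_one I : ideal_of S I ->
  (forall P, prime_of S P -> I `<=` P -> P = maxid S) -> exists k, colon I k 1.
Proof.
move=> hI hP; have [_ [x [y [n [mx my gen [Ix Iy]]]]]] := cofinite hI hP.
have Sx := maxid_sub mx; have Sy := maxid_sub my.
exists (n + n)%N; suff h k a b : (n + n <= a + b + k)%N -> colon I k (x ^+ a * y ^+ b).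
  by have := h (n + n)%N 0%N 0%N (leqnn _); rewrite !expr0 mulr1.
elim: k a b => [|k IH] a b hab /=.
  case: hI => _ _ _ IM; rewrite addn0 in hab.
  case: (leqP n a) => na.
    rewrite mulrC -(subnK na) exprD mulrA; apply: IM => //.
    by apply: subringM => //; apply: subringX.
  have nb : (n <= b)%N by lia.
  rewrite -(subnK nb) exprD mulrA; apply: IM => //.
  by apply: subringM => //; apply: subringX.
split; first by apply: subringM => //; apply: subringX.
move=> m /gen[p [q [Sp Sq ->]]]; have [_ _ h3 h4] := colon_ideal k hI.
have -> : (p * x + q * y) * (x ^+ a * y ^+ b) =
  p * (x ^+ a.+1 * y ^+ b) + q * (x ^+ a * y ^+ b.+1) by rewrite !exprS; ring.
by apply: h3; apply: h4 => //; apply: IH; lia.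
Qed.

(** The localization at [P] is again in [M]. Over O it has dimension 1, since a longer chain would
    extend by the maximal ideal of [S] to length 3, so it is an exceptional component. Away from O
    the resolution is an isomorphism and it is a local ring of [A]. *)
Lemma prime_cases P : prime_of S P -> P <> [set 0] -> P <> maxid S ->
  (exists v, S `<=` E v /\ P = component_ideal (E v) S) \/
  [/\ prime_of A (P `&` A), localization S P = localization A (P `&` A) & ~ mO `<=` P].
Proof.
move=> hP P0 Pm; have MP := model_prime MS hP; have hPl := model_local MP.
have SP := loc_sub hSr hP; have eP := maxid_loc_contract hSr hP.
have hAr := surface_subring; have AS := model_sub MS.
case: (pselect (over_O A mO (localization S P))) => hO; last first.
  right; have [h1 h2] := model_off_O MP hO.
  have e : maxid (localization S P) `&` A = P `&` A.
    apply/seteqP; split=> z [mz Az]; split=> //; last first.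
      have : (maxid (localization S P) `&` S) z by rewrite eP.
      by case.
    suff : (maxid (localization S P) `&` S) z by rewrite eP.
    by split=> //; apply: AS.
  split; [by rewrite -e|by rewrite -e|move=> mP; apply: hO].
  apply: (over_O_intro MP) => z mz; have := mP z mz; rewrite -{1}eP.
  by case.
left; have dP : krull_dim (localization S P) 1.
  split; last first.
    case=> Q [hQ ltQ].
    have hc (i : nat) : (i <= 2)%N -> prime_of S (Q i `&` S).
      by move=> hi; apply: prime_contract (hQ i hi) => //; apply: loc_subring.
    have hlt (i : nat) : (i < 2)%N -> Q i `&` S `<` Q i.+1 `&` S.
      move=> hi; have [l1 /existsNP[z /not_implyP[q n]]] := ltQ i hi.
      split=> [w [Qw Sw]|h]; first by split=> //; apply: l1.
      have [a [b [Sa Sb nb ez]]] := prime_sub (hQ i.+1 hi) q.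
      have b0 := prime_n0 hP nb.
      have [Qa _] : (Q i `&` S) a.
        apply: h; split=> //; have -> : a = b * z by rewrite ez mulrC divfK.
        by apply: (primeMl (hQ i.+1 hi)) => //; apply: SP.
      apply: n; rewrite ez; apply: (primeMr (hQ i (ltnW hi))) => //.
      exact: loc_inv.
    have lt3 : Q 2%N `&` S `<` maxid S.
      apply: set_lt_neq; first by apply: prime_le_maxid => //; apply: hc.
      move=> e; apply: Pm; apply/seteqP; split; first exact: prime_le_maxid.
      move=> z mz; rewrite -eP; have [Qz Sz] : (Q 2%N `&` S) z by rewrite e.
      by split=> //; apply: prime_le_maxid Qz => //; apply: hQ.
    have := prime_chain3 (hc 0%N isT) (hc 1%N isT) (hc 2%N isT) (local_maxid_prime hSl)
       (hlt 0%N isT) (hlt 1%N isT) lt3.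
    exact: model_no_chain.
  exists (nth setT [:: [set 0]; maxid (localization S P)]).
  apply: prime_chain1; [exact/zero_prime/loc_subring|exact: local_maxid_prime|].
  apply: set_lt_neq; first by move=> _ ->; apply: prime0 (local_maxid_prime hPl).
  move=> e; apply: P0; rewrite -eP -e; apply/seteqP; split=> [z []//|_ ->].
  by split=> //; apply: subring0.
have hex : exc (localization S P) by split.
case: hE => -[_ _ /(_ _ hex)[v _ ev]] _ _ _; exists v; rewrite ev.
by split=> //; rewrite /component_ideal eP.
Qed.

End Cofinite.

Lemma vge_cancel v k l f x : vge (E v) l f -> ~ vge (E v) l.+1 f ->
  vge (E v) (l + k) (f * x) -> vge (E v) k x.
Proof.
have hR := excE v; have hRr := exc_subring hR; have u0 := unif_n0 hR.
rewrite /vge => f1 f2 h.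
have g0 : ~ maxid (E v) (f / unif (E v) ^+ l) by move=> m; apply: f2; apply/vgeS_maxid.
have gV := maxid_nunit f1 g0; have gn0 := maxid_n0 f1 g0.
have -> : x / unif (E v) ^+ k = (f / unif (E v) ^+ l)^-1 * (f * x / unif (E v) ^+ (l + k)).
  have f0 : f != 0 by apply: contraNneq gn0 => ->; rewrite mul0r.
  rewrite exprD; move: (expf_neq0 l u0) (expf_neq0 k u0).
  set a := _ ^+ l; set b := _ ^+ k => a0 b0.
  by field; rewrite a0 b0 f0.
exact: subringM.
Qed.

Lemma common_denominator T S P d (b : 'I_d -> F) : subring T -> subring S -> T `<=` S ->
  prime_of S P -> localization S P = localization T (P `&` T) -> (forall i : 'I_d, S (b i)) ->
  exists D, [/\ T D, ~ P D & forall i : 'I_d, T (D * b i)].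
Proof.
move=> hT hS TS hP eP Sb.
have den (i : 'I_d) : exists x, [/\ T x, ~ P x & T (x * b i)].
  have : localization S P (b i) by apply: loc_sub.
  rewrite eP => -[a [x [Ta Tx nx e]]]; exists x; split=> //.
    by move=> Px; apply: nx.
  rewrite e mulrC divfK //; apply/eqP => x0; apply: nx; rewrite x0.
  by split; [exact: (prime0 hP)|exact: subring0].
pose x (i : 'I_d) := xget 0 [set x | [/\ T x, ~ P x & T (x * b i)]].
have hx (i : 'I_d) : [/\ T (x i), ~ P (x i) & T (x i * b i)].
  by have [w hw] := den i; rewrite /x; case: xgetP => [y _ //|/(_ w)].
exists (\prod_i x i); split.
- by apply: subring_prod => // i _; case: (hx i).
- suff : T (\prod_i x i) /\ ~ P (\prod_i x i) by case.
  apply: (big_ind (fun z => T z /\ ~ P z)).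
  + by split; [exact: subring1|exact: (prime1 hP)].
  + move=> y z [Ty ny] [Tz nz]; split; first exact: subringM.
    by apply: (prime_nM hP) => //; apply: TS.
  + by move=> i _; have [] := hx i.
- move=> i; rewrite (bigD1 i) //= mulrAC; have [_ _ h] := hx i.
  by apply: subringM => //; apply: subring_prod => // j _; case: (hx j).
Qed.

(** * The strict transform of f = 0 and its truncations *)

Section LowerBound.
Variables (f : F) (Z : G -> nat).
Hypotheses (Of : mO f) (f_n0 : f != 0).
Hypothesis f_ge : forall v, vge (E v) (Z v) f.
Hypothesis f_lt : forall v, ~ vge (E v) (Z v).+1 f.

(* A local equation of the strict transform of the curve f = 0. *)
Definition strict_eqn S : F := f / cycle_eqn S Z.
Definition cut_ideal S W : set F := ideal2 S (strict_eqn S) (cycle_eqn S W).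
(** The local intersection number of the strict transform with E_v; [local_colength] extends it
    additively to cycles. *)
Definition strict_mult S v : nat := if pselect (S `<=` E v) then `|strict_ord v Z f S|%N else 0%N.
Definition local_colength S W : nat := (\sum_v W v * strict_mult S v)%N.

Let Af : A f. Proof. exact: mO_sub. Qed.

Section AtPoint.
Variables (S : set F) (cS : closed_pt S).
Let MS : M S. Proof. by case: cS. Qed.
Let dS : krull_dim S 2. Proof. by case: cS. Qed.
Let hSl := model_local MS.
Let hSr := model_subring MS.
Let SK : forall a, S (iota a) := model_base MS.

Lemma strict_eqn_S : S (strict_eqn S).
Proof. by apply: div_cycle_eqn => //; apply: (model_sub MS). Qed.

Lemma strict_eqn_nmaxid v : S `<=` E v -> ~ maxid (E v) (strict_eqn S).
Proof. by move=> h; apply: div_cycle_eqn_nmaxid. Qed.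

Lemma strict_eqn_n0 : strict_eqn S != 0.
Proof. by rewrite mulf_neq0 // invr_eq0; apply: cycle_eqn_n0. Qed.

Lemma cut_ideal_ideal W : ideal_of S (cut_ideal S W).
Proof. by apply: ideal2_ideal => //; [exact: strict_eqn_S|exact: cycle_eqn_S]. Qed.

(** On E_v the strict transform restricts to a unit times y^n, with y = [coord]; hence 1, y, ...,
    y^(n-1) are independent in the quotient. *)
Lemma indep_comp_eqn v : indep iota S (ideal2 S (strict_eqn S) (comp_eqn S v)) (strict_mult S v).
Proof.
rewrite /strict_mult; case: pselect => [Sv|] /=; last by move=> _; apply: indep0.
have hR := excE v; have hS := closed_points cS Sv.
have [/(_ _ hS) ho /(_ _ hS) h0 _ _] := strict_transform_degree Af f_ge (f_lt (v := v)).
pose n := `|strict_ord v Z f S|%N.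
have en : strict_ord v Z f S = n%:Z by rewrite /n gez0_abs.
rewrite -/n; rewrite en in ho.
have [u [Su nu]] := (curve_ordP hR hS _ _).1 ho; rewrite /cong -exprnP => hc.
have Sy := coord_in hR hS.
exists (fun i : 'I_n => coord (E v) S ^+ i); split=> [i|c].
  exact: subringX.
rewrite poly_of_row => -[s [t [Ss St e]]].
set p := \poly_(i < n) _ in e.
have SX := eqn_in hR hS; rewrite (comp_eqn_in Sv) in e.
have hcp := component_prime hR hS.
have hP : component_ideal (E v) S ((map_poly iota p).[coord (E v) S] - coord (E v) S ^+ n * (s * u)).
  have alg (q a b k y r x : F) : q = a * b + r * x ->
    q - y * (a * k) = a * (b - k * y) + r * x by move=> ->; ring.
  rewrite (alg _ _ _ _ _ _ _ e).
  apply: (primeD hcp); apply: (primeMl hcp) => //; last exact: cp_eqn.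
  split=> //; apply: subringB => //; first exact: strict_eqn_S.
  by apply: subringM => //; apply: subringX.
have low := poly_low hSl SK (prime_ideal hcp) (prime_le_maxid hSl hcp)
  (coord_maxid hR hS) _ (subringM hSr Ss Su) hP.
have {}low : forall i : nat, (i < n)%N -> p`_i = 0.
  apply: low => z Sz hz.
  by case: hcp => _ _ /(_ _ _ Sy Sz hz)[/(coord_ncp hR hS)|].
apply/rowP => i; rewrite mxE; have := low i (ltn_ord i).
by rewrite coef_poly ltn_ord insubT //= => hi; rewrite (_ : Sub _ _ = i) //; apply: val_inj.
Qed.

(** The strict equation is a nonzerodivisor modulo [g]. This is carried along with the length bound
    in [good] because additivity of the bounds in products depends on it. *)
Let reg g := forall s, S s -> principal S g (s * strict_eqn S) -> principal S g s.
Let good g n := [/\ S g, g != 0, reg g & indep iota S (ideal2 S (strict_eqn S) g) n].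

Lemma good1 : good 1 0.
Proof.
split; [exact: subring1|exact: oner_neq0| |exact: indep0].
by move=> s Ss _; exists s; rewrite ?mulr1.
Qed.

(** Multiplication by [g] embeds S/(f', h) in S/(f', g h), where f' is the strict equation, with
    quotient S/(f', g); regularity modulo [g] makes it injective. *)
Lemma goodM g h (a b : nat) : good g a -> good h b -> good (g * h) (a + b).
Proof.
move=> [Sg g0 rg ig] [Sh h0 rh ih]; have Sf := strict_eqn_S; split.
- exact: subringM.
- exact: mulf_neq0.
- move=> s Ss [r Sr e].
  have [s' Ss' es] : principal S g s by apply: rg => //; exists (r * h); [exact: subringM|rewrite e; ring].
  have [s'' Ss'' es'] : principal S h s'.
    apply: rh => //; exists r => //; apply: (mulfI g0); rewrite mulrA (mulrC g) -es e; ring.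
  by exists s''; rewrite // es es'; ring.
- have hk I : ideal_of S I -> ksubspace iota I by apply: ideal_ksub.
  have SM : S (g * h) by apply: subringM.
  apply: (@indep_trans _ _ _ _ (ideal2 S (strict_eqn S) g)) => //.
  + by case: (ideal2_ideal hSr Sf Sg).
  + move=> _ [s [t [Ss St ->]]]; exists s, (t * h); split=> //; first exact: subringM.
    by ring.
  + by apply: hk; apply: ideal2_ideal.
  + apply: (@indep_mul _ _ _ _ (ideal2 S (strict_eqn S) h) _ _ _ g) ih.
    * exact: subalg_ksub.
    * by move=> x Sx; rewrite mulrC; apply: ideal2_r.
    move=> x Sx [s [t [Ss St e]]].
    have [s' Ss' es] : principal S g s.
      apply: rg => //; exists (x - t * h); first by apply: subringB => //; apply: subringM.
      by apply: (addIr (t * (g * h))); rewrite -e; ring.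
    exists s', t; split=> //; apply: (mulfI g0); rewrite e es; ring.
Qed.

Lemma goodX g a n : good g a -> good (g ^+ n) (n * a).
Proof.
move=> hg; elim: n => [|n IH]; first by rewrite expr0 mul0n; apply: good1.
by rewrite exprS mulSn; apply: goodM.
Qed.

Lemma reg_comp_eqn v : reg (comp_eqn S v).
Proof.
move=> s Ss; case: (pselect (S `<=` E v)) => Sv; last first.
  by move=> _; exists s; rewrite // comp_eqn_out ?mulr1.
have hR := excE v; have hS := closed_points cS Sv.
rewrite (comp_eqn_in Sv) -eqnE // => h.
have hcp := component_prime hR hS.
case: hcp => _ _ /(_ _ _ Ss strict_eqn_S h) [//|[/(strict_eqn_nmaxid Sv)]].
by [].
Qed.

Lemma indep_cut_ideal W : indep iota S (cut_ideal S W) (local_colength S W).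
Proof.
suff : good (cycle_eqn S W) (local_colength S W) by case.
rewrite /cycle_eqn /local_colength; apply: (big_ind2 good) => [|? ? ? ?|v _]; [exact: good1|exact: goodM|].
apply: goodX; split; [exact: comp_eqn_S|exact: comp_eqn_n0|exact: reg_comp_eqn|exact: indep_comp_eqn].
Qed.

Lemma cut_ideal_prime W P : prime_of S P -> cut_ideal S W `<=` P -> P = maxid S.
Proof.
move=> hP JP; have Pf : P (strict_eqn S) by apply: JP; apply: ideal2_a.
have : P (cycle_eqn S W) by apply: JP; apply: ideal2_b.
rewrite /cycle_eqn => h.
have [v [Sv Pv]] : exists v, S `<=` E v /\ P (comp_eqn S v).
  apply: contrapT => hn; have : ~ P (cycle_eqn S W); last by [].
  have hnv v : ~ P (comp_eqn S v).
    move=> Pv; case: (pselect (S `<=` E v)) => Sv; first by apply: hn; exists v.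
    by move: Pv; rewrite comp_eqn_out //; apply: (prime1 hP).
  suff : S (cycle_eqn S W) /\ ~ P (cycle_eqn S W) by case.
  rewrite /cycle_eqn; apply: (big_ind (fun x => S x /\ ~ P x)).
  - by split; [exact: subring1|exact: (prime1 hP)].
  - by move=> x y [Sx nx] [Sy ny]; split; [exact: subringM|exact: (prime_nM hP)].
  - move=> w _; split; first by apply: subringX => //; apply: comp_eqn_S.
    by apply: (prime_nX hSr hP) => //; apply: comp_eqn_S.
have hR := excE v; have hS := closed_points cS Sv.
have hcp := component_prime hR hS; rewrite (comp_eqn_in Sv) in Pv.
have le : component_ideal (E v) S `<=` P.
  by move=> z /(cpP hR hS)[a Sa ->]; apply: (primeMl hP).
have [e|//] := dim2_primes hSl dS hcp (component_n0 hR MS Sv) hP le.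
by move: Pf; rewrite e => -[/(strict_eqn_nmaxid Sv)].
Qed.

Lemma prime_strict_eqn P : prime_of S P -> P (strict_eqn S) -> P <> maxid S ->
  [/\ prime_of A (P `&` A), localization S P = localization A (P `&` A) & ~ mO `<=` P].
Proof.
move=> hP Pf Pm; have [|[v [Sv e]]|//] := prime_cases cS hP _ Pm.
  by move=> e; move: Pf; rewrite e => /eqP; rewrite (negPf strict_eqn_n0).
by move: Pf; rewrite e => -[/(strict_eqn_nmaxid Sv)].
Qed.

Lemma mO_cycle_eqn1 m : mO m -> exists2 s, S s & m = cycle_eqn S (fun=> 1%N) * s.
Proof.
move=> Om; exists (m / cycle_eqn S (fun=> 1%N)); last first.
  by rewrite mulrC divfK //; apply: cycle_eqn_n0.
apply: div_cycle_eqn => //; first by apply: (model_sub MS); apply: mO_sub.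
move=> v _; apply/vge1; first exact: excE.
by move: Om; rewrite -(exc_over (excE v)) => -[].
Qed.

(** Multipliers from [A] carrying [S] into [A] modulo the cut ideals, in the manner of the conductor
    of a curve. One multiplier must serve all [W], so that the codimension lost does not grow with
    [W]. *)
Definition conductor : set F := [set b | A b /\ forall W s, S s -> exists2 a, A a & cut_ideal S W (b * s - a)].

(* S is spanned modulo (f', mO) by finitely many elements, with a common
   denominator D outside P; then D S <= A + f' S + mO D S can be iterated. *)
Lemma conductor_avoid P : prime_of S P -> P (strict_eqn S) -> P <> maxid S -> exists2 b, conductor b & ~ P b.
Proof.
move=> hP Pf Pm; have [hPA eP _] := prime_strict_eqn hP Pf Pm.
have Sf := strict_eqn_S; have hAr := surface_subring; have AS := model_sub MS.
(* This ideal has finite colength: a prime containing the strict equation, other than the maximal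
   ideal, does not contain [mO]. *)
pose I0 := gen_ideal S ([set strict_eqn S] `|` mO).
have I0s : [set strict_eqn S] `|` mO `<=` S by move=> z [->//|/mO_sub/AS].
have hI0 : ideal_of S I0 by apply: gen_ideal_ideal.
have I0m z : ([set strict_eqn S] `|` mO) z -> I0 z.
  move=> hz; have := @lspan_mem F (fun a b => S a /\ ([set strict_eqn S] `|` mO) b) 1 z.
  by rewrite mul1r; apply; split=> //; apply: subring1.
have [] := cofinite cS hI0.
  move=> Q hQ IQ; apply: contrapT => Qm.
  have [_ _] := prime_strict_eqn hQ (IQ _ (I0m _ (or_introl erefl))) Qm.
  by apply=> m Om; apply: IQ; apply: I0m; right.
move=> [d [be [Sbe spbe]]] _.
have [D [AD nD hD]] := common_denominator hAr hSr AS hP eP Sbe.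
exists D => //; split=> // W.
pose z1 := cycle_eqn S (fun=> 1%N).
have Sz1 : S z1 by apply: cycle_eqn_S.
have main N s : S s -> exists a t r, [/\ A a, S t, S r &
    D * s = a + t * strict_eqn S + D * z1 ^+ N * r].
  elim: N s => [|N IH] s Ss.
    exists 0, 0, s; split=> //; [exact: subring0|exact: subring0|].
    by rewrite expr0; ring.
  pose Q x := S x /\ exists a t r, [/\ A a, S t, S r & D * x = a + t * strict_eqn S + D * z1 ^+ N.+1 * r].
  have QD x y : Q x -> Q y -> Q (x + y).
    move=> [Sx [a [t [r [Aa St Sr e]]]]] [Sy [a' [t' [r' [Aa' St' Sr' e']]]]].
    split; first exact: subringD.
    exists (a + a'), (t + t'), (r + r'); split; try exact: subringD.
    by rewrite mulrDr e e'; ring.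
  have Q0 : Q 0.
    split; first exact: subring0.
    by exists 0, 0, 0; split; [exact: subring0|exact: subring0|exact: subring0|ring].
  suff : Q s by case.
  have [c hc] := spbe s Ss.
  rewrite -(subrK (\sum_i iota (c 0 i) * be i) s); apply: (QD).
    move: hc; apply: (lspan_sub Q0 QD) => x z [Sx [->|Om]].
      split; first exact: subringM.
      exists 0, (D * x), 0; split; [exact: subring0|by apply: subringM => //; apply: AS|exact: subring0|ring].
    have Az := mO_sub Om; split; first by apply: subringM => //; apply: AS.
    have [a [t [r [Aa St Sr e]]]] := IH x Sx.
    have [m' Sm' em] := mO_cycle_eqn1 Om; have Sz := AS _ Az.
    exists (z * a), (z * t), (m' * r); split; try exact: subringM.
    have -> : D * z1 ^+ N.+1 * (m' * r) = z * (D * z1 ^+ N * r).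
      by rewrite em -/z1 exprS; ring.
    have -> : D * (x * z) = z * (D * x) by ring.
    by rewrite e; ring.
  apply: (big_ind Q) => // i _.
  split; first by apply: subringM.
  exists (iota (c 0 i) * (D * be i)), 0, 0; split; try exact: subring0.
    by apply: subringM => //; have [_] := surface_subalgebra; apply.
  by ring.
(* Each round of [main] gains a factor z1, the equation of the reduced exceptional divisor; after as
   many rounds as the largest multiplicity of [W] the remainder is divisible by the equation of
   [W]. *)
move=> s Ss; have [a [t [r [Aa St Sr e]]]] := main (\max_v W v)%N s Ss.
exists a => //; have [_ _ jD jM] := cut_ideal_ideal W.
have -> : D * s - a = t * strict_eqn S + D * r * z1 ^+ (\max_v W v)%N by rewrite e; ring.
apply: jD; first by apply: ideal2_l.
have -> : z1 ^+ (\max_v W v)%N = (\prod_v comp_eqn S v ^+ (\max_v W v - W v)) * cycle_eqn S W.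
  rewrite /z1 /cycle_eqn -big_split /= -prodrXl; apply: eq_bigr => v _.
  by rewrite expr1 -exprD subnK //; apply: leq_bigmax.
rewrite mulrA; apply: ideal2_r => //; apply: subringM => //.
  by apply: subringM => //; apply: AS.
by apply: subring_prod => // v _; apply: subringX => //; apply: comp_eqn_S.
Qed.

End AtPoint.

Lemma lspan_mono (P Q : F -> F -> Prop) x : (forall a b, P a b -> Q a b) ->
  lspan P x -> lspan Q x.
Proof. by move=> PQ; elim=> [|a b y /PQ h _ IH]; [exact: lspan0|exact: lspanD]. Qed.

(** Otherwise a valuation ring containing both local rings would dominate both, contradicting
    separatedness. *)
Lemma separated_unit S T : closed_pt S -> closed_pt T -> S <> T ->
  lspan (fun a b => [/\ S a, T b & maxid S a \/ maxid T b]) 1.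
Proof.
move=> [MS _ _] [MT _ _] ST; have hS := model_subring MS; have hT := model_subring MT.
have [_ [_ _ _ IS]] := model_local MS; have [_ [_ _ _ IT]] := model_local MT.
pose D := lspan (fun a b => S a /\ T b); pose P a b := [/\ S a, T b & maxid S a \/ maxid T b].
have DP (c a b : F) : D c -> P a b -> lspan P (c * (a * b)).
  move=> Dc [Sa Tb m]; rewrite mulrC; move: Dc; apply: lspan_map => a' b' [Sa' Tb'].
  rewrite mulrACA; apply: lspan_mem; split; [exact: subringM|exact: subringM|].
  rewrite (mulrC a) (mulrC b); case: m => m; [left|right].
    exact: IS.
  exact: IT.
have DM x y : D x -> D y -> D (x * y).
  move=> Dx; apply: lspan_map => a b [Sa Tb]; rewrite mulrC.
  move: Dx; apply: lspan_map => a' b' [Sa' Tb'].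
  by rewrite mulrACA; apply: lspan_mem; split; apply: subringM.
have D1 : D 1.
  by rewrite -(mulr1 1); apply: lspan_mem; split; apply: subring1.
have hD : subring D.
  split=> // x y Dx Dy; split; last exact: DM.
  apply: lspan_add => //; rewrite -mulN1r; apply: DM => //.
  rewrite -(mulr1 (-1)); apply: lspan_mem; split; last exact: subring1.
  by apply: subringN => //; apply: subring1.
apply: contrapT => n1; apply: ST.
have hI : ideal_of D (lspan P).
  apply: (lspan_ideal hD) => [a b [Sa Tb _]|]; first exact: lspan_mem.
  exact: DP.
have [V [Vr DV Vv IV]] := chevalley hD hI n1.
have SD : S `<=` D by move=> x Sx; rewrite -(mulr1 x); apply: lspan_mem; split=> //; apply: subring1.
have TD : T `<=` D by move=> x Tx; rewrite -(mul1r x); apply: lspan_mem; split=> //; apply: subring1.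
apply: (@model_separated V) => //.
- by move=> c; apply: DV; apply: SD; apply: model_base.
- split=> x; [by move=> /SD/DV|move=> mx; apply: IV].
  rewrite -(mulr1 x); apply: lspan_mem; split; [exact: maxid_sub|exact: subring1|by left].
- split=> x; [by move=> /TD/DV|move=> mx; apply: IV].
  rewrite -(mul1r x); apply: lspan_mem; split; [exact: subring1|exact: maxid_sub|by right].
Qed.

Definition splits S T W : set F := [set x | exists a b,
  [/\ A a, A b, cut_ideal S W a, cut_ideal T W b & x = a + b]].

Lemma splits_ideal S T W : closed_pt S -> closed_pt T -> ideal_of A (splits S T W).
Proof.
move=> cS cT; have [MS _ _] := cS; have [MT _ _] := cT; have hA := surface_subring.
have [_ S0 SD SM] := cut_ideal_ideal cS W; have [_ T0 TD TM] := cut_ideal_ideal cT W.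
have AS := model_sub MS; have AT := model_sub MT; split.
- by move=> _ [a [b [Aa Ab _ _ ->]]]; apply: subringD.
- by exists 0, 0; split; rewrite ?addr0 //; apply: subring0.
- move=> _ _ [a [b [Aa Ab Ja Jb ->]]] [a' [b' [Aa' Ab' Ja' Jb' ->]]].
  exists (a + a'), (b + b'); split; [exact: subringD|exact: subringD|exact: SD|exact: TD|].
  exact: addrACA.
- move=> c _ Ac [a [b [Aa Ab Ja Jb ->]]].
  exists (c * a), (c * b); split; [exact: subringM|exact: subringM| | |exact: mulrDr].
    by apply: SM => //; apply: AS.
  by apply: TM => //; apply: AT.
Qed.

(** Multipliers witnessing comaximality in [A] of the cut ideals at two points, again uniformly in
    [W]. *)
Definition splitter S T : set F := [set c | A c /\ forall W, splits S T W c].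

(* Multiplying by 1 = sum s t, where s or t is in a maximal ideal, repeatedly
   moves b s or b' t into its cut ideal. *)
Lemma splits_product S T W b b' d : closed_pt S -> closed_pt T -> conductor S b -> conductor T b' -> A d ->
  lspan (fun s t => [/\ A (d * s), A (d * t) & [/\ S s, T t & maxid S s \/ maxid T t]]) 1 ->
  splits S T W (d ^+ 2 * (b * b')).
Proof.
move=> cS cT [Ab hb] [Ab' hb'] Ad h1.
have [MS _ _] := cS; have [MT _ _] := cT; have hA := surface_subring.
have hS := model_subring MS; have hT := model_subring MT.
have AS := model_sub MS; have AT := model_sub MT.
have hJ := cut_ideal_ideal cS W; have hJ' := cut_ideal_ideal cT W.
have [_ S0 SD SM] := hJ; have [_ T0 TD TM] := hJ'.
have hL := splits_ideal W cS cT; have [_ L0 LD LM] := hL.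
have [i ci] := colon_one cS hJ (cut_ideal_prime cS (W := W)).
have [j cj] := colon_one cT hJ' (cut_ideal_prime cT (W := W)).
have Sb := AS _ Ab; have Tb := AT _ Ab'; have Ad2 := subringX hA 2 Ad.
have baseS s a a' : A a -> A a' -> cut_ideal S W (b * s - a) -> cut_ideal S W s ->
    splits S T W (d ^+ 2 * (a * a')).
  move=> Aa Aa' Ja Js; exists (d ^+ 2 * (a * a')), 0.
  split; [by do ?apply: subringM|exact: subring0| |by []|by rewrite addr0].
  rewrite (_ : _ * _ = d ^+ 2 * a' * a); last by ring.
  apply: (SM); first by apply: AS; apply: subringM.
  by rewrite -(subKr (b * s) a); apply: (idealB hS hJ) => //; apply: (SM).
have baseT t a a' : A a -> A a' -> cut_ideal T W (b' * t - a') -> cut_ideal T W t ->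
    splits S T W (d ^+ 2 * (a * a')).
  move=> Aa Aa' Ja Jt; exists 0, (d ^+ 2 * (a * a')).
  split; [exact: subring0|by do ?apply: subringM|by []| |by rewrite add0r].
  rewrite mulrA; apply: (TM); first by apply: AT; apply: subringM.
  by rewrite -(subKr (b' * t) a'); apply: (idealB hT hJ') => //; apply: (TM).
(* [k] and [l] measure how far [s] and [t] are from their cut ideals. Every summand of the
   decomposition of 1 lowers one of them, and at 0 the product splits trivially. *)
suff main N k l s t a a' : (k + l <= N)%N -> colon S (cut_ideal S W) k s -> colon T (cut_ideal T W) l t ->
    S s -> T t -> A a -> A a' -> cut_ideal S W (b * s - a) -> cut_ideal T W (b' * t - a') ->
    splits S T W (d ^+ 2 * (a * a')).
  apply: (main _ i j 1 1 _ _ (leqnn _)) => //; try exact: subring1.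
    by rewrite mulr1 subrr.
  by rewrite mulr1 subrr.
elim: N k l s t a a' => [|N IH] k l s t a a' kl ck cl Ss Tt Aa Aa' Ja Ja'.
  by move: kl ck; rewrite leqn0 addn_eq0 => /andP[/eqP-> _] Js; exact: (baseS s).
case: k kl ck => [_ Js|k kl ck]; first exact: (baseS s).
case: l kl cl => [_ Jt|l kl cl]; first exact: (baseT t).
suff : splits S T W (d ^+ 2 * (a * a') * 1) by rewrite mulr1.
pose Q x := splits S T W (d ^+ 2 * (a * a') * x); rewrite -/(Q 1); move: h1.
apply: lspan_sub; rewrite /Q; first by rewrite mulr0.
  by move=> x y Qx Qy; rewrite mulrDr; apply: LD.
move=> x y [Adx Ady [Sx Ty m]].
have [c Ac Jc] := hb W (x * s) (subringM hS Sx Ss).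
have [c' Ac' Jc'] := hb' W (y * t) (subringM hT Ty Tt).
have Lc : splits S T W (d ^+ 2 * (c * c')).
  case: m => m.
    apply: (IH k l.+1 (x * s) (y * t)) => //;
      [by case: ck => _; apply| |exact: subringM|exact: subringM].
    by have [_ _ _] := colon_ideal cT l.+1 hJ'; apply.
  apply: (IH k.+1 l (x * s) (y * t)) => //;
    [lia| |by case: cl => _; apply|exact: subringM|exact: subringM].
  by have [_ _ _] := colon_ideal cS k.+1 hJ; apply.
have Je : cut_ideal S W (d * x * a - d * c).
  rewrite (_ : _ - _ = d * (b * (x * s) - c) - d * x * (b * s - a)); last by ring.
  by apply: (idealB hS hJ); apply: SM => //; apply: AS.
have Je' : cut_ideal T W (d * y * a' - d * c').
  rewrite (_ : _ - _ = d * (b' * (y * t) - c') - d * y * (b' * t - a')); last by ring.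
  by apply: (idealB hT hJ'); apply: TM => //; apply: AT.
rewrite (_ : _ * _ = (d * y * a' * (d * x * a - d * c) + d * c * (d * y * a' - d * c'))
   + d ^+ 2 * (c * c')); last by ring.
have AM z z' : A z -> A z' -> A (z * z') by apply: subringM.
apply: LD => //; eexists; eexists; split; last reflexivity.
- by apply: (AM); [apply: (AM)|apply: subringB => //; apply: (AM)].
- by apply: (AM); [apply: (AM)|apply: subringB => //; apply: (AM)].
- by apply: SM => //; apply: AS; apply: (AM).
- by apply: TM => //; apply: AT; apply: (AM).
Qed.

(** If some element of [A] outside [P] is a multiple of the strict equation at [T], it lies in all
    cut ideals there and serves. Otherwise a branch P' at [T] lies over the same curve in Spec A as
    [P]; conductors at both points and common denominators can then be chosen outside both
    primes. *)
Lemma splitter_avoid S T P : closed_pt S -> closed_pt T -> S <> T ->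
  prime_of S P -> P (strict_eqn S) -> P <> maxid S -> exists2 c, splitter S T c & ~ P c.
Proof.
move=> cS cT ST hP Pf Pm; have [hq eP nmO] := prime_strict_eqn cS hP Pf Pm.
have [MS OS _] := cS; have [MT OT _] := cT; have hA := surface_subring.
have hS := model_subring MS; have hT := model_subring MT.
have AS := model_sub MS; have AT := model_sub MT.
have Tf := strict_eqn_S cT.
case: (pselect (exists c, [/\ A c, principal T (strict_eqn T) c & ~ P c])) => [[c [Ac [t Tt e] nc]]|hc].
  exists c => //; split=> // W; exists 0, c; split=> //; [exact: subring0| | |by rewrite add0r].
    by case: (cut_ideal_ideal cS W).
  by rewrite e; apply: ideal2_l.
have hI : ideal_of T (principal T (strict_eqn T)).
  split.
  - by move=> _ [t Tt ->]; apply: subringM.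
  - by exists 0; [exact: subring0|rewrite mul0r].
  - by move=> _ _ [t Tt ->] [t' Tt' ->]; exists (t + t'); [exact: subringD|rewrite mulrDl].
  - by move=> a _ Ta [t Tt ->]; exists (a * t); [exact: subringM|rewrite mulrA].
have [|||x Ix [Ax nx]|P' [hP' IP' aP']] :=
  @prime_avoiding _ T (principal T (strict_eqn T)) [set x | A x /\ ~ P x] hT hI.
- by move=> x [/AT].
- by split; [exact: subring1|exact: (prime1 hP)].
- by move=> x y [Ax nx] [Ay ny]; split; [exact: subringM|apply: (prime_nM hP) => //; apply: AS].
- by apply: hc; exists x.
have Pf' : P' (strict_eqn T) by apply: IP'; exists 1; [exact: subring1|rewrite mul1r].
have PP x : A x -> P' x -> P x by move=> Ax /aP' n; apply: contrapT => nx; apply: n.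
have Pm' : P' <> maxid T.
  move=> e; apply: nmO => x Ox; apply: PP; first exact: mO_sub.
  by rewrite e; move: Ox; rewrite -OT => -[].
have [hq' eP' _] := prime_strict_eqn cT hP' Pf' Pm'.
(* A strict inclusion would insert a further prime: 0, the two contractions and [mO] would form a
   chain of length 3. *)
have qq : P' `&` A = P `&` A.
  apply: contrapT => ne.
  have le : P' `&` A `<=` P `&` A by move=> x [Px Ax]; split=> //; apply: PP.
  have lt0 : [set 0] `<` P' `&` A.
    apply: set_lt_neq; first by move=> _ ->; apply: (prime0 hq').
    move=> e; have : (P' `&` A) f.
      split=> //; rewrite -(divfK (cycle_eqn_n0 Z cT) f) mulrC.
      by apply: (primeMl hP') => //; apply: cycle_eqn_S.
    by rewrite -e => /eqP; rewrite (negPf f_n0).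
  have lt2 : P `&` A `<` maxid S `&` A.
    apply: set_lt_neq => [x [Px Ax]|e].
      by split=> //; apply: prime_le_maxid Px => //; apply: model_local.
    by apply: nmO => x; rewrite -OS -e => -[].
  have hmO : prime_of A (maxid S `&` A).
    exact: (prime_contract hS hA AS (local_maxid_prime (model_local MS))).
  apply: surface_no_chain; eexists.
  exact: (prime_chain3 (zero_prime hA) hq' hq hmO lt0 (set_lt_neq le ne) lt2).
have nP x : A x -> ~ P' x -> ~ P x.
  move=> Ax n Px; apply: n; have : (P `&` A) x by [].
  by rewrite -qq => -[].
have [b hb nb] := conductor_avoid cS hP Pf Pm.
have [b' hb' nb'] := conductor_avoid cT hP' Pf' Pm'.
have [d [Ad nd hd]] : exists d, [/\ A d, ~ P d &
    lspan (fun s t => [/\ A (d * s), A (d * t) & [/\ S s, T t & maxid S s \/ maxid T t]]) 1].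
  elim: (separated_unit cS cT ST) => [|s t y h hy [d [Ad nd hd]]].
    by exists 1; split; [exact: subring1|exact: (prime1 hP)|exact: lspan0].
  have [Ss Tt _] := h.
  have [D [AD nD /(_ ord0) hD]] :=
    common_denominator hA hS AS hP eP (d := 1) (b := fun=> s) (fun=> Ss).
  have [D' [AD' nD' /(_ ord0) hD']] :=
    common_denominator hA hT AT hP' eP' (d := 1) (b := fun=> t) (fun=> Tt).
  exists (D * D' * d); split.
  - by apply: subringM => //; apply: subringM.
  - apply: (prime_nM hP) => //; [by apply: AS; apply: subringM|exact: AS|].
    by apply: (prime_nM hP) => //; [exact: AS|exact: AS|exact: nP].
  apply: lspanD.
    split=> //.
      rewrite (_ : _ * s = D' * d * (D * s)); last by ring.
      by apply: subringM => //; apply: subringM.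
    rewrite (_ : _ * t = D * d * (D' * t)); last by ring.
    by apply: subringM => //; apply: subringM.
  apply: lspan_mono hd => u v [Au Av h']; split=> //; rewrite -mulrA.
    by apply: subringM => //; apply: subringM.
  by apply: subringM => //; apply: subringM.
have [Ab _] := hb; have [Ab' _] := hb'.
exists (d ^+ 2 * (b * b')).
  split; first by apply: subringM; [|exact: subringX|exact: subringM].
  by move=> W; apply: splits_product.
apply: (prime_nM hP); [by apply: AS; apply: subringX|by apply: AS; apply: subringM| |].
  by apply: (prime_nX hS hP) => //; apply: AS.
by apply: (prime_nM hP) => //; [exact: AS|exact: AS|exact: nP].
Qed.

Definition cut_all (L : seq (set F)) W : set F := [set a | A a /\ forall S, S \in L -> cut_ideal S W a].

Lemma cut_all_ideal (L : seq (set F)) W : (forall S, S \in L -> closed_pt S) ->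
  ideal_of A (cut_all L W).
Proof.
have hA := surface_subring; move=> hL.
have hJ S : S \in L -> ideal_of S (cut_ideal S W) by move=> /hL cS; apply: cut_ideal_ideal.
split=> [a []//|||].
- by split=> [|S /hJ[_ ? _ _]//]; exact: subring0.
- move=> a b [Aa ha] [Ab hb]; split=> [|S SL]; first exact: subringD.
  by case: (hJ S SL) => _ _ h _; apply: h; [apply: ha|apply: hb].
- move=> c a Ac [Aa ha]; split=> [|S SL]; first exact: subringM.
  case: (hJ S SL) => _ _ _ h; apply: h; last exact: ha.
  by have [MS _ _] := hL S SL; apply: (model_sub MS).
Qed.

(** Points are added one at a time. Functions in the cut ideals at the old points fill, modulo the
    cut ideal at the new point, at least an ideal of finite colength independent of [W]; that
    colength is the loss. *)
Lemma indep_cut_all (L : seq (set F)) : uniq L -> (forall S, S \in L -> closed_pt S) ->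
  exists c, forall W, indep iota A (cut_all L W) (\sum_(S <- L) local_colength S W - c)%N.
Proof.
have hA := surface_subring.
have AK : forall a, A (iota a) by case: surface_subalgebra.
elim: L => [|S L IH] /= => [_ _|/andP[SL uL] hL].
  by exists 0%N => W; rewrite big_nil; apply: indep0.
have hL' T : T \in L -> closed_pt T by move=> TL; apply: hL; rewrite inE TL orbT.
have cS : closed_pt S by apply: hL; rewrite mem_head.
have [c hc] := IH uL hL'; have [MS _ _] := cS; have hS := model_subring MS.
have AS := model_sub MS; have SK := model_base MS.
(* The multiplier [r] makes this an ideal of [S], and quantifying over [W] inside makes its colength
   a constant. *)
pose a0 := [set s | S s /\ forall r W, S r -> exists2 y, cut_all L W y & cut_ideal S W (r * s - y)].
have ha0 : ideal_of S a0.
  split=> [s []//|||].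
  - split=> [|r W _]; first exact: subring0.
    exists 0; first by case: (cut_all_ideal W hL').
    by rewrite mulr0 subr0; case: (cut_ideal_ideal cS W).
  - move=> s t [Ss hs] [St ht]; split=> [|r W Sr]; first exact: subringD.
    have [y Yy Jy] := hs r W Sr; have [z Yz Jz] := ht r W Sr.
    exists (y + z); first by case: (cut_all_ideal W hL') => _ _ h _; apply: h.
    rewrite mulrDr opprD addrACA.
    by case: (cut_ideal_ideal cS W) => _ _ h _; apply: h.
  - move=> x s Sx [Ss hs]; split=> [|r W Sr]; first exact: subringM.
    by rewrite mulrA; apply: hs; apply: subringM.
have [|[d hd] _] := cofinite cS ha0.
  move=> P hP aP; apply: contrapT => Pm.
  have Pf : P (strict_eqn S).
    apply: aP; split=> [|r W Sr]; first exact: strict_eqn_S.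
    exists 0; first by case: (cut_all_ideal W hL').
    by rewrite subr0; apply: ideal2_l.
  have [b [Ab hb] nb] := conductor_avoid cS hP Pf Pm.
  (* A product of splitters, one for each old point: at [S] it is congruent to a function that lies
     in all the other cut ideals. *)
  have [x [Ax nx hx]] : exists x, [/\ A x, ~ P x & forall W, exists2 y, cut_all L W y & cut_ideal S W (x - y)].
    elim: (L) SL hL' {hc ha0 aP a0} => [|T L' IHL] /= SL hL'.
      exists 1; split; [exact: subring1|exact: (prime1 hP)|move=> W].
      exists 1; first by split=> //; exact: subring1.
      by rewrite subrr; case: (cut_ideal_ideal cS W).
    have cT : closed_pt T by apply: hL'; rewrite mem_head.
    move: SL; rewrite inE negb_or => /andP[/eqP ST SL].
    have [x [Ax nx hx]] :=
      IHL SL (fun T' (TL : T' \in L') => hL' T' (mem_behead (s := T :: L') TL)).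
    have [z [Az hz] nz] := splitter_avoid cS cT ST hP Pf Pm.
    exists (z * x); split; [exact: subringM|by apply: (prime_nM hP) => //; apply: AS|move=> W].
    have [y Yy Jy] := hx W; have [s [t [As At Js Jt ez]]] := hz W.
    have [Ay hy] := Yy; have [MT _ _] := cT.
    have [_ _ TD TM] := cut_ideal_ideal cT W; have [_ _ SD SM] := cut_ideal_ideal cS W.
    exists (t * y).
      split=> [|T']; first exact: subringM.
      rewrite inE => /orP[/eqP->|T'L].
        by rewrite mulrC; apply: TM => //; apply: (model_sub MT).
      have cT' : closed_pt T' by apply: hL'; rewrite inE T'L orbT.
      have [_ _ _ h] := cut_ideal_ideal cT' W; apply: h; last exact: hy.
      by have [MT' _ _] := cT'; apply: (model_sub MT').
    rewrite (_ : _ - _ = x * s + t * (x - y)); last by rewrite ez; ring.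
    by apply: SD; apply: SM => //; apply: AS.
  have : ~ P (x * b) by apply: (prime_nM hP) => //; apply: AS.
  apply; apply: aP; split=> [|r W Sr]; first by apply: AS; apply: subringM.
  have [y Yy Jy] := hx W; have [a Aa Ja] := hb W r Sr.
  have [_ _ SD SM] := cut_ideal_ideal cS W; have [_ _ _ YM] := cut_all_ideal W hL'.
  exists (a * y); first exact: YM.
  rewrite (_ : _ - _ = x * (b * r - a) + a * (x - y)); last by ring.
  by apply: SD; apply: SM => //; apply: AS.
exists (c + d)%N => W; rewrite big_cons.
have hY := ideal_ksub hA AK (cut_all_ideal W hL').
have hJ := ideal_ksub hS SK (cut_ideal_ideal cS W).
apply: (@indep_le _ _ _ _ _ ((\sum_(T <- L) local_colength T W - c) + (local_colength S W - d))); first lia.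
apply: (@indep_trans _ _ _ _ (cut_all L W)) => //.
- by case: (cut_all_ideal W hL').
- by move=> a [Aa ha]; split=> // T TL; apply: ha; rewrite inE TL orbT.
have h := indep_spans (ideal_ksub hS SK ha0) (indep_cut_ideal cS W) hd.
have h2 : indep iota (cut_all L W) (cut_ideal S W) (local_colength S W - d).
  apply: (indep_rep hJ _ h) => s [Ss /(_ 1 W (subring1 hS))].
  by rewrite mul1r.
apply: indep_sub h2 => // a [Aa ha]; apply: ha; exact: mem_head.
Qed.

Lemma bad_points : exists L : seq (set F), [/\ uniq L, forall S, S \in L -> closed_pt S &
  forall S v, points_on M (E v) S -> strict_ord v Z f S != 0 -> S \in L].
Proof.
have hv v : exists l : seq (set F),
      forall S, (points_on M (E v) S /\ strict_ord v Z f S != 0) <-> S \in l.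
  have [_ _ hd _] := strict_transform_degree Af f_ge (f_lt (v := v)).
  by have /finite_seqP[l el] := hd; exists l => S; have := congr1 (@^~ S) el => /= ->.
pose l v := xget [::] [set l : seq (set F) |
    forall S, (points_on M (E v) S /\ strict_ord v Z f S != 0) <-> S \in l].
have hl v S : (points_on M (E v) S /\ strict_ord v Z f S != 0) <-> S \in l v.
  by have [w hw] := hv v; rewrite /l; case: xgetP => [y _ //|/(_ w)].
exists (undup (flatten [seq l v | v <- enum G])); split; first exact: undup_uniq.
  move=> S; rewrite mem_undup => /flatten_mapP[v _ /hl[hS _]].
  exact: (points_closed (excE v) hS).
move=> S v hS ne; rewrite mem_undup; apply/flatten_mapP; exists v; first by rewrite mem_enum.
by apply/hl.
Qed.

Lemma sum_strict_mult (L : seq (set F)) v : uniq L -> (forall S, S \in L -> closed_pt S) ->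
  (forall S, points_on M (E v) S -> strict_ord v Z f S != 0 -> S \in L) ->
  (\sum_(S <- L) strict_mult S v)%N%:Z = - wdot Z v.
Proof.
move=> uL hL mL.
have [_ h0 _ <-] := strict_transform_degree Af f_ge (f_lt (v := v)).
have r := @fsbigE _ _ (GRing.add : Monoid.com_law (0 : int)) _ (points_on M (E v))
  [seq S <- L | `[< points_on M (E v) S >]] (strict_ord v Z f).
rewrite /divisor_degree r.
- rewrite [RHS]big_filter_cond [RHS]big_mkcond /= (big_morph Posz PoszD (erefl : Posz 0 = 0)).
  apply: eq_big_seq => S SL; rewrite /strict_mult; case: asboolP => [hS|local_colength] /=.
    case: pselect => [_|/(_ _)[]] /=; last by case: hS.
    by rewrite (mem_set hS) gez0_abs //; apply: h0.
  case: pselect => // SE; case: local_colength; apply: closed_points => //; exact: hL.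
- exact: filter_uniq.
- by move=> S /=; rewrite mem_filter => /andP[/asboolP].
- move=> S hS; rewrite mem_filter => nin; apply/eqP; apply: contraT => /(mL _ hS) SL.
  by move: nin; rewrite SL andbT => /asboolP.
Qed.

(* Multiplication by f embeds A/I((k-1)Z) in A/I(kZ), and the cokernel
   A/(I(kZ) + fA) maps to the product of the local rings of the strict transform
   of f = 0 truncated by kZ, with image of bounded codimension. *)
Lemma lower_bound : exists c, forall m, exists2 h, indep iota A (cycle_ideal (fun j => (m * Z j)%N)) h &
  m%:Z ^+ 2 * cycle_form Z <= 2%:Z * h%:Z + 2%:Z * c%:Z * m%:Z.
Proof.
have hA := surface_subring.
have AK : forall a, A (iota a) by case: surface_subalgebra.
have [L [uL hL mL]] := bad_points; have [c hc] := indep_cut_all uL hL.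
pose kZ (k : nat) : G -> nat := fun j => (k * Z j)%N.
pose q := (\sum_v Z v * \sum_(S <- L) strict_mult S v)%N.
have eq_q : cycle_form Z = q%:Z.
  rewrite /cycle_form /q (big_morph Posz PoszD (erefl : Posz 0 = 0)) -sumrN.
  apply: eq_bigr => v _; rewrite PoszM (sum_strict_mult uL hL) ?mulrN // => S; exact: mL.
have eq_n k : (\sum_(S <- L) local_colength S (kZ k) = k * q)%N.
  rewrite /local_colength exchange_big /= /q big_distrr; apply: eq_bigr => v _ /=.
  by rewrite /kZ -big_distrr /= mulnA.
have step k (h : nat) : indep iota A (cycle_ideal (kZ k)) h ->
    indep iota A (cycle_ideal (kZ k.+1)) ((k.+1 * q - c) + h).
  move=> hk; have hY := cut_all_ideal (kZ k.+1) hL.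
  have in_Y x : cycle_ideal (kZ k.+1) x -> cut_all L (kZ k.+1) x.
    move=> [Ax hx]; split=> // S SL; have cS := hL S SL; have [MS _ _] := cS.
    rewrite -(divfK (cycle_eqn_n0 (kZ k.+1) cS) x); apply: ideal2_r; first exact: model_subring.
    by apply: div_cycle_eqn => //; apply: (model_sub MS).
  apply: (@indep_trans _ _ _ _ (cut_all L (kZ k.+1))) => //.
  - by case: hY.
  - exact: (ideal_ksub hA AK hY).
  - by have := hc (kZ k.+1); rewrite eq_n.
  apply: (@indep_mul _ _ _ _ (cycle_ideal (kZ k)) _ _ _ f) hk.
  - exact: subalg_ksub.
  - move=> x Ax; split=> [|S SL]; first exact: subringM.
    have cS := hL S SL; have [MS _ _] := cS; have hS := model_subring MS.
    have -> : f * x = x * cycle_eqn S Z * strict_eqn S.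
      by rewrite mulrC -mulrA; congr (_ * _); rewrite mulrC divfK //; apply: cycle_eqn_n0.
    apply: ideal2_l => //; apply: subringM => //; [exact: (model_sub MS)|exact: cycle_eqn_S].
  - move=> x Ax [_ hx]; split=> // v; apply: (@vge_cancel v _ (Z v) f) => //.
exists c; elim=> [|m [h IH hm]].
  by exists 0%N; [exact: indep0|rewrite expr0n /= mul0r].
(* With q = -Z.Z the main term grows by at most 2 (m + 1) q per step, and truncated subtraction
   loses at most [c]. *)
exists ((m.+1 * q - c) + h)%N; first exact: step.
rewrite eq_q in hm *; rewrite PoszD.
have : (m.+1 * q)%N%:Z <= (m.+1 * q - c)%N%:Z + c%:Z by lia.
move: hm; set a := (m.+1 * q - c)%N; rewrite PoszM => hm ha.
rewrite -addn1 PoszD in ha *; nia.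
Qed.

End LowerBound.

(** * Arcs and orders of vanishing *)

Lemma points_nonempty v : selfint v != 0 -> exists S, points_on M (E v) S.
Proof.
move=> s0; apply: contrapT => hn; move/negP: s0; apply; apply/eqP.
case: hE => _ _ /(_ v)[f [n [_ _ _ ->]]] _; rewrite /divisor_degree fsbig1 ?oppr0 // => S hS.
by case: hn; exists S.
Qed.

Section Avoid.
Variables (R S1 : set F) (hR : exc R) (hS1 : points_on M R S1).
Let hRr := exc_subring hR.
Let hRp := exc_prime hR.
Local Notation c := (coord R S1).
Local Notation k0 := (base_field iota).

Lemma iota_maxid V (a : K) : local_ring V -> (forall b, V (iota b)) -> maxid V (iota a) -> a = 0.
Proof.
move=> hV VK ma; apply/eqP; apply: contrapT => /negP a0; move: ma.
by apply: unit_nmaxid; rewrite ?fmorph_eq0 // -fmorphV.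
Qed.

Lemma coord_nconst (a : K) : ~ maxid R (c - iota a).
Proof.
move=> ma; have [MS SR _] := hS1; have hSl := model_local MS.
have my := coord_maxid hR hS1; have Sy := coord_in hR hS1.
have : maxid S1 (c - iota a).
  apply: points_component_in ma => //.
  by apply: subringB => //; [exact: model_subring|exact: model_base].
have [hSr hm] := hSl => mS; have : maxid S1 (iota a).
  by rewrite -(subKr c (iota a)); apply: (idealB hSr hm).
move/(iota_maxid hSl (model_base MS)) => a0; apply: (coord_nmaxid hR hS1).
by move: ma; rewrite a0 rmorph0 subr0.
Qed.

(** The constant is the value at [T] of the restriction of the coordinate. If that restriction has a
    pole at [T], no such valuation ring exists and the witness 0 is arbitrary. *)
Lemma coord_value T : points_on M R T -> exists b : K, forall V (a : K), val_ring V ->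
  (forall e : K, V (iota e)) -> maxid R `<=` maxid V -> dominates V T ->
  maxid V (c - iota a) -> a = b.
Proof.
move=> hT; have [MT TR dT] := hT; have hTl := model_local MT.
have Rc : R c by case: hS1 => _ SR _; apply: SR; apply: coord_in.
have nc := coord_nmaxid hR hS1.
have [n hn] := curve_ord_ex hR hT Rc nc.
case: (leP 0 n) => n0.
  have [u [Tu nu hc]] := (curve_ordP hR hT _ _).1 hn.
  move: hn hc n0; case: n => [n|//] hn hc _; rewrite -exprnP in hc.
  have Tu' : T (u * coord R T ^+ n).
    by apply: subringM; [exact: model_subring| |apply: subringX; [exact: model_subring|exact: coord_in]].
  have [b mb] := residue_constant surface_affine surface_no_chain hTl (model_subalgebra MT) dT Tu'.
  exists b => V a hV VK RV [_ TV] ma; have [hVr hVm] := val_local hV.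
  apply/eqP; rewrite eq_sym -subr_eq0; apply/eqP; apply: (iota_maxid (conj hVr hVm) VK).
  have -> : iota (b - a) = (c - iota a) - ((c - u * coord R T ^+ n) + (u * coord R T ^+ n - iota b)).
    by rewrite rmorphB; ring.
  have [_ _ hD _] := hVm; apply: (idealB hVr hVm) => //.
  by apply: hD; [apply: RV|apply: TV].
exists 0 => V a hV VK RV [_ TV] ma; have [hVr hVm] := val_local hV.
have [|s ms hs] := curve_ord_gt0 hR hT (curve_ordV hR hT hn); first by rewrite oppr_gt0.
have Vc : V c.
  by rewrite -(subrK (iota a) c); apply: subringD => //; exact: maxid_sub ma.
have mV : maxid V c^-1.
  rewrite -(subrK s c^-1); have [_ _ hD _] := hVm; apply: hD; [exact: RV|exact: TV].
have [_ [c0|nc']] := mV; last by case: nc'; rewrite invrK.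
by case: nc; rewrite -(invrK c) c0 invr0; apply: (prime0 hRp).
Qed.

(* The new point is the center of a valuation ring in R which specializes a
   nonconstant function to a general constant. *)
Lemma points_avoid (L : seq (set F)) : exists2 S, points_on M R S & S \notin L.
Proof.
have [MS SR dS] := hS1; have hRl := exc_local hR; have MR := exc_M hR.
have hk0 := base_subfield iota; have k0R := base_sub (model_subalgebra MR).
have [tc cR] : transc k0 c /\ adj k0 c `<=` R.
  apply: transc_mod_maxid => //; first by apply: SR; apply: coord_in.
  move=> p hp p0 mp; have [r hr] := root_residue hp p0.
  have [|a _] := hr R c hRl (model_subalgebra MR) _ mp; last exact: coord_nconst.
  by apply: SR; apply: coord_in.
pose b T : K := xget 0 [set b | forall V (a : K), val_ring V ->
  (forall e : K, V (iota e)) -> maxid R `<=` maxid V -> dominates V T ->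
    maxid V (c - iota a) -> a = b].
have hb T : points_on M R T -> forall V (a : K), val_ring V ->
  (forall e : K, V (iota e)) -> maxid R `<=` maxid V -> dominates V T ->
    maxid V (c - iota a) -> a = b T.
  by move=> /coord_value[w hw]; rewrite /b; case: xgetP => [y _ //|/(_ w)].
(* The forbidden constants are the values at the points of [L], so the center of the new valuation
   ring cannot be one of them. *)
have [||a ab [V [hV [VR RV] k0V ma _]]] :=
  @specialize _ _ iota (map b L) R k0 c [::] (exc_val hR) hk0 _ cR tc.
- by move=> x; exists x.
- by [].
have VK (x : K) : V (iota x) by apply: k0V; exists x.
(* An element of [A] is a constant plus an element of [mO], and [mO] lies in the maximal ideal of
   [R], hence in that of [V]. *)
have AV : A `<=` V.
  move=> x Ax; have Sx := model_sub MS Ax.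
  have [e me] :=
    residue_constant surface_affine surface_no_chain (model_local MS) (model_subalgebra MS) dS Sx.
  rewrite -(subrK (iota e) x); apply: subringD => //; first by case: hV.
  apply: maxid_sub; apply: RV.
  have : (maxid S1 `&` A) (x - iota e).
    split=> //; apply: subringB => //; first exact: surface_subring.
    by case: surface_subalgebra.
  by rewrite (exc_over_sub hR MS SR) -(exc_over hR) => -[].
have [[_ _ proper _ _] _] := hM.
have [|S MS' [SV mSV]] := proper V _ AV.
  by split; [split=> //|]; case: hV.
have SR' : S `<=` R by move=> x /SV/VR.
have [eS|hS] := exc_sub_cases hR MS' SR'.
  case: (@coord_nconst a); have eV : V = R by apply/seteqP; split=> // x; rewrite -eS => /SV.
  by rewrite -[X in maxid X]eV.
exists S => //; apply/negP => SL; move/negP: ab; apply.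
by rewrite (hb S hS V a) //; apply: map_f.
Qed.

End Avoid.

(** * Arcs transversal to a component *)

Section PowerSeries.
Variables (R S : set F) (hR : exc R) (hS : points_on M R S).
Let MS : M S. Proof. by case: hS. Qed.
Let SR : S `<=` R. Proof. by case: hS. Qed.
Let dS : krull_dim S 2. Proof. by case: hS. Qed.
Let hSl := model_local MS.
Let hSr := model_subring MS.
Let hcp := component_prime hR hS.
Let SK : forall a, S (iota a) := model_base MS.
Local Notation X := (eqn S R).
Local Notation y := (coord R S).
Local Notation Y := (principal S y).
Local Notation ev p := ((map_poly iota p).[X]).

Lemma coord_ideal : ideal_of S Y.
Proof.
have Sy := coord_in hR hS; split.
- by move=> _ [a Sa ->]; apply: subringM.
- by exists 0; [exact: subring0|rewrite mul0r].
- by move=> _ _ [a Sa ->] [b Sb ->]; exists (a + b); [exact: subringD|rewrite mulrDl].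
- by move=> a _ Sa [b Sb ->]; exists (a * b); [exact: subringM|rewrite mulrA].
Qed.

Let YD : forall x z, Y x -> Y z -> Y (x + z). Proof. by case: coord_ideal. Qed.
Let YM : forall a x, S a -> Y x -> Y (a * x). Proof. by case: coord_ideal. Qed.
Let SX : S X := eqn_in hR hS.

Lemma ev_in (p : {poly K}) : S (ev p).
Proof. by apply: subring_horner => // i; rewrite coef_map; apply: SK. Qed.

(** A Taylor expansion of [s] to order [n] along the curve germ y = 0, which is transversal to the
    component and has the equation [X] of the component as parameter. The resulting arc sends [X] to
    t and [y] to 0. *)
Definition approx s (n : nat) (p : {poly K}) := exists2 a, S a & Y (s - ev p - X ^+ n * a).

Lemma approx_ex s n : S s -> exists p : {poly K}, approx s n p.
Proof.
elim: n s => [|n IH] s Ss.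
  exists 0, s => //; rewrite rmorph0 horner0 subr0 expr0 mul1r subrr.
  by case: coord_ideal.
have [c mc] := residue_constant surface_affine surface_no_chain hSl (model_subalgebra MS) dS Ss.
have [_ em _] := coordP hR hS; move: mc; rewrite em => -[a [b [Sa Sb e]]].
have [p [r Sr h]] := IH a Sa; exists (p * 'X + c%:P), r => //.
rewrite rmorphD rmorphM /= map_polyX map_polyC hornerD hornerM hornerX hornerC.
have -> : s - (ev p * X + iota c) - X ^+ n.+1 * r = X * (a - ev p - X ^+ n * r) + b * y.
  by rewrite -(subrK (iota c) s) e exprS; ring.
by apply: YD; [exact: YM|exists b].
Qed.

(** [X] can be cancelled modulo [y], because the component ideal is prime and does not contain [y];
    hence [poly_low] applies to p - q. *)
Lemma approx_uniq s n (p q : {poly K}) : approx s n p -> approx s n q ->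
  forall i : nat, (i < n)%N -> p`_i = q`_i.
Proof.
move=> [a Sa ha] [b Sb hb] i hi; apply/eqP; rewrite -subr_eq0 -coefB.
have SY : Y `<=` maxid S.
  move=> _ [x Sx ->]; have [_ [_ _ _ h]] := hSl; apply: h => //.
  exact: (coord_maxid hR hS).
have mX : maxid S X by have := prime_le_maxid hSl hcp; apply; exact: (cp_eqn hR hS).
apply/eqP; apply: (poly_low hSl SK coord_ideal SY mX _ (subringB hSr Sb Sa) (n := n)) => //.
  move=> z Sz [x Sx e].
  have cx : component_ideal R S x.
    have : component_ideal R S (x * y).
      by rewrite -e mulrC; apply: (primeMl hcp) => //; apply: cp_eqn.
    by case: hcp => _ _ h /(h _ _ Sx (coord_in hR hS))[//|/(coord_ncp hR hS)].
  have [w Sw ex] := (cpP hR hS x).1 cx; exists w => //.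
  by apply: (mulfI (eqn_n0 hR hS)); rewrite e ex; ring.
have -> : ev (p - q) - X ^+ n * (b - a) = (s - ev q - X ^+ n * b) - (s - ev p - X ^+ n * a).
  by rewrite rmorphB hornerD hornerN; ring.
exact: (idealB hSr coord_ideal).
Qed.

Lemma approx_le s m n (p : {poly K}) : (m <= n)%N -> approx s n p -> approx s m p.
Proof.
move=> mn [a Sa h]; exists (X ^+ (n - m) * a); first by apply: subringM => //; apply: subringX.
by rewrite mulrA -exprD subnKC.
Qed.

Lemma approxD s t n (p q : {poly K}) : approx s n p -> approx t n q -> approx (s + t) n (p + q).
Proof.
move=> [a Sa ha] [b Sb hb]; exists (a + b); first exact: subringD.
rewrite rmorphD hornerD; have := YD ha hb; congr (Y _); ring.
Qed.

Lemma approxM s t n (p q : {poly K}) : S s -> approx s n p -> approx t n q -> approx (s * t) n (p * q).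
Proof.
move=> Ss [a Sa ha] [b Sb hb]; exists (s * b + ev q * a).
  by apply: subringD => //; apply: subringM => //; apply: ev_in.
rewrite rmorphM hornerM.
have := YD (YM Ss hb) (YM (ev_in q) ha); congr (Y _); ring.
Qed.

Lemma approxC (c : K) n : approx (iota c) n c%:P.
Proof.
exists 0; first exact: subring0.
by rewrite map_polyC hornerC mulr0 subrr subr0; case: coord_ideal.
Qed.

Definition series s (n : nat) : K := xget 0 [set c | exists2 p : {poly K}, approx s n.+1 p & c = p`_n].

Lemma seriesE s n (p : {poly K}) : approx s n p -> forall i : nat, (i < n)%N -> series s i = p`_i.
Proof.
move=> h i hi; rewrite /series; case: xgetP => [c _ [q hq ->]|/(_ p`_i)].
  by apply: approx_uniq hq _ _ _ => //; apply: approx_le h.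
by case; exists p => //; apply: approx_le h.
Qed.

Lemma series_morphism : fps_morphism_on S series.
Proof.
split.
- by move=> n; rewrite (seriesE (n := n.+1) (p := 1)) ?coef1 // -(rmorph1 iota); apply: approxC.
- move=> x z Sx Sz n.
  have [p hp] := approx_ex n.+1 Sx; have [q hq] := approx_ex n.+1 Sz.
  by rewrite (seriesE (approxD hp hq)) // (seriesE hp) // (seriesE hq) // coefD.
- move=> x z Sx Sz n.
  have [p hp] := approx_ex n.+1 Sx; have [q hq] := approx_ex n.+1 Sz.
  rewrite (seriesE (approxM Sx hp hq)) // coefM; apply: eq_bigr => i _.
  by rewrite (seriesE hp) // (seriesE hq) // ltnS leq_subr.
Qed.

Lemma series_const (c : K) n : series (iota c) n = if n == 0%N then c else 0.
Proof. by rewrite (seriesE (approxC c n.+1)) // coefC. Qed.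

Lemma maxid_series s : S s -> maxid S s <-> series s 0%N = 0.
Proof.
move=> Ss; have [p hp] := approx_ex 1 Ss; rewrite (seriesE hp) //.
have [_ hm] := hSl; have [a Sa [b Sb e]] := hp.
have mX : maxid S X by have := prime_le_maxid hSl hcp; apply; exact: (cp_eqn hR hS).
have my : maxid S y by exact: (coord_maxid hR hS).
have hc : maxid S (s - iota p`_0).
  have -> : s - iota p`_0 = (ev p - ev (p`_0)%:P) + a * X + b * y.
    by rewrite -e expr1 map_polyC hornerC; ring.
  have [_ _ hD hM'] := hm; apply: (hD); last exact: hM'.
  apply: (hD); last exact: hM'.
  have -> : (map_poly iota (p`_0)%:P).[X] = (map_poly iota p).[0].
    by rewrite map_polyC hornerC horner_coef0 coef_map.
  apply: (ideal_horner_sub hSr hm) => //;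
    [by move=> i; rewrite coef_map; apply: SK|exact: subring0|by rewrite subr0].
split=> [ms|p0]; last by move: hc; rewrite p0 rmorph0 subr0.
apply: (iota_maxid hSl SK); rewrite -(subKr s (iota _)).
exact: (idealB hSr hm).
Qed.

Lemma series_eqnX s k : S s -> series (X ^+ k * s) k = series s 0%N.
Proof.
move=> Ss; have [p [a Sa h]] := approx_ex 1 Ss.
rewrite (@seriesE _ k.+1 ('X^k * p)) // ?coefXnM ?ltnn ?subnn.
  by rewrite (@seriesE _ 1 p) //; exists a.
exists a => //; rewrite rmorphM /= map_polyXn hornerM hornerXn.
have -> : X ^+ k * s - X ^+ k * ev p - X ^+ k.+1 * a = X ^+ k * (s - ev p - X ^+ 1 * a).
  by rewrite expr1 exprS; ring.
by apply: YM => //; apply: subringX.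
Qed.

End PowerSeries.

Lemma fps_order S (C : comNzRingType) (g : F -> nat -> C) a b x y : fps_morphism_on S g ->
  S x -> S y -> (forall n : nat, (n < a)%N -> g x n = 0) -> (forall n : nat, (n < b)%N -> g y n = 0) ->
  forall n : nat, (n < a + b)%N -> g (x * y) n = 0.
Proof.
move=> [_ _ gM] Sx Sy hx hy n hn; rewrite gM // big1 // => i _.
case: (ltnP i a) => hi; first by rewrite hx ?mul0r.
by rewrite hy ?mulr0 //; have := ltn_ord i; lia.
Qed.

Lemma fps_orderX S (C : comNzRingType) (g : F -> nat -> C) x k : subring S -> fps_morphism_on S g ->
  S x -> g x 0%N = 0 -> forall n : nat, (n < k)%N -> g (x ^+ k) n = 0.
Proof.
move=> hS hg Sx gx; elim: k => [|k IH] // n hn; rewrite exprS.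
apply: (@fps_order S C g 1 k) => //; first exact: subringX.
by case.
Qed.

Lemma vge_bounded v h : A h -> h != 0 -> exists2 k, vge (E v) k h & ~ vge (E v) k.+1 h.
Proof.
move=> Ah h0; have hR := excE v; have Eh := model_sub (exc_M hR) Ah.
have [k [w [Ew nw e]]] := exc_decomp hR Eh h0.
have u0 := unif_n0 hR; exists k.
  by rewrite /vge e mulrC mulKf // expf_neq0.
move=> hk; apply: nw; have h1 : E v (h / unif (E v) ^+ k) by rewrite e mulrC mulKf // expf_neq0.
by have := (vgeS_maxid hR h1).1 hk; rewrite {1}e mulrC mulKf // expf_neq0.
Qed.

Section Arcs.
Variables (B : comAlgType K) (U : F -> nat -> B) (hU : represents_arcs iota A mO U).

Lemma arcs_through_order v (p : set B) h k : arcs_through A mO U M (E v) p ->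
  A h -> vge (E v) k h -> forall n : nat, (n < k)%N -> p (U h n).
Proof.
move=> [_ [L [r [[rp _] _ [S [g [[MS SE] hg gm gr]]]]]]] Ah hk n hn.
have hR := excE v; have hS := model_subring MS; have Sh := model_sub MS Ah.
apply/rp; rewrite -gr //.
have [x [s [mx Ss ->]]] : exists x s, [/\ maxid S x, S s & h = x ^+ k * s].
  (* The lifted closed point may also be the generic point of E_v; then a uniformizer replaces the
     local equation. *)
  have [eS|hS'] := exc_sub_cases hR MS SE.
    exists (unif (E v)), (h / unif (E v) ^+ k); rewrite eS.
    split; [exact: maxid_unif|exact: hk|rewrite mulrC divfK //].
    by rewrite expf_neq0 //; apply: unif_n0.
  exists (eqn S (E v)), (h / eqn S (E v) ^+ k); split.
  - by apply: (prime_le_maxid (model_local MS) (component_prime hR hS')); apply: cp_eqn.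
  - exact: div_eqn.
  - by rewrite mulrC divfK // expf_neq0 //; apply: eqn_n0.
have Sx := maxid_sub mx.
apply: (@fps_order S L g k 0) => //; last by rewrite addn0.
  exact: subringX.
exact: (fps_orderX hS hg Sx (gm x mx)).
Qed.

Lemma series_arc v S : points_on M (E v) S ->
  @Defs.arc K F iota A mO K^o (series (E v) S).
Proof.
move=> hS; have hR := excE v; have [MS SE dS] := hS.
have [g1 gD gM] := series_morphism hR hS; have AS := model_sub MS.
split.
- split; [exact: g1| |] => x y Ax Ay n;
  [exact: gD (AS _ Ax) (AS _ Ay) n|exact: gM (AS _ Ax) (AS _ Ay) n].
- move=> c n; rewrite (series_const hR hS); case: eqP => // _.
  by rewrite /GRing.scale /= mulr1.
- move=> a Oa; apply/(maxid_series hR hS); first exact/AS/mO_sub.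
  by have [_ OS _] := points_closed hR hS; move: Oa; rewrite -OS => -[].
Qed.

(** Away from finitely many points of E_v, [h] is a unit times the k-th power of the local equation,
    so a transversal arc there has nonzero k-th coefficient. This arc is a K-point of the arc space,
    with residue field K. *)
Lemma arc_of_order v h k : mO h -> vge (E v) k h -> ~ vge (E v) k.+1 h ->
  (exists S, points_on M (E v) S) ->
  exists2 p, arcs_through A mO U M (E v) p & ~ p (U h k).
Proof.
move=> Oh hk hk1 [S1 hS1]; have hR := excE v; have Ah := mO_sub Oh.
(* Only E_v is divided out, so the finite set to avoid also contains the crossings with other
   components along which [h] vanishes. *)
pose W : G -> nat := fun j => (k * (j == v))%N.
have [ho h0 hd _] : [/\ forall S, points_on M (E v) S -> curve_ord (E v) S (h / cycle_eqn S W) (strict_ord v W h S),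
      forall S, points_on M (E v) S -> 0 <= strict_ord v W h S,
      divisor_on M (E v) (strict_ord v W h) &
      divisor_degree M (E v) (strict_ord v W h) = - wdot W v].
  apply: strict_transform_degree => //; last by rewrite /W eqxx muln1.
  move=> j; rewrite /W; case: eqP => [->|_]; first by rewrite muln1.
  by rewrite muln0 /vge expr0 divr1; exact: (model_sub (exc_M (excE j)) Ah).
move/finite_seqP: hd => [L eL].
have [S hS local_colength] := points_avoid hR hS1 L.
have a0 : strict_ord v W h S = 0.
  apply/eqP; apply: contraT => ne; move/negP: local_colength; case.
  by have : [set` L] S by rewrite -eL.
have [MS SE dS] := hS; have cS := points_closed hR hS.
have AS := model_sub MS; have hSl := model_local MS.
set x := eqn S (E v); pose w := h / x ^+ k.
have ez : cycle_eqn S W = x ^+ k.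
  rewrite /cycle_eqn (bigD1 v) //= big1 => [|j jv]; last by rewrite /W (negPf jv) muln0 expr0.
  by rewrite /W eqxx muln1 mulr1 (comp_eqn_in SE).
have Sw : S w by apply: div_eqn => //; apply: AS.
have hw : curve_ord (E v) S w 0 by have := ho S hS; rewrite a0 ez.
have nw := curve_ord0_unit hR hS Sw hw.
have eh : h = x ^+ k * w by rewrite mulrC divfK // expf_neq0 //; apply: eqn_n0.
have [r hr rA] : exists2 r : {rmorphism B -> K},
    forall a n, A a -> series (E v) S a n = r (U a n) & forall z : K, r (z *: 1) = z.
  have [r hr _] := hU.2 _ _ (series_arc hS); exists r => // z.
  by have := linearZ_LR r z 1; rewrite rmorph1 => e; rewrite [LHS]e /GRing.scale /= mulr1.
have gh : r (U h k) <> 0.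
  rewrite -hr // eh => e0; apply: nw; apply/(maxid_series hR hS) => //.
  by rewrite -(series_eqnX hR hS k Sw).
exists [set b | r b = 0] => //; split.
  split; first split.
  - by [].
  - exact: rmorph0.
  - by move=> b c; rewrite /= rmorphD => -> ->; rewrite addr0.
  - by move=> b c _; rewrite /= rmorphM => ->; rewrite mulr0.
  - by move=> /=; rewrite rmorph1; apply/eqP/oner_neq0.
  - move=> b c _ _ /=; rewrite rmorphM => /eqP.
    by rewrite mulf_eq0 => /orP[/eqP|/eqP]; [left|right].
exists (K : fieldType), r; split.
- by split=> // z; exists (z *: 1), 1; rewrite rmorph1 divr1 rA.
- by exists h, k.
- exists S, (series (E v) S); split=> //.
  + exact: series_morphism.
  + by move=> z mz; apply/(maxid_series hR hS) => //; apply: maxid_sub.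
Qed.

Lemma adjacency_order u v : (exists S, points_on M (E v) S) ->
  adjacency A mO U M (E u) (E v) ->
  forall h k, A h -> vge (E u) k h -> vge (E v) k h.
Proof.
move=> hpt hadj h k Ah hk; have hRu := excE u; have hRv := excE v.
case: (eqVneq h 0) => [->|h0].
  by rewrite /vge mul0r; apply: subring0; apply: exc_subring.
(* Positive order along E_u places [h] in [mO], the hypothesis of [arc_of_order]; order 0 is treated
   apart. *)
case: k hk => [|k] hk; first by rewrite /vge expr0 divr1; exact: (model_sub (exc_M hRv) Ah).
have Oh : mO h.
  rewrite -(exc_over hRu); split=> //; apply/(vge1 hRu); exact: vge_le hk.
have [l hl nl] := vge_bounded v Ah h0.
case: (leqP k.+1 l) => lk; first exact: vge_le hl.
have [p pv np] := arc_of_order Oh hl nl hpt.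
have [_ cl] := hadj p pv; case: np.
apply: (cl [set b | exists2 n : nat, (n < k.+1)%N & b = U h n]); last by exists l.
by move=> q hq _ [n hn ->]; apply: arcs_through_order hq Ah hk _ hn.
Qed.

End Arcs.

(** * The intersection lattice *)

Section Lattice.
Variables (Rt : realType) (hG : negative_definite Rt G).

Definition zdot (x : G -> int) v : int := \sum_j x j * inter v j.

Lemma zdot_adj (x y : G -> int) : \sum_v x v * zdot y v = \sum_v y v * zdot x v.
Proof.
rewrite /zdot; under eq_bigr do rewrite mulr_sumr; rewrite exchange_big /=.
apply: eq_bigr => j _; rewrite mulr_sumr; apply: eq_bigr => i _.
by rewrite inter_sym; ring.
Qed.

Lemma zdotD (x y : G -> int) v : zdot (fun j => x j + y j) v = zdot x v + zdot y v.
Proof. by rewrite /zdot -big_split /=; apply: eq_bigr => j _; rewrite mulrDl. Qed.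

Lemma zdotZ (c : int) (x : G -> int) v : zdot (fun j => c * x j) v = c * zdot x v.
Proof. by rewrite /zdot mulr_sumr; apply: eq_bigr => j _; rewrite mulrA. Qed.

Lemma sum_delta (x : G -> int) u : \sum_v x v * (v == u)%:R = x u.
Proof.
rewrite (bigD1 u) //= eqxx mulr1 big1 ?addr0 // => v /negPf->; exact: mulr0.
Qed.

Lemma incidenceE (i j : 'I_#|G|) : incidence G i j = inter (enum_val i) (enum_val j).
Proof.
by rewrite mxE /inter (inj_eq enum_val_inj); case: eqP => [->|].
Qed.

Lemma zdot_neg (x : G -> int) v : x v != 0 -> \sum_j x j * zdot x j < 0.
Proof.
move=> xv; pose r : 'rV[Rt]_#|G| := \row_i (x (enum_val i))%:~R.
have r0 : r != 0.
  apply: contraNneq xv => /rowP /(_ (enum_rank v)); rewrite !mxE enum_rankK => /eqP.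
  by rewrite intr_eq0.
have := hG r0; suff -> : (r *m map_mx intr (incidence G) *m r^T) 0 0 =
    (\sum_j x j * zdot x j)%:~R by rewrite ltrz0.
rewrite mxE rmorph_sum /= [RHS](reindex_onto enum_val enum_rank) /=; last by move=> i _; rewrite enum_rankK.
under [RHS]eq_bigl do rewrite enum_valK eqxx.
apply: eq_bigr => i _; rewrite !mxE rmorphM /= mulrC; congr (_ * _).
rewrite /zdot rmorph_sum /= [RHS](reindex_onto enum_val enum_rank) /=; last by move=> j _; rewrite enum_rankK.
under [RHS]eq_bigl do rewrite enum_valK eqxx.
apply: eq_bigr => j _; rewrite [r _ _]mxE [map_mx _ _ _ _]mxE incidenceE inter_sym.
by rewrite [RHS]rmorphM.
Qed.

Lemma selfint_neg v : selfint v < 0.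
Proof.
have := @zdot_neg (fun j => (j == v)%:R) v; rewrite eqxx => /(_ isT).
rewrite (eq_bigr (fun j => zdot (fun k => (k == v)%:R) j * (j == v)%:R)) => [|j _]; last exact: mulrC.
rewrite sum_delta /zdot (eq_bigr (fun j => inter v j * (j == v)%:R)) => [|j _]; last exact: mulrC.
by rewrite sum_delta /inter eqxx.
Qed.

(** Write x = p - n with p, n nonnegative of disjoint support. Then n.x = n.p - n.n, where n.p >= 0,
    and a nonzero n would give n.n < 0 and n.x > 0. *)
Lemma antinef_ge0 (x : G -> int) : (forall v, zdot x v <= 0) -> forall v, 0 <= x v.
Proof.
move=> hx v; rewrite leNgt; apply/negP => xv.
pose n j := if x j < 0 then - x j else 0.
pose p j := if x j < 0 then 0 else x j.
have ex j : x j = p j + -1 * n j by rewrite /p /n; case: ifP => _; ring.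
have nv : n v != 0 by rewrite /n xv oppr_eq0 lt_eqF.
have h1 := zdot_neg nv.
have n0 j : 0 <= n j by rewrite /n; case: ifP => // /ltW; rewrite oppr_ge0.
have p0 j : 0 <= p j by rewrite /p; case: ltP.
have h2 : \sum_j n j * zdot x j <= 0 by apply: sumr_le0 => j _; apply: mulr_ge0_le0.
have h3 : 0 <= \sum_j n j * zdot p j.
  apply: sumr_ge0 => j _; rewrite /zdot mulr_sumr; apply: sumr_ge0 => i _.
  rewrite /inter; case: eqP => [->|_].
    by rewrite /n /p; case: ifP => _; rewrite ?mul0r ?mulr0.
  by apply: mulr_ge0 => //; apply: mulr_ge0.
have : \sum_j n j * zdot x j = \sum_j n j * zdot p j - \sum_j n j * zdot n j.
  rewrite -sumrN -big_split /=; apply: eq_bigr => j _.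
  have -> : zdot x j = zdot p j + -1 * zdot n j.
    by rewrite -zdotZ -zdotD; apply: eq_bigr => i _; rewrite ex.
  by ring.
move=> e; move: h2; rewrite e lerBlDr add0r => /(le_trans h3) h2.
by have := le_lt_trans h2 h1; rewrite ltxx.
Qed.

(** Cramer's rule over the integers: N is the absolute value of the determinant, nonzero by
    definiteness, and its sign is moved into the solution. *)
Lemma zdot_solve (t : G -> int) : exists2 N : int, 0 < N &
  exists x : G -> int, forall v, zdot x v = - N * t v.
Proof.
pose I := incidence G.
have d0 : \det I != 0.
  have : \det (map_mx (intr : int -> Rt) I) != 0.
    apply/det0P => -[r r0 e]; have := hG r0; rewrite e mul0mx mxE ltxx; by [].
  by rewrite det_map_mx intr_eq0.
exists `|\det I|; first by rewrite normr_gt0.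
pose y := \adj I *m \col_i t (enum_val i).
exists (fun j => - Num.sg (\det I) * y (enum_rank j) 0) => v.
have : (I *m y) (enum_rank v) 0 = \det I * t v.
  by rewrite mulmxA mul_mx_adj mul_scalar_mx !mxE enum_rankK.
rewrite mxE => e; rewrite zdotZ normrEsg.
have -> : zdot (fun j => y (enum_rank j) 0) v = \det I * t v.
  rewrite -e /zdot (reindex_onto enum_val enum_rank) /=; last by move=> j _; rewrite enum_rankK.
  under eq_bigl do rewrite enum_valK eqxx.
  by apply: eq_bigr => i _; rewrite incidenceE enum_rankK enum_valK mulrC.
by ring.
Qed.

Lemma zdot_auto (phi : {perm G}) (x : G -> int) v : graph_automorphism phi ->
  zdot (fun j => x ((phi^-1)%g j)) (phi v) = zdot x v.
Proof.
move=> [hE' _ hs]; rewrite /zdot (reindex_inj (@perm_inj _ phi)) /=.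
apply: eq_bigr => j _; rewrite permK; congr (_ * _).
by rewrite /inter (inj_eq perm_inj) hs hE'.
Qed.

Lemma separating_cycle (phi : {perm G}) u : graph_automorphism phi -> phi u <> u ->
  exists D : G -> nat, [/\ forall j, wdot D j <= 0,
    forall j, wdot (cycle_add D (cycle_unit (phi u))) j <= 0 & (D (phi u) < D u)%N].
Proof.
move=> hphi /eqP nfix; set v := phi u.
have [N N0 [w hw]] := zdot_solve (fun j => (j == u)%:R).
pose w' j := w ((phi^-1)%g j).
have hw' j : zdot w' j = - N * (j == v)%:R.
  rewrite -[j](permKV phi) zdot_auto // hw /v (inj_eq perm_inj).
  by [].
(* Both sides, times -N, are the intersection number of the two dual cycles. *)
have w'u : w' u = w v.
  have := zdot_adj w' w.
  under eq_bigr do rewrite hw mulrCA; rewrite -mulr_sumr sum_delta.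
  under eq_bigr do rewrite hw' mulrCA; rewrite -mulr_sumr sum_delta.
  by apply: mulfI; rewrite oppr_eq0 gt_eqF.
have w'v : w' v = w u by rewrite /w' /v permK.
have wuv : w v < w u.
  pose z j := w j + -1 * w' j.
  have hz j : zdot z j = - N * (j == u)%:R + N * (j == v)%:R.
    by rewrite zdotD zdotZ hw hw'; ring.
  have : \sum_j z j * zdot z j = - N * (z u - z v).
    under eq_bigr do rewrite hz mulrDr.
    rewrite big_split /=; under eq_bigr do rewrite mulrCA; rewrite -mulr_sumr sum_delta.
    by under eq_bigr do rewrite mulrCA; rewrite -mulr_sumr sum_delta; ring.
  have [j zj] : exists j, z j != 0.
    apply: contrapT => hn; have := hz u.
    have -> : zdot z u = 0.
      by apply: big1 => j _; case: (eqVneq (z j) 0) => [->|zj]; [rewrite mul0r|case: hn; exists j].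
    rewrite eqxx (negPf (_ : u != v)) 1?eq_sym // mulr1 mulr0 addr0 => /eqP.
    by rewrite eq_sym oppr_eq0 gt_eqF.
  move=> e; have := zdot_neg zj; rewrite e mulNr oppr_lt0 pmulr_rgt0 // /z w'u w'v.
  lia.
(* The correction [b] supplies the slack |E_j.E_v| that keeps D + E_v antinef. The factor C then
   makes the gap of [w] between u and v outweigh whatever [b] does to it. *)
have [N' N'0 [b hb]] := zdot_solve (fun j => `|inter j v|).
pose C := 1 + `|b u - b v|; pose D j := C * w j + b j.
have hD j : zdot D j = - (C * N) * (j == u)%:R - N' * `|inter j v|.
  by rewrite zdotD zdotZ hw hb; ring.
have C0 : 0 < C by rewrite /C; lia.
have hD0 j : zdot D j <= - `|inter j v|.
  have : 0 <= C * N * (j == u)%:R by rewrite !mulr_ge0 // ltW.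
  have : `|inter j v| <= N' * `|inter j v| by rewrite ler_peMl //; lia.
  rewrite hD; lia.
have D0 : forall j, 0 <= D j by apply: antinef_ge0 => j; have := hD0 j; lia.
have ed j : wdot (fun k => `|D k|%N) j = zdot D j.
  by apply: eq_bigr => k _; rewrite gez0_abs.
exists (fun k => `|D k|%N); split.
- by move=> j; rewrite ed; have := hD0 j; lia.
- by move=> j; rewrite wdotD wdot_unit ed; have := hD0 j; lia.
- rewrite -ltz_nat !gez0_abs // /D.
  have : C <= C * (w u - w v) by rewrite ler_peMr; lia.
  rewrite /C; lia.
Qed.

End Lattice.

(** * Comparison of the two colength bounds *)

Lemma no_adjacency (phi : {perm G}) (B : comAlgType K) (U : F -> nat -> B) u
  (Rt : realType) : negative_definite Rt G ->
  graph_automorphism phi -> represents_arcs iota A mO U -> phi u <> u ->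
  ~ adjacency A mO U M (E u) (E (phi u)).
Proof.
move=> hG hphi hU nfix hadj; set v := phi u in hadj.
have hself := selfint_neg hG.
have hpts j : exists S, points_on M (E j) S.
  by apply: points_nonempty; rewrite lt_eqF.
have hord := adjacency_order hU (hpts v) hadj.
have [D [hD hD' Duv]] := separating_cycle hG hphi nfix.
have [f Of f0] : exists2 f, mO f & f != 0.
  have hR := excE u; have [_ _ /(_ (unif (E u)))[a [b [Aa Ab b0 e]]]] := surface_affine.
  exists a; last by have := unif_n0 hR; rewrite e mulf_eq0 invr_eq0 negb_or => /andP[].
  rewrite -(exc_over hR); split=> //.
  have -> : a = b * unif (E u) by rewrite e mulrC divfK.
  apply: (primeMl (exc_prime hR)); last exact: maxid_unif.
  exact: (model_sub (exc_M hR) Ab).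
have Af := mO_sub Of.
have hZ j : exists k, vge (E j) k f /\ ~ vge (E j) k.+1 f.
  by have [k h1 h2] := vge_bounded j Af f0; exists k.
pose Z j := xget 0%N [set k | vge (E j) k f /\ ~ vge (E j) k.+1 f].
have hZ' j : vge (E j) (Z j) f /\ ~ vge (E j) (Z j).+1 f.
  by have [w hw] := hZ j; rewrite /Z; case: xgetP => [y _ //|/(_ w)].
have fge j : vge (E j) (Z j) f by case: (hZ' j).
have flt j : ~ vge (E j) (Z j).+1 f by case: (hZ' j).
have Z1 j : (0 < Z j)%N.
  case: (posnP (Z j)) => // Z0; case: (flt j); rewrite Z0.
  by apply/(vge1 (excE j)); move: Of; rewrite -(exc_over (excE j)) => -[].
have Zneg j : wdot Z j <= 0.
  have [_ h0 hd e] := strict_transform_degree Af fge (flt j).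
  have [S hS] := hpts j; have := fsum_ge_term hd h0 hS; have := h0 S hS.
  by rewrite /divisor_degree in e; rewrite e; lia.
have [c hc] := lower_bound Of f0 fge flt.
(* All multiplicities of [Z] are positive, so this [lam] makes lam Z at least D', and X = lam Z - D'
   is effective. *)
pose D' := cycle_add D (cycle_unit v); pose lam := (\sum_j D' j)%N.
pose X j := (lam * Z j - D' j)%N.
have lamD j : (D' j <= lam * Z j)%N.
  apply: leq_trans (leq_pmulr lam (Z1 j)).
  by rewrite /lam (bigD1 j) //= leq_addr.
pose c1 := (pathcost D + pathcost X)%N.
(* One more than the coefficient of the total linear error, so that n^2 exceeds that error. *)
pose n := (c1 + 2 * c * lam).+1.
pose nD j := (n * D j)%N; pose nD' j := (n * D' j)%N; pose nZ j := (n * lam * Z j)%N.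
have [|d1 s1 b1] := @spans_blocks hpts hself (fun=> 0%N) D n.
  move=> k _ j; rewrite wdotD wdot_scale.
  have -> : wdot (fun=> 0%N) j = 0 by apply: big1 => i _; rewrite mul0r.
  by rewrite add0r mulr_ge0_le0.
(* The cycle reached after k copies of X is (n - k) D' + k lam Z, a nonnegative combination of
   antinef cycles. *)
have [|d3 s3 b3] := @spans_blocks hpts hself nD' X n.
  move=> k kn j; rewrite wdotD !wdot_scale.
  have -> : wdot X j = lam%:Z * wdot Z j - wdot D' j.
    rewrite -wdot_scale; apply/eqP; rewrite eq_sym subr_eq -wdotD; apply/eqP.
    by apply: eq_bigr => i _; rewrite /cycle_add /X subnK.
  have e : n%:Z * wdot D' j + k%:Z * (lam%:Z * wdot Z j - wdot D' j) =
     (n - k)%N%:Z * wdot D' j + (k * lam)%N%:Z * wdot Z j.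
    by rewrite -subzn 1?ltnW // PoszM; ring.
  rewrite e; have h1 : (n - k)%N%:Z * wdot D' j <= 0 by apply: mulr_ge0_le0 => //; apply: hD'.
  have h2 : (k * lam)%N%:Z * wdot Z j <= 0 by apply: mulr_ge0_le0 => //; apply: Zneg.
  lia.
have eqW W W' : (forall j, W j = W' j) -> cycle_ideal W = cycle_ideal W' /\ cycle_form W = cycle_form W'.
  by move=> h; have -> : W = W' by apply: funext.
have [eI1 eQ1] := eqW (cycle_add (fun=> 0%N) (fun j => (n * D j)%N)) nD (fun j => erefl).
have [|eI3 eQ3] := eqW (cycle_add nD' (fun j => (n * X j)%N)) nZ.
  by move=> j; rewrite /cycle_add /nD' /X /nZ -mulnDr subnKC // mulnA.
rewrite eI1 eQ1 cycle_ideal0 in s1 b1; rewrite eI3 eQ3 in s3 b3.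
(* The only use of the adjacency: D_v + 1 <= D_u, and orders along E_u bound those along E_v from
   below. *)
have s2 : spans iota (cycle_ideal nD) (cycle_ideal nD') 0.
  apply: spans0 => h [Ah hh]; split=> // j; rewrite /nD' /D' /cycle_add /cycle_unit.
  case: eqP => [->|_]; last by rewrite addn0; apply: hh.
  have le : (n * (D v + true) <= n * D u)%N by rewrite leq_mul2l addn1 Duv orbT.
  by apply: (hord h) => //; apply: (vge_le (excE u) le); apply: hh.
have le1 : cycle_ideal nD `<=` A by move=> h [].
have le2 : cycle_ideal nD' `<=` cycle_ideal nD.
  by apply: cycle_ideal_le => j; rewrite leq_mul2l leq_addr orbT.
have sA := spans_trans le1 s1 (spans_trans le2 s2 s3).
have [h ih bh] := hc (n * lam)%N.
have hle := indep_spans_le (cycle_ideal_ksub nZ) ih sA.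
have q0 : cycle_form (fun=> 0%N) = 0 by rewrite /cycle_form big1 ?oppr0 // => i _; rewrite mul0r.
have qD : cycle_form nD = n%:Z ^+ 2 * cycle_form D by apply: cycle_form_scale.
have qD' : cycle_form nD' = n%:Z ^+ 2 * (cycle_form D - 2%:R * wdot D v - selfint v) by rewrite cycle_form_scale cycle_form_unit.
have qZ : cycle_form nZ = (n * lam)%N%:Z ^+ 2 * cycle_form Z by apply: cycle_form_scale.
(* Times n^2, this is the difference of the forms at nD' and nD, which the upper bound saves. *)
have gap : 1 <= - (2%:R * wdot D v + selfint v).
  by have := hself v; have := hD v; lia.
have : n%:Z ^+ 2 <= n%:Z * (c1 + 2 * c * lam)%N%:Z.
  have : n%:Z ^+ 2 <= n%:Z ^+ 2 * - (2%:R * wdot D v + selfint v).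
    by rewrite ler_peMr // exprn_even_ge0.
  have e1 : n%:Z ^+ 2 * (cycle_form D - 2%:R * wdot D v - selfint v) =
    n%:Z ^+ 2 * cycle_form D + n%:Z ^+ 2 * - (2%:R * wdot D v + selfint v) by ring.
  rewrite q0 qD in b1; rewrite qD' qZ e1 in b3.
  rewrite /c1 !PoszD !PoszM in b1 b3 bh hle *.
  move: b1 b3 bh hle; lia.
by rewrite expr2 ler_pM2l // /n; lia.
Qed.

End Surface.

Theorem proposition35
  (R : realType) (G : weighted_graph) (hG : negative_definite R G)
  (phi : {perm G}) (hphi : graph_automorphism phi)
  (K : closedFieldType) (charK : [pchar K] =i pred0)
  (F : fieldType) (iota : {rmorphism K -> F})
  (A mO : set F) (hX : normal_surface_singularity iota A mO)
  (M : set (set F)) (hM : good_resolution iota A mO M)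
  (E : G -> set F) (hE : is_dual_graph iota A mO M E)
  (B : comAlgType K) (U : F -> nat -> B) (hB : represents_arcs iota A mO U)
  (u : G) (hu : essential iota A mO (E u)) (hfix : phi u <> u) :
  ~ adjacency A mO U M (E u) (E (phi u)).
Proof. exact: (no_adjacency hX hM hE hG hphi hB hfix). Qed.
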